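(* Let $u'''=f(x,u,u',u'')$ be a scalar third-order ODE, and write $p=u'$, $q=u''$. The necessary and sufficient conditions for equivalence of this equation, via a point transformation $\bar x=\phi(x,u)$, $\bar u=\psi(x,u)$ with $\phi_x\psi_u-\phi_u\psi_x\neq0$, to the canonical form $\bar u'''=\bar a^3(\bar x)\,\bar u$ with four point symmetries are the identical vanishing of the relative invariants $$I_1=f_{q,q,q},\qquad I_2=f_{q,q}^2+6f_{p,q,q},\qquad I_4=J_q,\qquad I_5=f_{q,q}J-6J_p,\qquad I_6=J_u-D_xJ_p,$$ $$I_7=f_{q,q}(9f_p+f_q^2-3D_xf_q)-9f_{p,p}+18f_{u,q}-6f_qf_{p,q},$$ $$I_9=K_q,\qquad I_{10}=K_p,\qquad I_{11}=f_{q,q}D_xK-6K_u,$$ where $$I_3=J^3=\tfrac{1}{54}\left(4f_q^3+18f_q(f_p-D_xf_q)+9D_x^2f_q-27D_xf_p+54f_u\right)\neq0,$$ $$I_8=\tfrac13\left((f_q^2+3f_p-3D_xf_q)J^2+6J\,D_x^2J-9(D_xJ)^2\right)\neq0,\qquad K=\frac{I_8}{J^4},\qquad D_xK\neq0.$$ Given that these relative invariants are zero and that the conditions $J^3\ne0$, $I_8\neq0$, $D_xK\neq0$ are satisfied, the linearizing point transformation $\bar x=\phi(x,u)$, $\bar u=\psi(x,u)$ is defined by $$D_x\phi=\frac{J}{b},\qquad \phi_x\psi_u-\phi_u\psi_x=\frac{J\,a_1}{b},$$ where $H(x,u)$, $b(x,u)$, $a_1(x,u,p)$ are auxiliary functions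 given by $$\frac{2}{J}D_xH+H^2=K,\qquad D_xb=(JH)\,b,\qquad D_xa_1=\left(\frac{D_xJ}{J}-\frac13f_q-JH\right)a_1.$$ Finally, the function $\bar a(\bar x)$ of the resulting canonical form is given by the equation $\bar a(\bar x)=\bar a(\phi(x,u))=b(x,u)$.
   Context: The coordinates are $(x,u,p,q)$ with $p=u'$, $q=u''$; subscripts denote partial derivatives in these coordinates (e.g. $f_{p,q,q}=\partial^3f/\partial p\,\partial q^2$), and $D_x=\partial_x+p\,\partial_u+q\,\partial_p+f\,\partial_q$ is the total derivative along the equation. All functions are smooth and all considerations are local, at generic points; $J$ is the real cube root of the expression given for $J^3$. Two third-order ODEs are equivalent via a point transformation if its prolongation to derivatives carries one equation to the other. ''Four point symmetries'' means that the Lie algebra of infinitesimal point symmetries has dimension four; for the canonical form $\bar u'''=\bar a^3(\bar x)\bar u$ this means $\bar a\neq0$ and $\left(\frac{2\bar a\bar a''-3\bar a'^2}{\bar a^4}\right)_{\bar x}\neq0$. The auxiliary functions $b$ and $a_1$ are nonvanishing. The procedure for constructing the transformation is: solve the first auxiliary equation for $H$, then the other two for $b$ and $a_1$, and finally determine the point transformation by solving the system for $\phi$ and $\psi$.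
   Formalization: The system for φ, ψ fixes ψ only up to adding g(φ), so not every solution linearizes; it is proved that each does after replacing ψ by ψ − g(φ) for some g, and that all linearizing maps solve it. The equivalence assumes I_8 is nowhere zero or identically zero near the point. *)

(* Defs.v *)
From Stdlib Require Import Reals List.
From Coquelicot Require Import Coquelicot.
Open Scope R_scope.

(* Points (x, u, p, q) with p = u' and q = u''. *)
Definition jet : Type := (R * R * R * R)%type.

Inductive coord : Set := cx | cu | cp | cq.

Definition coordinate (i : coord) (z : jet) : R :=
  let '(x, u, p, q) := z in
  match i with cx => x | cu => u | cp => p | cq => q end.

(* The restriction of g to the line through z parallel to the i-th axis. *)
Definition slice (i : coord) (g : jet -> R) (z : jet) (t : R) : R :=
  let '(x, u, p, q) := z in
  match i with
  | cx => g (t, u, p, q)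
  | cu => g (x, t, p, q)
  | cp => g (x, u, t, q)
  | cq => g (x, u, p, t)
  end.

Definition partial (i : coord) (g : jet -> R) (z : jet) : R :=
  Derive (slice i g z) (coordinate i z).

Fixpoint partials (w : list coord) (g : jet -> R) : jet -> R :=
  match w with
  | nil => g
  | i :: w' => partial i (partials w' g)
  end.

(* C^infinity on one neighbourhood of P: [Derive] is total, so the existence
   of every iterated partial derivative has to be required. *)
Definition smooth_near (g : jet -> R) (P : jet) : Prop :=
  locally P (fun z => forall w : list coord,
    continuous (partials w g) z /\
    forall i : coord, ex_derive (slice i (partials w g) z) (coordinate i z)).

Definition smooth1_near (a : R -> R) (t0 : R) : Prop :=
  locally t0 (fun t => forall n : nat, ex_derive_n a n t).

(* Functions of (x, u) and of (x, u, p) are treated through their pullbacks;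
   a pullback is smooth near P exactly when the function itself is smooth
   near the projection of P. *)
Definition pull2 (g : R -> R -> R) (z : jet) : R :=
  let '(x, u, _, _) := z in g x u.

Definition pull3 (g : R -> R -> R -> R) (z : jet) : R :=
  let '(x, u, p, _) := z in g x u p.

(* Total derivative with u''' = r; D f is the one along u''' = f. *)
Definition total (r : R) (g : jet -> R) (z : jet) : R :=
  partial cx g z + coordinate cp z * partial cu g z
  + coordinate cq z * partial cp g z + r * partial cq g z.

Definition D (f g : jet -> R) (z : jet) : R := total (f z) g z.

(* Odd extension of the cube root; [sign 0 = 0] makes it vanish at 0. *)
Definition cbrt (y : R) : R := sign y * Rpower (Rabs y) (1 / 3).

Section Invariants.

Variable f : jet -> R.

Let f_u := partial cu f.
Let f_p := partial cp f.
Let f_q := partial cq f.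
Let f_qq := partial cq (partial cq f).
Let f_pp := partial cp (partial cp f).
Let f_pq := partial cq (partial cp f).
Let f_uq := partial cq (partial cu f).

Definition I1 (z : jet) : R := partial cq f_qq z.

Definition I2 (z : jet) : R := f_qq z ^ 2 + 6 * partial cq f_pq z.

Definition I3 (z : jet) : R :=
  1 / 54 * (4 * f_q z ^ 3 + 18 * f_q z * (f_p z - D f f_q z)
            + 9 * D f (D f f_q) z - 27 * D f f_p z + 54 * f_u z).

Definition J (z : jet) : R := cbrt (I3 z).

Definition I4 (z : jet) : R := partial cq J z.

Definition I5 (z : jet) : R := f_qq z * J z - 6 * partial cp J z.

Definition I6 (z : jet) : R := partial cu J z - D f (partial cp J) z.

Definition I7 (z : jet) : R :=
  f_qq z * (9 * f_p z + f_q z ^ 2 - 3 * D f f_q z)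
  - 9 * f_pp z + 18 * f_uq z - 6 * f_q z * f_pq z.

Definition I8 (z : jet) : R :=
  1 / 3 * ((f_q z ^ 2 + 3 * f_p z - 3 * D f f_q z) * J z ^ 2
           + 6 * J z * D f (D f J) z - 9 * D f J z ^ 2).

Definition K (z : jet) : R := I8 z / J z ^ 4.

Definition I9 (z : jet) : R := partial cq K z.

Definition I10 (z : jet) : R := partial cp K z.

Definition I11 (z : jet) : R := f_qq z * D f K z - 6 * partial cu K z.

Definition invariant_conditions (P : jet) : Prop :=
  locally P (fun z =>
    (I1 z = 0 /\ I2 z = 0 /\ I4 z = 0 /\ I5 z = 0 /\ I6 z = 0 /\
     I7 z = 0 /\ I9 z = 0 /\ I10 z = 0 /\ I11 z = 0) /\
    (I3 z <> 0 /\ I8 z <> 0 /\ D f K z <> 0)).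

(* Genericity: near P the relative invariant I8 is either nowhere zero or
   identically zero.  Without it necessity fails pointwise: on the canonical
   form I8 = 2 a a'' - 3 a'^2, which may have isolated zeros although a <> 0
   and D_x K <> 0. *)
Definition generic_point (P : jet) : Prop :=
  locally P (fun z => I8 z <> 0) \/ locally P (fun z => I8 z = 0).

End Invariants.

Definition jacobian (phi psi : R -> R -> R) (z : jet) : R :=
  partial cx (pull2 phi) z * partial cu (pull2 psi) z
  - partial cu (pull2 phi) z * partial cx (pull2 psi) z.

(* Prolongation of xbar = phi(x,u), ubar = psi(x,u) to ubar', ubar'', ubar'''.
   In the first two the differentiated functions do not depend on q, so the
   value chosen for u''' is immaterial; in the third u''' = r. *)
Definition prolong1 (phi psi : R -> R -> R) (z : jet) : R :=
  total 0 (pull2 psi) z / total 0 (pull2 phi) z.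

Definition prolong2 (phi psi : R -> R -> R) (z : jet) : R :=
  total 0 (prolong1 phi psi) z / total 0 (pull2 phi) z.

Definition prolong3 (phi psi : R -> R -> R) (r : R) (z : jet) : R :=
  total r (prolong2 phi psi) z / total r (pull2 phi) z.

(* D_x phi <> 0 is what makes the prolongation defined at the jets near P. *)
Definition point_transformation (phi psi : R -> R -> R) (P : jet) : Prop :=
  smooth_near (pull2 phi) P /\ smooth_near (pull2 psi) P /\
  locally P (fun z => jacobian phi psi z <> 0 /\ total 0 (pull2 phi) z <> 0).

Definition carries (phi psi : R -> R -> R) (f F : jet -> R) (P : jet) : Prop :=
  point_transformation phi psi P /\
  locally P (fun z => forall r : R,
    r = f z <->
    prolong3 phi psi r z =
      F (pull2 phi z, pull2 psi z, prolong1 phi psi z, prolong2 phi psi z)).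

Definition canonical (a : R -> R) (z : jet) : R :=
  let '(x, u, _, _) := z in a x ^ 3 * u.

(* For ubar''' = a^3 ubar, where J = a and K = (2 a a'' - 3 a'^2) / a^4, a
   four-dimensional Lie algebra of point symmetries means a <> 0 and K' <> 0;
   a = 0 or constant K give a larger algebra. *)
Definition four_symmetries (a : R -> R) (t0 : R) : Prop :=
  locally t0 (fun t =>
    a t <> 0 /\
    Derive (fun s => (2 * a s * Derive_n a 2 s - 3 * Derive a s ^ 2) / a s ^ 4) t
      <> 0).

Definition carries_to_canonical
    (f : jet -> R) (phi psi : R -> R -> R) (a : R -> R) (P : jet) : Prop :=
  smooth1_near a (pull2 phi P) /\ four_symmetries a (pull2 phi P) /\
  carries phi psi f (canonical a) P.

Definition equivalent_to_canonical (f : jet -> R) (P : jet) : Prop :=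
  exists (phi psi : R -> R -> R) (a : R -> R), carries_to_canonical f phi psi a P.

Definition aux_H (f : jet -> R) (H : R -> R -> R) (P : jet) : Prop :=
  smooth_near (pull2 H) P /\
  locally P (fun z => 2 / J f z * D f (pull2 H) z + pull2 H z ^ 2 = K f z).

Definition aux_b (f : jet -> R) (H b : R -> R -> R) (P : jet) : Prop :=
  smooth_near (pull2 b) P /\
  locally P (fun z =>
    pull2 b z <> 0 /\ D f (pull2 b) z = (J f z * pull2 H z) * pull2 b z).

Definition aux_a1
    (f : jet -> R) (H : R -> R -> R) (a1 : R -> R -> R -> R) (P : jet) : Prop :=
  smooth_near (pull3 a1) P /\
  locally P (fun z =>
    pull3 a1 z <> 0 /\
    D f (pull3 a1) z =
      (D f (J f) z / J f z - 1 / 3 * partial cq f z - J f z * pull2 H z)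
      * pull3 a1 z).

Definition auxiliary (f : jet -> R) (H b : R -> R -> R)
    (a1 : R -> R -> R -> R) (P : jet) : Prop :=
  aux_H f H P /\ aux_b f H b P /\ aux_a1 f H a1 P.

Definition transformation_system (f : jet -> R) (b : R -> R -> R)
    (a1 : R -> R -> R -> R) (phi psi : R -> R -> R) (P : jet) : Prop :=
  smooth_near (pull2 phi) P /\ smooth_near (pull2 psi) P /\
  locally P (fun z =>
    D f (pull2 phi) z = J f z / pull2 b z /\
    jacobian phi psi z = J f z * pull3 a1 z / pull2 b z).

(* Main.v *)
From Stdlib Require Import Ranalysis5 Lra Lia List FunctionalExtensionality ClassicalEpsilon.
From Stdlib Require Import Reals.
From Coquelicot Require Import Coquelicot.
Require Import Defs.
Open Scope R_scope.

(** Everything is expressed through the derivation D = D_x along the equation and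
    its commutators with the partial derivatives. For a transformation (phi, psi)
    put A = D phi and m = jacobian / A. Differentiating the relations
    ubar_(i+1) = D ubar_i / A with respect to u, p and q shows that the equation is
    carried to ubar_3 = a(xbar)^3 ubar + c(xbar) for some c exactly when
    D^3 - f_q D^2 - f_p D - f_u = (A^3 / m) ((D / A)^3 - a^3) m. Then J = a A,
    a_1 = m, and K is (2 a a_xx - 3 a_x^2) / a^4 evaluated at phi.

    Conversely, write E(g) = g_u - D g_p + D^2 g_q. The identity
    54 (I_3)_q = 3 I_7 + 9 E(f_q) turns I_4 = I_7 = 0 into E(f_q) = 0. A function g
    with g_q = 0 and g_u = D g_p is linear in p and equals D of a function of
    (x, u). This applies to J, to J H, to 2 D J / J - f_q / 3 - J H and to J / b, and
    yields H (through a linear second order equation, K being a function of a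
    potential of J), b, a_1 and phi. The function psi is found by straightening
    phi, and c(xbar) is removed by solving g_xxx = abar^3 g + c. *)

(** The auxiliary equations arise by comparing coefficients. With b = abar(phi) and A = J / b, the
    formula f_q = 3 (D A / A - D m / m) becomes the equation for a_1; the formula for f_p amounts to
    the Riccati equation for H = D b / (J b); the formula for f_u defines J as a cube root. Both
    directions rest on the identities [I3_form] and [I8_form]: read one way they compute J and K,
    read the other way they recover f_u and f_p from H, b and a_1. The analytic obstacle is that
    [Derive] is total and that smoothness means continuity and differentiability of all iterated
    partial derivatives. Calculations therefore take place on one open set where every function
    involved is smooth. Objects given by an existence argument (ODE solutions, parameter integrals,
    implicit functions) are shown smooth by a single device: their partial derivatives are algebraic
    in themselves and in functions already known to be smooth. *)

Ltac jet_ext := apply functional_extensionality; now intros [[[x u] p] q].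

(** * Partial derivatives and smoothness on open sets of jets *)

Definition move (i : coord) (z : jet) (t : R) : jet :=
  let '(x, u, p, q) := z in
  match i with
  | cx => (t, u, p, q)
  | cu => (x, t, p, q)
  | cp => (x, u, t, q)
  | cq => (x, u, p, t)
  end.

Lemma slice_move (i : coord) (g : jet -> R) (z : jet) (t : R) :
  slice i g z t = g (move i z t).
Proof. destruct z as [[[x u] p] q], i; reflexivity. Qed.

Lemma slice_coordinate (i : coord) (g : jet -> R) (z : jet) :
  slice i g z (coordinate i z) = g z.
Proof. destruct z as [[[x u] p] q], i; reflexivity. Qed.

Lemma locally_move (i : coord) (z : jet) (Q : jet -> Prop) :
  locally z Q -> locally (coordinate i z) (fun t => Q (move i z t)).
Proof.
  intros [eps Heps]. exists eps. intros t Ht. apply Heps.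
  destruct z as [[[x u] p] q], i; simpl in *;
    repeat split; simpl; try apply ball_center; exact Ht.
Qed.

Lemma locally_slice_eq (i : coord) (g h : jet -> R) (z : jet) :
  locally z (fun y => g y = h y) ->
  locally (coordinate i z) (fun t => slice i g z t = slice i h z t).
Proof.
  intros E. apply (filter_imp _ _ (fun t H => eq_trans (slice_move i g z t)
    (eq_trans H (eq_sym (slice_move i h z t))))).
  exact (locally_move i z _ E).
Qed.

Lemma partial_ext_loc (i : coord) (g h : jet -> R) (z : jet) :
  locally z (fun y => g y = h y) -> partial i g z = partial i h z.
Proof. intros E. apply Derive_ext_loc, locally_slice_eq, E. Qed.

(** Only the four partial derivatives, not total differentiability: enough for sums, products and
    post-composition with a function of one variable. The two-variable chain rule goes through
    [smooth_near] instead. *)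
Definition dif (g : jet -> R) (z : jet) : Prop :=
  forall i : coord, ex_derive (slice i g z) (coordinate i z).

Lemma dif_ext_loc (g h : jet -> R) (z : jet) :
  locally z (fun y => g y = h y) -> dif g z -> dif h z.
Proof.
  intros E G i. apply (ex_derive_ext_loc (slice i g z)), G.
  apply locally_slice_eq, E.
Qed.

Lemma continuous_jet_ext_loc (g h : jet -> R) (z : jet) :
  locally z (fun y => g y = h y) -> continuous g z -> continuous h z.
Proof. intros E. apply continuous_ext_loc, E. Qed.

Lemma partial_is_derive (i : coord) (g : jet -> R) (z : jet) :
  dif g z -> is_derive (slice i g z) (coordinate i z) (partial i g z).
Proof. intros G. apply Derive_correct, G. Qed.

(** [smooth_near g P] is [locally P (smooth_at g)] by conversion. With [smooth_on] and a fixed open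
    set, repeated differentiation never shrinks the neighbourhood. *)
Definition smooth_at (g : jet -> R) (z : jet) : Prop :=
  forall w : list coord, continuous (partials w g) z /\ dif (partials w g) z.

Definition smooth_on (U : jet -> Prop) (g : jet -> R) : Prop :=
  forall z, U z -> smooth_at g z.

Lemma locally_open_ext {T : UniformSpace} (U : T -> Prop) (Q : T -> Prop) (z : T) :
  open U -> U z -> (forall y, U y -> Q y) -> locally z Q.
Proof. intros O Z H. exact (filter_imp _ _ H (O z Z)). Qed.

Lemma partials_ext_on (U : jet -> Prop) (g h : jet -> R) (w : list coord) :
  open U -> (forall z, U z -> g z = h z) ->
  forall z, U z -> partials w g z = partials w h z.
Proof.
  intros O E. induction w as [|i w IH]; simpl; intros z Z; [now apply E|].
  apply partial_ext_loc. now apply (locally_open_ext U).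
Qed.

Lemma smooth_on_ext (U : jet -> Prop) (g h : jet -> R) :
  open U -> (forall z, U z -> g z = h z) -> smooth_on U g -> smooth_on U h.
Proof.
  intros O E G z Z w.
  assert (L : locally z (fun y => partials w g y = partials w h y)).
  { apply (locally_open_ext U); auto. intros y Y. now apply (partials_ext_on U). }
  split.
  - apply (continuous_jet_ext_loc _ _ _ L), G, Z.
  - apply (dif_ext_loc _ _ _ L), G, Z.
Qed.

Lemma smooth_on_partial (U : jet -> Prop) (g : jet -> R) (i : coord) :
  smooth_on U g -> smooth_on U (partial i g).
Proof.
  intros G z Z w.
  assert (E : partials w (partial i g) = partials (w ++ i :: nil) g).
  { induction w as [|j w IH]; simpl; [reflexivity | now rewrite IH]. }
  rewrite E. apply G, Z.
Qed.

Lemma smooth_on_continuous (U : jet -> Prop) (g : jet -> R) (z : jet) :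
  smooth_on U g -> U z -> continuous g z.
Proof. intros G Z. exact (proj1 (G z Z nil)). Qed.

Lemma smooth_on_dif (U : jet -> Prop) (g : jet -> R) (z : jet) :
  smooth_on U g -> U z -> dif g z.
Proof. intros G Z. exact (proj2 (G z Z nil)). Qed.

Lemma smooth_on_subset (U V : jet -> Prop) (g : jet -> R) :
  (forall z, V z -> U z) -> smooth_on U g -> smooth_on V g.
Proof. intros H G z Z. apply G, H, Z. Qed.

Lemma smooth_on_near (U : jet -> Prop) (g : jet -> R) (P : jet) :
  open U -> U P -> smooth_on U g -> smooth_near g P.
Proof. intros O UP G. now apply (locally_open_ext U). Qed.

Lemma locally_open_nbhd {T : UniformSpace} (P : T) (Q : T -> Prop) :
  locally P Q -> exists U : T -> Prop, open U /\ U P /\ forall z, U z -> Q z.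
Proof.
  intros H. exists (fun z => locally z Q). repeat split.
  - intros z Z. now apply locally_locally.
  - exact H.
  - intros z Z. now apply locally_singleton.
Qed.

(** * Functions of two variables *)

Lemma locally_pull2 (Q : R -> R -> Prop) (x u p q : R) :
  locally ((x, u, p, q) : jet) (fun z => let '(x', u', _, _) := z in Q x' u')
  <-> locally_2d Q x u.
Proof.
  split; intros [eps H]; exists eps.
  - intros a b Ha Hb. apply (H (a, b, p, q)). repeat split; simpl;
      first [exact Ha | exact Hb | apply ball_center].
  - intros [[[a b] c] d] [[[Ha Hb] _] _]. now apply H.
Qed.

Lemma locally_plane (Q : jet -> Prop) (x u p q : R) :
  locally ((x, u, p, q) : jet) Q -> locally_2d (fun a b => Q (a, b, p, q)) x u.
Proof.
  intros [eps H]. exists eps. intros a b A B. apply H.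
  repeat split; simpl; first [exact A | exact B | apply ball_center].
Qed.

(** A predicate blind to p and q may be tested over any fibre point; this permits the fibre (0, 0)
    as a placeholder for functions of (x, u). *)
Lemma locally_pull2' (Q : jet -> Prop) (x u p q p' q' : R) :
  (forall a b c d c' d', Q (a, b, c, d) -> Q (a, b, c', d')) ->
  locally ((x, u, p, q) : jet) Q -> locally ((x, u, p', q') : jet) Q.
Proof.
  intros HQ [eps H]. exists eps. intros [[[a b] c] d] [[[Ha Hb] _] _].
  apply HQ with (c := p) (d := q), H. repeat split; simpl; auto; apply ball_center.
Qed.

Lemma continuous_pull2 (G : R -> R -> R) (x u p q : R) :
  continuous (pull2 G) ((x, u, p, q) : jet) <-> continuity_2d_pt G x u.
Proof.
  split.
  - intros C eps. apply (locally_pull2 (fun a b => Rabs (G a b - G x u) < eps) x u p q).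
    specialize (C (ball (G x u) eps) (locally_ball _ eps)). unfold filtermap in C.
    refine (filter_imp _ _ _ C). intros [[[a b] c] d] H. exact H.
  - intros C Q [eps HQ]. specialize (C eps).
    apply (locally_pull2 _ x u p q) in C.
    refine (filter_imp _ _ _ C). intros [[[a b] c] d] H. apply HQ, H.
Qed.

Lemma partial_pull2_cx (G : R -> R -> R) :
  partial cx (pull2 G) = pull2 (fun x u => Derive (fun t => G t u) x).
Proof. jet_ext. Qed.

Lemma partial_pull2_cu (G : R -> R -> R) :
  partial cu (pull2 G) = pull2 (fun x u => Derive (fun t => G x t) u).
Proof. jet_ext. Qed.

Lemma partial_pull2_cp (G : R -> R -> R) : partial cp (pull2 G) = pull2 (fun _ _ => 0).
Proof.
  apply functional_extensionality. intros [[[x u] p] q].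
  exact (Derive_const (G x u) p).
Qed.

Lemma partial_pull2_cq (G : R -> R -> R) : partial cq (pull2 G) = pull2 (fun _ _ => 0).
Proof.
  apply functional_extensionality. intros [[[x u] p] q].
  exact (Derive_const (G x u) q).
Qed.

Lemma partials_pull2 (w : list coord) (G : R -> R -> R) :
  exists G' : R -> R -> R, partials w (pull2 G) = pull2 G'.
Proof.
  induction w as [|i w [G' IH]]; simpl; [now exists G|]. rewrite IH.
  destruct i; eexists;
    [apply partial_pull2_cx | apply partial_pull2_cu
    | apply partial_pull2_cp | apply partial_pull2_cq].
Qed.

Lemma dif_pull2 (G : R -> R -> R) (x u p q : R) :
  dif (pull2 G) (x, u, p, q) <->
  ex_derive (fun t => G t u) x /\ ex_derive (fun t => G x t) u.
Proof.
  split.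
  - intros H. split; [exact (H cx) | exact (H cu)].
  - intros [Hx Hu] []; simpl; auto; apply ex_derive_const.
Qed.

Lemma smooth_at_pull2 (G : R -> R -> R) (x u p q p' q' : R) :
  smooth_at (pull2 G) (x, u, p, q) -> smooth_at (pull2 G) (x, u, p', q').
Proof.
  intros H w. destruct (H w) as [C Df]. destruct (partials_pull2 w G) as [G' E].
  rewrite E in *. split.
  - apply continuous_pull2 in C. now apply continuous_pull2.
  - apply dif_pull2 in Df. now apply dif_pull2.
Qed.

Lemma smooth_near_pull2 (G : R -> R -> R) (x u p q p' q' : R) :
  smooth_near (pull2 G) (x, u, p, q) -> smooth_near (pull2 G) (x, u, p', q').
Proof.
  apply (locally_pull2' (smooth_at (pull2 G))). intros. eapply smooth_at_pull2; eauto.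
Qed.

Lemma locally_2d_swap (Q : R -> R -> Prop) (x u : R) :
  locally_2d Q x u -> locally_2d (fun a b => Q b a) u x.
Proof. intros [d H]. exists d. auto. Qed.

(** The mean value argument needs one partial derivative in a neighbourhood, continuous at the
    point, and the other only at the point itself. *)
Lemma differentiable_of_partials (G Gx : R -> R -> R) (x u l : R) :
  locally_2d (fun a b => is_derive (fun t => G t b) a (Gx a b)) x u ->
  continuity_2d_pt Gx x u ->
  is_derive (fun t => G x t) u l ->
  differentiable_pt_lim G x u (Gx x u) l.
Proof.
  intros L C E. apply filterdiff_differentiable_pt_lim.
  apply is_derive_filterdiff with (dfx := Gx); auto.
  - now apply (locally_2d_locally (fun a b => is_derive (fun t => G t b) a (Gx a b))).
  - now apply (continuity_2d_pt_filterlim Gx x u).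
Qed.

(** Partial derivatives alone give no chain rule; smoothness supplies the continuous x-derivative
    that makes [G] totally differentiable. [p] and [q] only name a fibre point. *)
Lemma is_derive_comp2 (G : R -> R -> R) (a b : R -> R) (t la lb p q : R) :
  smooth_near (pull2 G) (a t, b t, p, q) ->
  is_derive a t la -> is_derive b t lb ->
  is_derive (fun s => G (a s) (b s)) t
    (partial cx (pull2 G) (a t, b t, p, q) * la
     + partial cu (pull2 G) (a t, b t, p, q) * lb).
Proof.
  intros S Ha Hb.
  apply is_derive_Reals. apply is_derive_Reals in Ha, Hb.
  apply derivable_pt_lim_comp_2d; auto.
  apply (differentiable_of_partials G (fun x u => Derive (fun s => G s u) x)).
  - apply (locally_pull2 _ (a t) (b t) p q).
    refine (filter_imp _ _ _ S). intros [[[x u] p'] q'] H.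
    apply Derive_correct. exact (proj2 (H nil) cx).
  - destruct (locally_singleton _ _ S (cx :: nil)) as [C _]. simpl in C.
    rewrite partial_pull2_cx in C. now apply continuous_pull2 in C.
  - apply Derive_correct. exact (proj2 (locally_singleton _ _ S nil) cu).
Qed.

(** * Closure properties of smooth functions *)

(* [B] is a set of generators; a generator is adjoined to the smooth functions
   on [U] by showing that its partial derivatives are again in the algebra. *)
Inductive alg (U : jet -> Prop) (B : (jet -> R) -> Prop) : (jet -> R) -> Prop :=
| alg_base g : B g -> alg U B g
| alg_const c : alg U B (fun _ => c)
| alg_plus g h : alg U B g -> alg U B h -> alg U B (fun z => g z + h z)
| alg_mult g h : alg U B g -> alg U B h -> alg U B (fun z => g z * h z)
| alg_inv g : alg U B g -> (forall z, U z -> g z <> 0) -> alg U B (fun z => / g z)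
| alg_comp2 G a b : alg U B a -> alg U B b ->
    (forall z, U z -> smooth_near (pull2 G) (a z, b z, 0, 0)) ->
    alg U B (fun z => G (a z) (b z)).

(** One order of regularity, with the partial derivatives handed back to the algebra so that the
    property can be iterated. *)
Definition step (U : jet -> Prop) (B : (jet -> R) -> Prop) (g : jet -> R) : Prop :=
  (forall z, U z -> continuous g z /\ dif g z) /\
  forall i, exists h, alg U B h /\ forall z, U z -> partial i g z = h z.

Lemma partial_eq (i : coord) (g : jet -> R) (z : jet) (l : R) :
  is_derive (slice i g z) (coordinate i z) l -> partial i g z = l.
Proof. apply is_derive_unique. Qed.

Lemma is_slice_plus i g h z lg lh :
  is_derive (slice i g z) (coordinate i z) lg ->
  is_derive (slice i h z) (coordinate i z) lh ->
  is_derive (slice i (fun z => g z + h z) z) (coordinate i z) (lg + lh).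
Proof.
  intros Hg Hh. replace (slice i (fun z => g z + h z) z) with
    (fun t => plus (slice i g z t) (slice i h z t)).
  - now apply @is_derive_plus.
  - apply functional_extensionality. intros t. now rewrite !slice_move.
Qed.

Lemma is_slice_comp1 i (k : R -> R) g z lg lk :
  is_derive (slice i g z) (coordinate i z) lg ->
  is_derive k (g z) lk ->
  is_derive (slice i (fun z => k (g z)) z) (coordinate i z) (lk * lg).
Proof.
  intros Hg Hk. replace (slice i (fun z => k (g z)) z) with
    (fun t => k (slice i g z t)).
  - rewrite Rmult_comm. apply @is_derive_comp; auto. now rewrite slice_coordinate.
  - apply functional_extensionality. intros t. now rewrite !slice_move.
Qed.

Lemma is_slice_mult i g h z lg lh :
  is_derive (slice i g z) (coordinate i z) lg ->
  is_derive (slice i h z) (coordinate i z) lh ->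
  is_derive (slice i (fun z => g z * h z) z) (coordinate i z) (lg * h z + g z * lh).
Proof.
  intros Hg Hh. replace (slice i (fun z => g z * h z) z) with
    (fun t => mult (slice i g z t) (slice i h z t)).
  - rewrite <- (slice_coordinate i g z), <- (slice_coordinate i h z).
    apply @is_derive_mult; auto. intros; apply Rmult_comm.
  - apply functional_extensionality. intros t. now rewrite !slice_move.
Qed.

Lemma is_slice_const i c z : is_derive (slice i (fun _ => c) z) (coordinate i z) 0.
Proof.
  replace (slice i (fun _ => c) z) with (fun _ : R => c).
  - apply @is_derive_const.
  - apply functional_extensionality. intros t. now rewrite slice_move.
Qed.

Lemma is_slice_comp2 i (G : R -> R -> R) a b z la lb p q :
  smooth_near (pull2 G) (a z, b z, p, q) ->
  is_derive (slice i a z) (coordinate i z) la ->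
  is_derive (slice i b z) (coordinate i z) lb ->
  is_derive (slice i (fun z => G (a z) (b z)) z) (coordinate i z)
    (partial cx (pull2 G) (a z, b z, p, q) * la
     + partial cu (pull2 G) (a z, b z, p, q) * lb).
Proof.
  intros S Ha Hb. replace (slice i (fun z => G (a z) (b z)) z) with
    (fun t => G (slice i a z t) (slice i b z t)).
  - rewrite <- (slice_coordinate i a z), <- (slice_coordinate i b z) in S |- *.
    now apply is_derive_comp2.
  - apply functional_extensionality. intros t. now rewrite !slice_move.
Qed.

Lemma is_derive_Rinv (x : R) : x <> 0 -> is_derive Rinv x (- / x ^ 2).
Proof. intros H. auto_derive; auto. field; auto. Qed.

Lemma smooth_near_partial (g : jet -> R) (i : coord) (P : jet) :
  smooth_near g P -> smooth_near (partial i g) P.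
Proof.
  intros H. apply locally_open_nbhd in H. destruct H as (U & O & UP & H).
  apply (smooth_on_near U); auto. now apply smooth_on_partial.
Qed.

(** The sum, product, inverse and chain rules express the derivatives of a compound through its
    parts and their derivatives, so the generators decide. *)
Lemma alg_step (U : jet -> Prop) (B : (jet -> R) -> Prop) :
  (forall g, B g -> step U B g) -> forall g, alg U B g -> step U B g.
Proof.
  intros HB g A. induction A as
    [g Bg | c | g h Ag [Cg Pg] Ah [Ch Ph] | g h Ag [Cg Pg] Ah [Ch Ph]
    | g Ag [Cg Pg] N | G a b Aa [Ca Pa] Ab [Cb Pb] HG].
  - now apply HB.
  - split.
    + intros z _. split; [apply @continuous_const|]. intros i. eexists. apply is_slice_const.
    + intros i. exists (fun _ => 0). split; [apply alg_const|]. intros z _.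
      apply partial_eq, is_slice_const.
  - split.
    + intros z Z. destruct (Cg z Z) as [cg dg], (Ch z Z) as [ch dh]. split.
      * now apply @continuous_plus.
      * intros i. eexists. apply is_slice_plus; apply partial_is_derive; auto.
    + intros i. destruct (Pg i) as (g' & Ag' & Eg), (Ph i) as (h' & Ah' & Eh).
      exists (fun z => g' z + h' z). split; [now apply alg_plus|]. intros z Z.
      rewrite <- Eg, <- Eh by auto. apply partial_eq, is_slice_plus;
        apply partial_is_derive; [apply Cg | apply Ch]; auto.
  - split.
    + intros z Z. destruct (Cg z Z) as [cg dg], (Ch z Z) as [ch dh]. split.
      * now apply @continuous_mult.
      * intros i. eexists. apply is_slice_mult; apply partial_is_derive; auto.
    + intros i. destruct (Pg i) as (g' & Ag' & Eg), (Ph i) as (h' & Ah' & Eh).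
      exists (fun z => g' z * h z + g z * h' z).
      split; [repeat (apply alg_plus || apply alg_mult); auto|]. intros z Z.
      rewrite <- Eg, <- Eh by auto. apply partial_eq, is_slice_mult;
        apply partial_is_derive; [apply Cg | apply Ch]; auto.
  - split.
    + intros z Z. destruct (Cg z Z) as [cg dg]. split.
      * apply continuous_comp; auto. apply @ex_derive_continuous.
        eexists. apply is_derive_Rinv, N, Z.
      * intros i. eexists. apply is_slice_comp1;
          [apply partial_is_derive; auto | apply is_derive_Rinv, N, Z].
    + intros i. destruct (Pg i) as (g' & Ag' & Eg).
      (* This is - g' / g^2, written with the operations available in [alg]. *)
      exists (fun z => -1 * (/ g z * / g z) * g' z).
      split; [repeat (apply alg_mult || apply alg_const); auto; now apply alg_inv|].
      intros z Z. rewrite <- Eg by auto.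
      replace (-1 * (/ g z * / g z) * partial i g z) with (- / g z ^ 2 * partial i g z)
        by (field; auto).
      apply partial_eq, is_slice_comp1;
        [apply partial_is_derive, Cg; auto | apply is_derive_Rinv, N, Z].
  - split.
    + intros z Z. destruct (Ca z Z) as [ca da], (Cb z Z) as [cb db]. split.
      * apply continuous_comp_2; auto.
        destruct (locally_singleton _ _ (HG z Z) nil) as [c _]. simpl in c.
        apply continuous_pull2 in c. now apply continuity_2d_pt_filterlim in c.
      * intros i. eexists. apply is_slice_comp2 with (p := 0) (q := 0);
          try apply partial_is_derive; auto.
    + intros i. destruct (Pa i) as (a' & Aa' & Ea), (Pb i) as (b' & Ab' & Eb).
      exists (fun z => Derive (fun t => G t (b z)) (a z) * a' z
                       + Derive (fun t => G (a z) t) (b z) * b' z).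
      split.
      * apply alg_plus; apply alg_mult; auto.
        -- apply (alg_comp2 U B (fun x u => Derive (fun t => G t u) x)); auto.
           intros z Z. rewrite <- partial_pull2_cx. now apply smooth_near_partial, HG.
        -- apply (alg_comp2 U B (fun x u => Derive (fun t => G x t) u)); auto.
           intros z Z. rewrite <- partial_pull2_cu. now apply smooth_near_partial, HG.
      * intros z Z. rewrite <- Ea, <- Eb by auto.
        apply partial_eq. apply is_slice_comp2 with (p := 0) (q := 0); auto;
          apply partial_is_derive; [apply Ca | apply Cb]; auto.
Qed.

(** By induction on the word, each iterated partial derivative coincides on [U] with a member of the
    algebra, and members are continuous and have partial derivatives. *)
Lemma alg_smooth (U : jet -> Prop) (B : (jet -> R) -> Prop) :
  open U -> (forall g, B g -> step U B g) -> forall g, alg U B g -> smooth_on U g.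
Proof.
  intros O HB g A.
  assert (H : forall w, exists h, alg U B h /\ forall z, U z -> partials w g z = h z).
  { induction w as [|i w (h & Ah & Eh)]; simpl; [now exists g|].
    destruct (proj2 (alg_step U B HB h Ah) i) as (h' & Ah' & Eh').
    exists h'. split; auto. intros z Z. rewrite <- Eh' by auto.
    apply partial_ext_loc. now apply (locally_open_ext U). }
  intros z Z w. destruct (H w) as (h & Ah & Eh).
  assert (L : locally z (fun y => h y = partials w g y)).
  { apply (locally_open_ext U); auto. intros; symmetry; auto. }
  destruct (proj1 (alg_step U B HB h Ah) z Z) as [c d]. split.
  - exact (continuous_jet_ext_loc _ _ _ L c).
  - exact (dif_ext_loc _ _ _ L d).
Qed.

Lemma step_smooth (U : jet -> Prop) (B : (jet -> R) -> Prop) (g : jet -> R) :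
  (forall h, smooth_on U h -> B h) -> smooth_on U g -> step U B g.
Proof.
  intros HB G. split.
  - intros z Z. split; [now apply (smooth_on_continuous U) | now apply (smooth_on_dif U)].
  - intros i. exists (partial i g). split; auto. now apply alg_base, HB, smooth_on_partial.
Qed.

Lemma alg_smooth_on (U : jet -> Prop) (g : jet -> R) :
  open U -> alg U (smooth_on U) g -> smooth_on U g.
Proof. intros O. apply alg_smooth; auto. intros h. now apply step_smooth. Qed.

(** The regularity bootstrap: a family [N] of continuous functions becomes smooth as soon as its
    partial derivatives exist and are algebraic in the family itself and in smooth functions. It
    serves for ODE solutions, parameter integrals and implicit functions. *)
Lemma smooth_on_adjoin (U : jet -> Prop) (N : (jet -> R) -> Prop) :
  open U ->
  (forall g, N g -> step U (fun h => smooth_on U h \/ N h) g) ->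
  forall g, N g -> smooth_on U g.
Proof.
  intros O H g Ng.
  apply (alg_smooth U (fun h => smooth_on U h \/ N h)); auto.
  - intros h [Sh | Nh]; auto. apply step_smooth; auto.
  - now apply alg_base; right.
Qed.

Section Closure.
Variable U : jet -> Prop.
Hypothesis O : open U.

Lemma smooth_on_const c : smooth_on U (fun _ => c).
Proof. apply alg_smooth_on; auto. apply alg_const. Qed.

Lemma smooth_on_plus g h :
  smooth_on U g -> smooth_on U h -> smooth_on U (fun z => g z + h z).
Proof. intros. apply alg_smooth_on; auto. now apply alg_plus; apply alg_base. Qed.

Lemma smooth_on_mult g h :
  smooth_on U g -> smooth_on U h -> smooth_on U (fun z => g z * h z).
Proof. intros. apply alg_smooth_on; auto. now apply alg_mult; apply alg_base. Qed.

Lemma smooth_on_inv g :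
  smooth_on U g -> (forall z, U z -> g z <> 0) -> smooth_on U (fun z => / g z).
Proof. intros. apply alg_smooth_on; auto. now apply alg_inv; [apply alg_base|]. Qed.

Lemma smooth_on_comp2 (G : R -> R -> R) a b :
  smooth_on U a -> smooth_on U b ->
  (forall z, U z -> smooth_near (pull2 G) (a z, b z, 0, 0)) ->
  smooth_on U (fun z => G (a z) (b z)).
Proof. intros. apply alg_smooth_on; auto. now apply alg_comp2; try apply alg_base. Qed.

Lemma smooth_on_opp g : smooth_on U g -> smooth_on U (fun z => - g z).
Proof.
  intros G. apply (smooth_on_ext U (fun z => -1 * g z)); auto.
  - intros; ring.
  - apply smooth_on_mult; auto. apply smooth_on_const.
Qed.

Lemma smooth_on_minus g h :
  smooth_on U g -> smooth_on U h -> smooth_on U (fun z => g z - h z).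
Proof. intros. apply smooth_on_plus; auto. now apply smooth_on_opp. Qed.

Lemma smooth_on_div g h :
  smooth_on U g -> smooth_on U h -> (forall z, U z -> h z <> 0) ->
  smooth_on U (fun z => g z / h z).
Proof. intros. apply smooth_on_mult; auto. now apply smooth_on_inv. Qed.

Lemma smooth_on_pow g n : smooth_on U g -> smooth_on U (fun z => g z ^ n).
Proof.
  intros G. induction n as [|n IH]; simpl; [apply smooth_on_const|].
  now apply smooth_on_mult.
Qed.

Lemma continuous_coordinate i z : continuous (coordinate i) z.
Proof.
  destruct z as [[[x u] p] q]. intros Q [eps H]. exists eps.
  intros [[[a b] c] d] [[[A B] C] E].
  destruct i; apply H; simpl in *; assumption.
Qed.

Lemma partial_coordinate i j z :
  is_derive (slice i (coordinate j) z) (coordinate i z)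
    (match i, j with cx, cx | cu, cu | cp, cp | cq, cq => 1 | _, _ => 0 end).
Proof.
  destruct z as [[[x u] p] q].
  destruct i, j; simpl; first [apply @is_derive_id | apply @is_derive_const].
Qed.

Lemma smooth_on_coordinate j : smooth_on U (coordinate j).
Proof.
  apply (smooth_on_adjoin U (fun g => g = coordinate j)); auto.
  intros g ->. split.
  - intros z _. split; [apply continuous_coordinate|].
    intros i. eexists. apply partial_coordinate.
  - intros i. eexists. split; [apply alg_const|]. intros z _.
    apply partial_eq, partial_coordinate.
Qed.

(* Covers [exp] and the cube root, whose derivatives are smooth multiples of
   the functions themselves. *)
Lemma smooth_on_comp1_multiple (k c : R -> R) g :
  smooth_on U g ->
  (forall z, U z -> is_derive k (g z) (k (g z) * c (g z))) ->
  smooth_on U (fun z => c (g z)) ->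
  smooth_on U (fun z => k (g z)).
Proof.
  intros G Hk C.
  apply (smooth_on_adjoin U (fun h => h = fun z => k (g z))); auto.
  intros h ->. split.
  - intros z Z. split.
    + apply continuous_comp; [now apply (smooth_on_continuous U)|].
      apply @ex_derive_continuous. eexists. now apply Hk.
    + intros i. eexists. apply is_slice_comp1;
        [apply partial_is_derive, (smooth_on_dif U); auto | now apply Hk].
  - intros i. exists (fun z => k (g z) * c (g z) * partial i g z). split.
    + repeat apply alg_mult; apply alg_base; auto. left. now apply smooth_on_partial.
    + intros z Z. apply partial_eq, is_slice_comp1; auto.
      now apply partial_is_derive, (smooth_on_dif U).
Qed.

Lemma smooth_on_exp g : smooth_on U g -> smooth_on U (fun z => exp (g z)).
Proof.
  intros G. apply (smooth_on_comp1_multiple exp (fun _ => 1)); auto.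
  - intros z Z. rewrite Rmult_1_r. apply is_derive_Reals, derivable_pt_lim_exp.
  - apply smooth_on_const.
Qed.

End Closure.

(** * The real cube root *)

Lemma cbrt_cube (y : R) : cbrt y ^ 3 = y.
Proof.
  unfold cbrt. destruct (total_order_T y 0) as [[L|E]|G].
  - rewrite sign_eq_m1, Rabs_left by lra. rewrite Rpow_mult_distr.
    rewrite <- (Rpower_pow 3 (Rpower _ _)) by apply exp_pos. rewrite Rpower_mult.
    replace (1 / 3 * INR 3) with 1 by (simpl; field). rewrite Rpower_1 by lra. ring.
  - subst y. rewrite sign_0. ring.
  - rewrite sign_eq_1, Rabs_right by lra. rewrite Rpow_mult_distr.
    rewrite <- (Rpower_pow 3 (Rpower _ _)) by apply exp_pos. rewrite Rpower_mult.
    replace (1 / 3 * INR 3) with 1 by (simpl; field). rewrite Rpower_1 by lra. ring.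
Qed.

Lemma cube_inj (a b : R) : a ^ 3 = b ^ 3 -> a = b.
Proof.
  (* The cofactor a^2 + a b + b^2 is written as a sum of squares: it vanishes only for a = b = 0. *)
  intros H. assert (E : (a - b) * ((a + b / 2) ^ 2 + 3 / 4 * b ^ 2) = 0)
    by (transitivity (a ^ 3 - b ^ 3); [field | lra]).
  apply Rmult_integral in E. destruct E as [E | E]; [lra|].
  pose proof (pow2_ge_0 (a + b / 2)). pose proof (pow2_ge_0 b).
  assert (B : b = 0) by (apply Rsqr_eq_0; unfold Rsqr; nra). subst b.
  apply Rsqr_eq_0. unfold Rsqr. nra.
Qed.

(* Coquelicot's structures leave equations typed in aliases of [R], which
   [ring] and [lra] do not recognise. *)
Ltac eq_in_R := match goal with |- ?a = ?b => change (@eq R a b) end.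

(** The derivative is a rational multiple of [cbrt] itself, the shape that
    [smooth_on_comp1_multiple] asks for. Each half-line has its own exponential formula. *)
Lemma is_derive_cbrt (y : R) : y <> 0 -> is_derive cbrt y (cbrt y * / (3 * y)).
Proof.
  intros N. destruct (total_order_T y 0) as [[L|E]|G]; [|contradiction|].
  - apply (is_derive_ext_loc (fun t => - exp (1 / 3 * ln (- t)))).
    + apply (locally_open_ext (fun t => t < 0)); auto; [apply open_lt|].
      intros t T. unfold cbrt, Rpower. rewrite sign_eq_m1, Rabs_left by lra. eq_in_R. ring.
    + unfold cbrt, Rpower. rewrite sign_eq_m1, Rabs_left by lra.
      auto_derive; [lra|]. field. lra.
  - apply (is_derive_ext_loc (fun t => exp (1 / 3 * ln t))).
    + apply (locally_open_ext (fun t => 0 < t)); auto; [apply open_gt|].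
      intros t T. unfold cbrt, Rpower. rewrite sign_eq_1, Rabs_right by lra. eq_in_R. ring.
    + unfold cbrt, Rpower. rewrite sign_eq_1, Rabs_right by lra.
      auto_derive; [lra|]. field. lra.
Qed.

Lemma smooth_on_cbrt (U : jet -> Prop) (g : jet -> R) :
  open U -> smooth_on U g -> (forall z, U z -> g z <> 0) ->
  smooth_on U (fun z => cbrt (g z)).
Proof.
  intros O G N. apply (smooth_on_comp1_multiple U O cbrt (fun y => / (3 * y))); auto.
  - intros z Z. now apply is_derive_cbrt, N.
  - apply smooth_on_inv; auto.
    apply smooth_on_mult; auto. now apply smooth_on_const.
Qed.

(** * Functions of one variable *)

Lemma continuous_pull2_cx (r : R -> R) (z : jet) :
  ex_derive r (coordinate cx z) -> continuous (pull2 (fun x _ => r x)) z.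
Proof.
  intros H. replace (pull2 (fun x _ => r x)) with (fun z => r (coordinate cx z)).
  - apply (continuous_comp (coordinate cx) r); [apply continuous_coordinate|].
    now apply @ex_derive_continuous.
  - jet_ext.
Qed.

(** All derivatives of [r] are adjoined at once: the x-derivative leads from one to the next, and
    the other three partial derivatives vanish. *)
Lemma smooth_near_of_smooth1 (r : R -> R) (P : jet) :
  smooth1_near r (coordinate cx P) -> smooth_near (pull2 (fun x _ => r x)) P.
Proof.
  intros H.
  assert (L : locally P (fun z => forall n, ex_derive_n r n (coordinate cx z))).
  { exact (continuous_coordinate cx P _ H). }
  apply locally_open_nbhd in L. destruct L as (U & O & UP & L).
  apply (smooth_on_near U); auto.
  apply (smooth_on_adjoin U
    (fun g => exists n, g = pull2 (fun x _ => Derive_n r n x))); auto.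
  2: { now exists 0%nat. }
  intros g [n ->]. split.
  - intros [[[x u] p] q] Z. specialize (L _ Z). simpl in L.
    assert (D1 : ex_derive (Derive_n r n) x) by exact (L (S n)). split.
    + now apply (continuous_pull2_cx (Derive_n r n)).
    + apply dif_pull2. split; [exact D1 | apply ex_derive_const].
  - intros i. destruct i;
      [|exists (fun _ => 0); split; [apply alg_const|]; intros [[[x u] p] q] _;
        exact (Derive_const _ _)..].
    { exists (pull2 (fun x _ => Derive_n r (S n) x)). split.
         - apply alg_base. right. now exists (S n).
         - intros [[[x u] p] q] _. reflexivity. }
Qed.

Lemma smooth1_of_smooth_near (r : R -> R) (P : jet) :
  smooth_near (pull2 (fun x _ => r x)) P -> smooth1_near r (coordinate cx P).
Proof.
  intros H. apply (locally_move cx) in H. refine (filter_imp _ _ _ H).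
  (* [ex_derive_n] at order 0 is [True]; at order n + 1 it is the derivability of the n-th
     derivative, read off from the word made of n letters [cx]. *)
  intros t S n. destruct n as [|n]; [exact I|].
  assert (E : partials (repeat cx n) (pull2 (fun x _ => r x))
              = pull2 (fun x _ => Derive_n r n x)).
  { induction n as [|n IH]; simpl; [reflexivity|].
    rewrite IH, partial_pull2_cx. reflexivity. }
  destruct (S (repeat cx n)) as [_ Df]. rewrite E in Df.
  destruct P as [[[x u] p] q]. exact (Df cx).
Qed.

Lemma smooth1_near_locally (r : R -> R) (t : R) :
  smooth1_near r t -> locally t (smooth1_near r).
Proof. apply locally_locally. Qed.

Lemma smooth1_near_ex_derive (r : R -> R) (t : R) :
  smooth1_near r t -> ex_derive r t.
Proof. intros H. exact (locally_singleton _ _ H 1%nat). Qed.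

Lemma smooth1_near_Derive (r : R -> R) (t : R) :
  smooth1_near r t -> smooth1_near (Derive r) t.
Proof.
  intros H. refine (filter_imp _ _ _ H). intros s S n.
  destruct n as [|n]; [exact I|]. simpl.
  apply (ex_derive_ext (Derive_n r (n + 1))).
  - intros y. rewrite <- (Derive_n_comp r n 1 y). reflexivity.
  - rewrite Nat.add_comm. exact (S (2 + n)%nat).
Qed.

(** * Linear ordinary differential equations by Picard iteration *)

Section Picard.

Variables (t0 d : R).
Hypotheses (d_pos : 0 < d) (d_le_1 : d <= 1).

(** Retraction of the line onto [t0 - d, t0 + d]. Composing with it turns data on the interval into
    functions continuous and bounded on the whole line, on which the iteration can run. *)
Definition clamp (t : R) : R := Rmax (t0 - d) (Rmin (t0 + d) t).

Lemma clamp_bound (t : R) : t0 - d <= clamp t <= t0 + d.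
Proof.
  unfold clamp, Rmax, Rmin. destruct (Rle_dec (t0 + d) t), (Rle_dec _ _); lra.
Qed.

Lemma clamp_id (t : R) : t0 - d <= t <= t0 + d -> clamp t = t.
Proof.
  intros H. unfold clamp, Rmax, Rmin.
  destruct (Rle_dec (t0 + d) t), (Rle_dec _ _); lra.
Qed.

Lemma clamp_lipschitz (s t : R) : Rabs (clamp s - clamp t) <= Rabs (s - t).
Proof.
  unfold clamp, Rmax, Rmin, Rabs.
  repeat destruct Rle_dec; repeat destruct Rcase_abs; lra.
Qed.

Lemma continuous_clamp (t : R) : continuous clamp t.
Proof.
  intros Q [eps H]. exists eps. intros s S. apply H.
  apply Rle_lt_trans with (2 := S). apply clamp_lipschitz.
Qed.

(** An antiderivative inside the interval and constant outside, so that continuity and the bound by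
    d times a bound of [g] hold on the whole line. *)
Definition primitive (g : R -> R) (t : R) : R := RInt g t0 (clamp t).

Lemma ex_RInt_continuous_fun (g : R -> R) (a b : R) :
  (forall t, continuous g t) -> ex_RInt g a b.
Proof. intros C. apply @ex_RInt_continuous. auto. Qed.

Lemma is_derive_RInt_continuous (g : R -> R) (t : R) :
  (forall t, continuous g t) -> is_derive (RInt g t0) t (g t).
Proof.
  intros C. apply (@is_derive_RInt R_NormedModule g (RInt g t0) t0); auto.
  apply filter_forall. intros s.
  now apply (RInt_correct (V := R_CompleteNormedModule)), ex_RInt_continuous_fun.
Qed.

Lemma primitive_continuous (g : R -> R) :
  (forall t, continuous g t) -> forall t, continuous (primitive g) t.
Proof.
  intros C t. apply (continuous_comp clamp (RInt g t0)); [apply continuous_clamp|].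
  apply @ex_derive_continuous. eexists. now apply is_derive_RInt_continuous.
Qed.

Lemma primitive_bound (g : R -> R) (C : R) :
  (forall t, continuous g t) -> (forall t, Rabs (g t) <= C) ->
  forall t, Rabs (primitive g t) <= d * C.
Proof.
  intros Cg B t. unfold primitive.
  pose proof (clamp_bound t). assert (0 <= C) by
    (apply Rle_trans with (Rabs (g t)); [apply Rabs_pos | apply B]).
  apply Rle_trans with (Rabs (clamp t - t0) * C).
  - destruct (Rle_dec t0 (clamp t)) as [L|L].
    + rewrite (Rabs_pos_eq (clamp t - t0)) by lra.
      apply abs_RInt_le_const; auto. now apply ex_RInt_continuous_fun.
    + rewrite <- opp_RInt_swap by now apply ex_RInt_continuous_fun.
      unfold opp; simpl. rewrite Rabs_Ropp, (Rabs_left (clamp t - t0)) by lra.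
      replace (- (clamp t - t0)) with (t0 - clamp t) by ring.
      apply abs_RInt_le_const; auto; [lra|]. now apply ex_RInt_continuous_fun.
  - apply Rmult_le_compat_r; auto. apply Rabs_le. lra.
Qed.

Lemma primitive_minus (g h : R -> R) :
  (forall t, continuous g t) -> (forall t, continuous h t) ->
  forall t, primitive (fun s => g s - h s) t = primitive g t - primitive h t.
Proof.
  intros Cg Ch t. unfold primitive.
  apply (RInt_minus (V := R_CompleteNormedModule) g h);
    now apply ex_RInt_continuous_fun.
Qed.

Lemma primitive_plus (g h : R -> R) :
  (forall t, continuous g t) -> (forall t, continuous h t) ->
  forall t, primitive (fun s => g s + h s) t = primitive g t + primitive h t.
Proof.
  intros Cg Ch t. unfold primitive.
  apply (RInt_plus (V := R_CompleteNormedModule) g h);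
    now apply ex_RInt_continuous_fun.
Qed.

Lemma is_derive_primitive (g : R -> R) (t : R) :
  (forall t, continuous g t) -> t0 - d < t < t0 + d ->
  is_derive (primitive g) t (g t).
Proof.
  intros C T. apply (is_derive_ext_loc (RInt g t0)).
  - apply (locally_open_ext (fun s => t0 - d < s /\ s < t0 + d)); auto.
    + apply open_and; [apply open_gt | apply open_lt].
    + intros s S. unfold primitive. rewrite clamp_id by lra. reflexivity.
  - now apply is_derive_RInt_continuous.
Qed.

Lemma primitive_t0 (g : R -> R) : primitive g t0 = 0.
Proof. unfold primitive. rewrite clamp_id by lra. apply (RInt_point t0 g). Qed.

Definition primitives (n : nat) (g : R -> R) : R -> R := Nat.iter n primitive g.

Lemma primitives_continuous (n : nat) (g : R -> R) :
  (forall t, continuous g t) -> forall t, continuous (primitives n g) t.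
Proof. intros C. induction n; simpl; auto. now apply primitive_continuous. Qed.

(** As d <= 1, keeping a single factor d is enough for any number of integrations; one smallness
    condition on d then serves equations of every order. *)
Lemma primitives_bound (n : nat) (g : R -> R) (C : R) :
  (forall t, continuous g t) -> (forall t, Rabs (g t) <= C) ->
  forall t, Rabs (primitives (S n) g t) <= d * C.
Proof.
  intros Cg B. assert (0 <= C) by
    (apply Rle_trans with (Rabs (g 0)); [apply Rabs_pos | apply B]).
  induction n as [|n IH]; intros t.
  - now apply primitive_bound.
  - apply Rle_trans with (d * (d * C)); [|assert (0 <= d * C) by nra; nra].
    apply (primitive_bound (primitives (S n) g)); auto.
    now apply primitives_continuous.
Qed.

Lemma primitives_minus (n : nat) (g h : R -> R) :
  (forall t, continuous g t) -> (forall t, continuous h t) ->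
  forall t, primitives n (fun s => g s - h s) t = primitives n g t - primitives n h t.
Proof.
  intros Cg Ch. induction n as [|n IH]; intros t; [reflexivity|]. simpl.
  rewrite <- primitive_minus by now apply primitives_continuous.
  f_equal. now apply functional_extensionality.
Qed.

Lemma primitives_plus (n : nat) (g h : R -> R) :
  (forall t, continuous g t) -> (forall t, continuous h t) ->
  forall t, primitives n (fun s => g s + h s) t = primitives n g t + primitives n h t.
Proof.
  intros Cg Ch. induction n as [|n IH]; intros t; [reflexivity|]. simpl.
  rewrite <- primitive_plus by now apply primitives_continuous.
  f_equal. now apply functional_extensionality.
Qed.

Variables (n : nat) (k e : R -> R) (M C : R).
Hypotheses (k_cont : forall t, continuous k t) (k_bound : forall t, Rabs (k t) <= M)
  (e_cont : forall t, continuous e t) (e_bound : forall t, Rabs (e t) <= C)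
  (dM : d * M <= 1 / 2).

(** The Volterra operator of y^(n+1) = k y: initial data and inhomogeneity sit in [e], and solutions
    are the fixed points of e + T. *)
Let T (g : R -> R) : R -> R := primitives (S n) (fun s => k s * g s).

Lemma T_cont (g : R -> R) : (forall t, continuous g t) -> forall t, continuous (T g) t.
Proof.
  intros Cg. apply primitives_continuous. intros t. now apply @continuous_mult.
Qed.

(** By linearity and [primitives_bound] the ratio is at most d M <= 1/2, whatever the order. *)
Lemma T_contracts (g h : R -> R) (B : R) :
  (forall t, continuous g t) -> (forall t, continuous h t) ->
  (forall t, Rabs (g t - h t) <= B) -> forall t, Rabs (T g t - T h t) <= B / 2.
Proof.
  intros Cg Ch H t. unfold T.
  rewrite <- primitives_minus by (intros; now apply @continuous_mult).
  assert (0 <= B) by (apply Rle_trans with (2 := H 0); apply Rabs_pos).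
  apply Rle_trans with (d * (M * B)); [|assert (d * M * B <= 1 / 2 * B) by nra; nra].
  apply primitives_bound.
  - intros s. now apply @continuous_minus; apply @continuous_mult.
  - intros s. replace (k s * g s - k s * h s) with (k s * (g s - h s)) by ring.
    rewrite Rabs_mult. apply Rmult_le_compat; auto; apply Rabs_pos.
Qed.

Fixpoint picard (j : nat) : R -> R :=
  match j with
  | O => fun _ => 0
  | S j => fun t => e t + T (picard j) t
  end.

Lemma picard_cont (j : nat) : forall t, continuous (picard j) t.
Proof.
  induction j as [|j IH]; intros t; simpl; [apply @continuous_const|].
  apply @continuous_plus; auto. now apply T_cont.
Qed.

Lemma picard_step (j : nat) (t : R) : Rabs (picard (S j) t - picard j t) <= C * (/ 2) ^ j.
Proof.
  revert t. induction j as [|j IH]; intros t.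
  - simpl. replace (e t + T (fun _ => 0) t - 0) with (e t).
    + rewrite Rmult_1_r. apply e_bound.
    + assert (Z : T (fun _ => 0) t - T (fun _ => 0) t = T (fun _ => 0) t).
      { unfold T. rewrite <- primitives_minus.
        - f_equal. apply functional_extensionality. intros; ring.
        - intros; apply @continuous_mult; auto. apply @continuous_const.
        - intros; apply @continuous_mult; auto. apply @continuous_const. }
      lra.
  - simpl picard. replace (e t + T (fun t => e t + T (picard j) t) t - (e t + T (picard j) t))
      with (T (picard (S j)) t - T (picard j) t) by (simpl; ring).
    replace (C * (/ 2) ^ S j) with (C * (/ 2) ^ j / 2) by (simpl; field).
    apply T_contracts; auto; apply picard_cont.
Qed.

(** A segment of a geometric series; the subtracted term is what lets the induction on [i] close. *)
Lemma picard_cauchy (j i : nat) (t : R) :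
  Rabs (picard (i + j) t - picard j t) <= 2 * C * (/ 2) ^ j - 2 * C * (/ 2) ^ (i + j).
Proof.
  induction i as [|i IH]; [simpl; rewrite Rminus_diag, Rabs_R0; lra|].
  simpl Nat.add. pose proof (picard_step (i + j) t) as H.
  replace (picard (S (i + j)) t - picard j t) with
    ((picard (S (i + j)) t - picard (i + j) t) + (picard (i + j) t - picard j t)) by ring.
  apply Rle_trans with (1 := Rabs_triang _ _). simpl pow. lra.
Qed.

(** The limit is taken pointwise, but the geometric bound is uniform in t; it passes to the limit
    and yields both continuity and the fixed point equation. *)
Lemma picard_limit :
  exists y : R -> R, (forall t, continuous y t) /\ forall t, y t = e t + T y t.
Proof.
  assert (C0 : 0 <= C) by (apply Rle_trans with (2 := e_bound 0); apply Rabs_pos).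
  assert (small : forall eps, 0 < eps -> exists N, forall j, (N <= j)%nat ->
    2 * C * (/ 2) ^ j < eps).
  { intros eps E. destruct (pow_lt_1_zero (/ 2)) with (y := eps / (2 * C + 1)) as [N HN].
    - rewrite Rabs_pos_eq; lra.
    - apply Rdiv_lt_0_compat; lra.
    - exists N. intros j J. specialize (HN j J).
      rewrite Rabs_pos_eq in HN by (apply pow_le; lra).
      apply (Rmult_lt_compat_l (2 * C + 1)) in HN; [|lra].
      replace ((2 * C + 1) * (eps / (2 * C + 1))) with eps in HN by (field; lra).
      pose proof (pow_le (/ 2) j). lra. }
  assert (lim : forall t, ex_finite_lim_seq (fun j => picard j t)).
  { intros t. apply ex_lim_seq_cauchy_corr. intros eps.
    destruct (small (eps / 2)) as [N HN]; [destruct eps; simpl; lra|].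
    assert (A : forall a, (N <= a)%nat -> Rabs (picard a t - picard N t) < eps / 2).
    { intros a Ha. replace a with ((a - N) + N)%nat by lia.
      apply Rle_lt_trans with (1 := picard_cauchy N (a - N) t).
      specialize (HN N (le_n N)).
      assert (0 <= 2 * C * (/ 2) ^ (a - N + N)).
      { apply Rmult_le_pos; [lra | apply pow_le; lra]. }
      lra. }
    exists N. intros a b Ha Hb. pose proof (A a Ha). pose proof (A b Hb) as Hb'.
    rewrite Rabs_minus_sym in Hb'.
    replace (picard a t - picard b t) with
      ((picard a t - picard N t) + (picard N t - picard b t)) by ring.
    apply Rle_lt_trans with (1 := Rabs_triang _ _). lra. }
  set (y := fun t => real (Lim_seq (fun j => picard j t))).
  assert (close : forall j t, Rabs (y t - picard j t) <= 2 * C * (/ 2) ^ j).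
  { intros j t.
    assert (L : is_lim_seq (fun i => Rabs (picard (i + j) t - picard j t))
                  (Rabs (y t - picard j t))).
    { apply (is_lim_seq_abs _ (Finite (y t - picard j t))).
      apply is_lim_seq_minus'; [|apply is_lim_seq_const].
      apply (is_lim_seq_incr_n (fun i => picard i t) j). apply Lim_seq_correct', lim. }
    refine (is_lim_seq_le _ (fun _ => 2 * C * (/ 2) ^ j) _ (Finite _) _ L
              (is_lim_seq_const _)).
    intros i. apply Rle_trans with (1 := picard_cauchy j i t).
    assert (0 <= 2 * C * (/ 2) ^ (i + j)) by
      (apply Rmult_le_pos; [lra | apply pow_le; lra]). lra. }
  assert (yc : forall t, continuous y t).
  { intros t. apply filterlim_locally. intros eps.
    destruct (small (eps / 3)) as [N HN]; [destruct eps; simpl; lra|].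
    specialize (HN N (le_n N)).
    assert (c := picard_cont N t).
    assert (E3 : 0 < eps / 3) by (destruct eps; simpl; lra).
    apply filterlim_locally with (eps := mkposreal _ E3) in c.
    refine (filter_imp _ _ _ c). intros s S.
    change (Rabs (picard N s - picard N t) < eps / 3) in S.
    change (Rabs (y s - y t) < eps).
    pose proof (close N s). pose proof (close N t) as ct. rewrite Rabs_minus_sym in ct.
    replace (y s - y t) with
      ((y s - picard N s) + ((picard N s - picard N t) + (picard N t - y t))) by ring.
    apply Rle_lt_trans with (1 := Rabs_triang _ _).
    assert (A := Rabs_triang (picard N s - picard N t) (picard N t - y t)). lra. }
  exists y. split; auto. intros t.
  apply Rminus_diag_uniq. apply cond_eq. intros eps E. rewrite Rminus_0_r.
  destruct (small eps E) as [N HN].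
  pose proof (close (S N) t) as c1.
  assert (c2 := T_contracts (picard N) y (2 * C * (/ 2) ^ N) (picard_cont N) yc).
  assert (c3 : Rabs (T (picard N) t - T y t) <= 2 * C * (/ 2) ^ N / 2).
  { apply c2. intros s. rewrite Rabs_minus_sym. apply close. }
  (* The difference is split at the iterate N + 1, whose definition turns the rest into T (picard N)
     - T y. *)
  replace (y t - (e t + T y t)) with
    ((y t - picard (S N) t) + (T (picard N) t - T y t)) by (simpl; ring).
  apply Rle_lt_trans with (1 := Rabs_triang _ _).
  specialize (HN N (le_n N)). simpl pow in c1. lra.
Qed.

End Picard.

(** [Y j] stands for the j-th derivative of the solution [Y 0], so only first derivatives occur. The
    order of the equation is n + 1. *)
Lemma linear_ode (n : nat) (k r : R -> R) (t0 c : R) :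
  locally t0 (fun t => continuous k t) -> locally t0 (fun t => continuous r t) ->
  exists Y : nat -> R -> R, Y 0%nat t0 = c /\
    locally t0 (fun t =>
      (forall j, (j < n)%nat -> is_derive (Y j) t (Y (S j) t)) /\
      is_derive (Y n) t (k t * Y 0%nat t + r t)).
Proof.
  intros Hk Hr. destruct (filter_and _ _ Hk Hr) as [eps Heps].
  (* Half of eps keeps the closed interval, where boundedness is needed, inside the open one. *)
  set (a := eps / 2). assert (a0 : 0 < a) by (unfold a; destruct eps; simpl; lra).
  assert (near : forall t, t0 - a <= t <= t0 + a -> continuous k t /\ continuous r t).
  { intros t Ht. apply Heps. change (Rabs (t - t0) < eps).
    apply Rle_lt_trans with a; [apply Rabs_le; lra|]. unfold a. destruct eps; simpl; lra. }
  set (k' := fun t => k (clamp t0 a t)). set (r' := fun t => r (clamp t0 a t)).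
  assert (k'c : forall t, continuous k' t).
  { intros t. apply (continuous_comp (clamp t0 a) k); [now apply continuous_clamp|].
    apply near, clamp_bound; auto. }
  assert (r'c : forall t, continuous r' t).
  { intros t. apply (continuous_comp (clamp t0 a) r); [now apply continuous_clamp|].
    apply near, clamp_bound; auto. }
  assert (bounded : forall g, (forall t, t0 - a <= t <= t0 + a -> continuous g t) ->
    exists B, forall t, Rabs (g (clamp t0 a t)) <= B).
  { intros g Hg.
    destruct (continuity_ab_maj (fun t => Rabs (g t)) (t0 - a) (t0 + a)) as [m [Hm _]].
    - lra.
    - intros t Ht. apply continuity_pt_filterlim.
      apply (continuous_comp g Rabs); [now apply Hg | apply continuous_Rabs].
    - exists (Rabs (g m)). intros t. apply Hm, clamp_bound; auto. }
  destruct (bounded k) as [M HM]; [apply near|].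
  destruct (bounded r) as [B HB]; [apply near|].
  assert (M0 : 0 <= M) by (apply Rle_trans with (2 := HM 0); apply Rabs_pos).
  (* Three constraints: d <= 1, an interval on which the data are continuous, and d M <= 1/2. The
     summand 1 keeps the denominator positive when M = 0. *)
  set (d := Rmin (Rmin 1 a) (/ (2 * (M + 1)))).
  assert (P0 : 0 < / (2 * (M + 1))) by (apply Rinv_0_lt_compat; lra).
  assert (d0 : 0 < d) by (unfold d; repeat apply Rmin_glb_lt; lra).
  assert (d1 : d <= 1 /\ d <= a /\ d <= / (2 * (M + 1))).
  { unfold d. pose proof (Rmin_l (Rmin 1 a) (/ (2 * (M + 1)))).
    pose proof (Rmin_r (Rmin 1 a) (/ (2 * (M + 1)))).
    pose proof (Rmin_l 1 a). pose proof (Rmin_r 1 a). lra. }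
  assert (dM : d * M <= 1 / 2).
  { apply Rle_trans with (/ (2 * (M + 1)) * (M + 1)).
    - apply Rmult_le_compat; lra.
    - right. field. lra. }
  (* Initial value c at t0; the derivatives of order 1 to n start from zero. *)
  set (e := fun t => c + primitives t0 d (S n) r' t).
  destruct (picard_limit t0 d d0 (proj1 d1) n k' e M (Rabs c + d * B)) as (y & yc & Hy);
    auto.
  { intros t. apply @continuous_plus; [apply @continuous_const|].
    now apply primitives_continuous. }
  { intros t. apply Rle_trans with (1 := Rabs_triang _ _). apply Rplus_le_compat_l.
    now apply primitives_bound. }
  set (g := fun t => k' t * y t + r' t).
  assert (gc : forall t, continuous g t).
  { intros t. apply @continuous_plus; auto. now apply @continuous_mult. }
  assert (yE : forall t, y t = c + primitives t0 d (S n) g t).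
  { intros t. rewrite Hy. unfold e, g.
    rewrite primitives_plus; auto; [ring|]. intros; now apply @continuous_mult. }
  (* Differentiating n + 1 primitives of [g] j times leaves n + 1 - j of them. The case j = 0 stands
     apart because of the constant c. *)
  exists (fun j => match j with O => y | S i => primitives t0 d (S n - S i) g end).
  split.
  { rewrite yE. simpl. rewrite primitive_t0; auto. ring. }
  apply (locally_open_ext (fun t => t0 - d < t /\ t < t0 + d)).
  { apply open_and; [apply open_gt | apply open_lt]. }
  { lra. }
  intros t T.
  assert (der : forall m, is_derive (primitives t0 d (S m) g) t (primitives t0 d m g t)).
  { intros m. apply is_derive_primitive; auto. now apply primitives_continuous. }
  assert (dery : is_derive y t (primitives t0 d n g t)).
  { apply (is_derive_ext (fun t => c + primitives t0 d (S n) g t)); [symmetry; apply yE|].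
    rewrite <- Rplus_0_l. apply @is_derive_plus; [apply @is_derive_const | apply der]. }
  assert (gt : k t * y t + r t = g t).
  { unfold g, k', r'. rewrite !clamp_id by lra. reflexivity. }
  split.
  - intros [|i] Hi.
    + replace (S n - 1)%nat with n by lia. exact dery.
    + replace (S n - S i)%nat with (S (S n - S (S i))) by lia. apply der.
  - rewrite gt. destruct n as [|m]; [exact dery|].
    replace (S (S m) - S m)%nat with 1%nat by lia. exact (der 0%nat).
Qed.

(** [Y 0], ..., [Y n] are adjoined together: each derives to the next, and the last to k Y 0 + r,
    which lies in the algebra they generate with the data. *)
Lemma linear_ode_smooth (n : nat) (k r : R -> R) (t0 c : R) :
  smooth1_near k t0 -> smooth1_near r t0 ->
  exists y : R -> R, y t0 = c /\ smooth1_near y t0 /\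
    locally t0 (fun t => Derive_n y (S n) t = k t * y t + r t).
Proof.
  intros Sk Sr.
  assert (cont : forall g, smooth1_near g t0 -> locally t0 (fun t => continuous g t)).
  { intros g Sg. refine (filter_imp _ _ _ (smooth1_near_locally _ _ Sg)). intros t H.
    apply @ex_derive_continuous. now apply smooth1_near_ex_derive. }
  destruct (linear_ode n k r t0 c (cont k Sk) (cont r Sr)) as (Y & Y0 & HY).
  exists (Y 0%nat). split; [exact Y0|].
  apply locally_open_nbhd in HY. destruct HY as (V & OV & Vt & HY).
  split.
  - set (P := (t0, 0, 0, 0) : jet).
    apply (smooth1_of_smooth_near (Y 0%nat) P).
    assert (L : locally P (fun z => V (coordinate cx z)
      /\ smooth_at (pull2 (fun x _ => k x)) z /\ smooth_at (pull2 (fun x _ => r x)) z)).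
    { repeat apply filter_and.
      - apply (continuous_coordinate cx P). now apply OV.
      - apply (smooth_near_of_smooth1 k P Sk).
      - apply (smooth_near_of_smooth1 r P Sr). }
    apply locally_open_nbhd in L. destruct L as (U & O & UP & L).
    apply (smooth_on_near U); auto.
    apply (smooth_on_adjoin U
      (fun g => exists j, (j <= n)%nat /\ g = pull2 (fun x _ => Y j x))); auto.
    2: { exists 0%nat. split; auto. lia. }
    set (Y' := fun j => if Nat.ltb j n then Y (S j) else fun x => k x * Y 0%nat x + r x).
    assert (dY : forall j t, (j <= n)%nat -> V t -> is_derive (Y j) t (Y' j t)).
    { intros j t J Ht. unfold Y'. destruct (Nat.ltb_spec j n) as [A|A].
      - now apply HY.
      - replace j with n by lia. now apply HY. }
    intros g (j & J & ->). split.
    + intros [[[x u] p] q] Z. destruct (L _ Z) as (Vx & _). simpl in Vx. split.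
      * apply (continuous_pull2_cx (Y j)). eexists. now apply dY.
      * apply dif_pull2. split; [eexists; now apply dY | apply ex_derive_const].
    + intros i. destruct i;
      [|exists (fun _ => 0); split; [apply alg_const|]; intros [[[x u] p] q] _;
        exact (Derive_const _ _)..].
    { exists (pull2 (fun x _ => Y' j x)). split.
           - unfold Y'. destruct (Nat.ltb_spec j n) as [A|A].
             + apply alg_base. right. exists (S j). split; auto.
             + replace (pull2 (fun x _ => k x * Y 0%nat x + r x)) with
                 (fun z => pull2 (fun x _ => k x) z * pull2 (fun x _ => Y 0%nat x) z
                           + pull2 (fun x _ => r x) z).
               * apply alg_plus; [apply alg_mult|]; apply alg_base.
                 -- left. intros z Z. now apply L.
                 -- right. exists 0%nat. split; auto. lia.
                 -- left. intros z Z. now apply L.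
               * jet_ext.
           - intros [[[x u] p] q] Z. apply partial_eq. simpl. apply dY; auto.
             now apply (L _ Z). }
  - apply (locally_open_ext V); auto.
    assert (E : forall j, (j <= n)%nat -> forall t, V t -> Derive_n (Y 0%nat) j t = Y j t).
    { induction j as [|j IH]; intros J t Ht; [reflexivity|]. simpl.
      rewrite (Derive_ext_loc _ (Y j)).
      - apply is_derive_unique, HY; auto.
      - apply (locally_open_ext V); auto. intros s Hs. apply IH; auto. lia. }
    intros t Ht. simpl. rewrite (Derive_ext_loc _ (Y n)).
    + apply is_derive_unique, HY; auto.
    + apply (locally_open_ext V); auto.
Qed.

(** * Closure properties at a point *)

Lemma smooth_near_open (g : jet -> R) (P : jet) :
  smooth_near g P -> exists U, open U /\ U P /\ smooth_on U g.
Proof. apply (locally_open_nbhd P (smooth_at g)). Qed.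

Lemma smooth_near_locally (g : jet -> R) (P : jet) :
  smooth_near g P -> locally P (smooth_near g).
Proof. apply locally_locally. Qed.

Lemma smooth_near_continuous (g : jet -> R) (P : jet) :
  smooth_near g P -> continuous g P.
Proof. intros S. exact (proj1 (locally_singleton _ _ S nil)). Qed.

Lemma smooth_near_dif (g : jet -> R) (P : jet) : smooth_near g P -> dif g P.
Proof. intros S. exact (proj2 (locally_singleton _ _ S nil)). Qed.

Lemma smooth_near_ext_loc (g h : jet -> R) (P : jet) :
  locally P (fun z => g z = h z) -> smooth_near g P -> smooth_near h P.
Proof.
  intros E G. destruct (locally_open_nbhd P _ (filter_and _ _ E G)) as (U & O & UP & H).
  apply (smooth_on_near U); auto. apply (smooth_on_ext U g); auto; try (intros z Z; decompose [and] (H z Z); assumption).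
Qed.

Lemma smooth_near_const (c : R) (P : jet) : smooth_near (fun _ => c) P.
Proof.
  apply (smooth_on_near (fun _ => True)); auto; [apply open_true|].
  apply smooth_on_const, open_true.
Qed.

Lemma smooth_near_coordinate (i : coord) (P : jet) : smooth_near (coordinate i) P.
Proof.
  apply (smooth_on_near (fun _ => True)); auto; [apply open_true|].
  apply smooth_on_coordinate, open_true.
Qed.

Lemma smooth_near_open2 (g h : jet -> R) (P : jet) :
  smooth_near g P -> smooth_near h P ->
  exists U, open U /\ U P /\ smooth_on U g /\ smooth_on U h.
Proof.
  intros G H. destruct (locally_open_nbhd P _ (filter_and _ _ G H)) as (U & O & UP & A).
  exists U. split; [|split; [|split]]; auto; try (intros z Z; decompose [and] (A z Z); assumption).
Qed.

Lemma smooth_near_binary (op : (jet -> R) -> (jet -> R) -> jet -> R) (g h : jet -> R) P :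
  (forall U, open U -> smooth_on U g -> smooth_on U h -> smooth_on U (op g h)) ->
  smooth_near g P -> smooth_near h P -> smooth_near (op g h) P.
Proof.
  intros E G H. destruct (smooth_near_open2 g h P G H) as (U & O & UP & A & B).
  apply (smooth_on_near U); auto.
Qed.

Lemma smooth_near_plus (g h : jet -> R) (P : jet) :
  smooth_near g P -> smooth_near h P -> smooth_near (fun z => g z + h z) P.
Proof. apply (smooth_near_binary (fun g h z => g z + h z)). auto using smooth_on_plus. Qed.

Lemma smooth_near_mult (g h : jet -> R) (P : jet) :
  smooth_near g P -> smooth_near h P -> smooth_near (fun z => g z * h z) P.
Proof. apply (smooth_near_binary (fun g h z => g z * h z)). auto using smooth_on_mult. Qed.

Lemma smooth_near_minus (g h : jet -> R) (P : jet) :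
  smooth_near g P -> smooth_near h P -> smooth_near (fun z => g z - h z) P.
Proof. apply (smooth_near_binary (fun g h z => g z - h z)). auto using smooth_on_minus. Qed.

Lemma continuous_nonzero (g : jet -> R) (P : jet) :
  continuous g P -> g P <> 0 -> locally P (fun z => g z <> 0).
Proof. intros C N. exact (C _ (open_neq 0 (g P) N)). Qed.

Lemma smooth_near_div (g h : jet -> R) (P : jet) :
  smooth_near g P -> smooth_near h P -> h P <> 0 -> smooth_near (fun z => g z / h z) P.
Proof.
  intros G H N. assert (N' := continuous_nonzero h P (smooth_near_continuous h P H) N).
  destruct (locally_open_nbhd P _ (filter_and _ _ N' (filter_and _ _ G H)))
    as (U & O & UP & A).
  apply (smooth_on_near U); auto.
  apply smooth_on_div; auto; try (intros z Z; decompose [and] (A z Z); assumption).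
Qed.

Lemma locally_comp2 (a b : jet -> R) (Q : R -> R -> Prop) (P : jet) :
  continuous a P -> continuous b P -> locally_2d Q (a P) (b P) ->
  locally P (fun z => Q (a z) (b z)).
Proof.
  intros Ca Cb [d H].
  assert (La : locally P (fun z => ball (a P) d (a z))) by exact (Ca _ (locally_ball _ d)).
  assert (Lb : locally P (fun z => ball (b P) d (b z))) by exact (Cb _ (locally_ball _ d)).
  refine (filter_imp _ _ _ (filter_and _ _ La Lb)).
  intros z [A B]. apply H; [exact A | exact B].
Qed.

Lemma smooth_near_comp2 (G : R -> R -> R) (a b : jet -> R) (P : jet) (p q : R) :
  smooth_near a P -> smooth_near b P -> smooth_near (pull2 G) (a P, b P, p, q) ->
  smooth_near (fun z => G (a z) (b z)) P.
Proof.
  intros A B S.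
  assert (L : locally P (fun z => smooth_near (pull2 G) (a z, b z, 0, 0))).
  { apply (locally_comp2 a b (fun x u => smooth_near (pull2 G) (x, u, 0, 0)));
      try apply smooth_near_continuous; auto.
    apply (locally_pull2 _ _ _ p q).
    refine (filter_imp _ _ _ (smooth_near_locally _ _ S)).
    intros [[[x u] p'] q']. apply smooth_near_pull2. }
  destruct (locally_open_nbhd P _ (filter_and _ _ L (filter_and _ _ A B)))
    as (U & O & UP & H).
  apply (smooth_on_near U); auto.
  apply smooth_on_comp2; auto; try (intros z Z; decompose [and] (H z Z); assumption).
Qed.

Lemma smooth_near_comp1 (r : R -> R) (g : jet -> R) (P : jet) :
  smooth_near g P -> smooth1_near r (g P) -> smooth_near (fun z => r (g z)) P.
Proof.
  intros G S. apply (smooth_near_comp2 (fun x _ => r x) g g P 0 0); auto.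
  now apply (smooth_near_of_smooth1 r (g P, g P, 0, 0)).
Qed.

Lemma smooth_near_exp (g : jet -> R) (P : jet) :
  smooth_near g P -> smooth_near (fun z => exp (g z)) P.
Proof.
  intros G. destruct (smooth_near_open g P G) as (U & O & UP & S).
  apply (smooth_on_near U); auto. now apply smooth_on_exp.
Qed.

Lemma pull2_comp (G : R -> R -> R) (A B : R -> R -> R) :
  pull2 (fun x u => G (A x u) (B x u)) = fun z => G (pull2 A z) (pull2 B z).
Proof. jet_ext. Qed.

Lemma pull2_ext (G : R -> R -> R) :
  pull2 G = fun z => G (coordinate cx z) (coordinate cu z).
Proof. jet_ext. Qed.

(** * Partial integrals *)

(** [differentiable_of_partials] with the variables exchanged: here the u-derivative is the one
    known in a neighbourhood. *)
Lemma continuity_of_partials (G Gu : R -> R -> R) (x u l : R) :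
  locally_2d (fun a b => is_derive (fun t => G a t) b (Gu a b)) x u ->
  continuity_2d_pt Gu x u ->
  is_derive (fun t => G t u) x l ->
  continuity_2d_pt G x u.
Proof.
  intros L C E.
  assert (D := differentiable_of_partials (fun b a => G a b) (fun b a => Gu a b) u x l
    (locally_2d_swap _ _ _ L) (fun eps => locally_2d_swap _ _ _ (C eps)) E).
  intros eps. apply locally_2d_swap.
  apply (differentiable_continuity_pt (fun b a => G a b)).
  now exists (Gu x u), l.
Qed.

Lemma open_Rabs_lt (c e : R) : open (fun x : R => Rabs (x - c) < e).
Proof.
  intros x H. assert (p : 0 < e - Rabs (x - c)) by lra.
  exists (mkposreal _ p). intros y Y. change (Rabs (y - x) < e - Rabs (x - c)) in Y.
  replace (y - c) with ((y - x) + (x - c)) by ring.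
  apply Rle_lt_trans with (1 := Rabs_triang _ _). lra.
Qed.

Lemma between_ball (a b s : R) (eps : R) :
  Rmin a b <= s <= Rmax a b -> Rabs (b - a) < eps -> Rabs (s - a) < eps.
Proof.
  unfold Rmin, Rmax, Rabs. destruct Rle_dec; repeat destruct Rcase_abs; lra.
Qed.

(** The integrals of all smooth integrands are adjoined as one family: the t-derivative acts under
    the integral sign and stays in the family, the v-derivative returns the smooth integrand. *)
Lemma smooth_partial_integral (M : R -> R -> R) (t0 v0 p0 q0 : R) :
  smooth_near (pull2 M) (t0, v0, p0, q0) ->
  smooth_near (pull2 (fun t v => RInt (M t) v0 v)) (t0, v0, p0, q0) /\
  locally ((t0, v0, p0, q0) : jet) (fun z => let '(t, v, _, _) := z in
    is_derive (fun s => RInt (M t) v0 s) v (M t v) /\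
    is_derive (fun s => RInt (M s) v0 v) t
      (RInt (fun s => Derive (fun r => M r s) t) v0 v)).
Proof.
  intros S. destruct (locally_plane _ _ _ _ _ (smooth_near_pull2 _ _ _ _ _ 0 0 S))
    as [eps L].
  (* A square, so that the whole segment from v0 to v lies in the domain of smoothness. *)
  set (U := fun z : jet => Rabs (coordinate cx z - t0) < eps
                           /\ Rabs (coordinate cu z - v0) < eps).
  assert (O : open U).
  { apply open_and.
    - apply (open_comp (coordinate cx) (fun x => Rabs (x - t0) < eps)).
      + intros z _. apply continuous_coordinate.
      + apply (open_Rabs_lt t0 eps).
    - apply (open_comp (coordinate cu) (fun x => Rabs (x - v0) < eps)).
      + intros z _. apply continuous_coordinate.
      + apply (open_Rabs_lt v0 eps). }
  assert (UP : U (t0, v0, p0, q0)).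
  { unfold U; simpl. rewrite !Rminus_diag, Rabs_R0. destruct eps; simpl; lra. }
  assert (SM : smooth_on U (pull2 M)).
  { intros [[[a b] c] d] [A B]. exact (smooth_at_pull2 M a b 0 0 c d (L a b A B)). }
  assert (der : forall N, smooth_on U (pull2 N) -> forall t v p q, U (t, v, p, q) ->
    is_derive (fun s => RInt (N t) v0 s) v (N t v) /\
    is_derive (fun s => RInt (N s) v0 v) t
      (RInt (fun s => Derive (fun r => N r s) t) v0 v)).
  { intros N SN t v p q [Ht Hv]. simpl in Ht, Hv.
    assert (cont : forall a b, Rabs (a - t0) < eps -> Rabs (b - v0) < eps ->
      continuous (N a) b).
    { intros a b A B. apply @ex_derive_continuous.
      exact (smooth_on_dif U (pull2 N) (a, b, 0, 0) SN (conj A B) cu). }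
    assert (ex : forall a b, Rabs (a - t0) < eps -> Rabs (b - v0) < eps ->
      ex_RInt (N a) v0 b).
    { intros a b A B. apply @ex_RInt_continuous. intros s Hs. apply cont; auto.
      now apply (between_ball v0 b). }
    split.
    - apply (@is_derive_RInt R_NormedModule (N t) (fun s => RInt (N t) v0 s) v0).
      + apply (locally_open_ext (fun b => Rabs (b - v0) < eps)); auto.
        * apply (open_Rabs_lt v0 eps).
        * intros b B. apply (RInt_correct (V := R_CompleteNormedModule)). now apply ex.
      + now apply cont.
    - apply is_derive_RInt_param.
      + apply (locally_open_ext (fun a => Rabs (a - t0) < eps)); auto.
        * apply (open_Rabs_lt t0 eps).
        * intros a A s Hs.
          exact (smooth_on_dif U (pull2 N) (a, s, 0, 0) SN
                   (conj A (between_ball v0 v s eps Hs Hv)) cx).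
      + intros s Hs.
        assert (C := smooth_on_continuous U _ (t, s, 0, 0) (smooth_on_partial U _ cx SN)
                   (conj Ht (between_ball v0 v s eps Hs Hv))).
        rewrite partial_pull2_cx in C. now apply continuous_pull2 in C.
      + apply (locally_open_ext (fun a => Rabs (a - t0) < eps)); auto.
        apply (open_Rabs_lt t0 eps). }
  split.
  - apply (smooth_on_near U); auto.
    apply (smooth_on_adjoin U (fun g => exists N, smooth_on U (pull2 N) /\
      g = pull2 (fun t v => RInt (N t) v0 v))); auto.
    2: { now exists M. }
    intros g (N & SN & ->). split.
    + intros [[[t v] p] q] Z. split.
      * apply continuous_pull2. apply (continuity_of_partials _ N _ _
          (RInt (fun s => Derive (fun r => N r s) t) v0 v)).
        -- apply (locally_pull2 _ t v p q).
           apply (locally_open_ext U); auto. intros [[[a b] c] d] Z'.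
           now apply (der N SN a b c d).
        -- apply (continuous_pull2 N t v p q). now apply (smooth_on_continuous U).
        -- now apply (der N SN t v p q).
      * apply dif_pull2. destruct (der N SN t v p q Z) as [A B].
        split; eexists; [exact B | exact A].
    + intros i. destruct i;
      [| |exists (fun _ => 0); split; [apply alg_const|]; intros [[[x u] p] q] _;
        exact (Derive_const _ _)..].
      * exists (pull2 (fun t v => RInt (fun s => Derive (fun r => N r s) t) v0 v)).
        split.
        -- apply alg_base. right. exists (fun t s => Derive (fun r => N r s) t).
           split; [|reflexivity]. rewrite <- partial_pull2_cx. now apply smooth_on_partial.
        -- intros [[[t v] p] q] Z. apply partial_eq. now apply (der N SN t v p q).
      * exists (pull2 N). split; [apply alg_base; now left|].
        intros [[[t v] p] q] Z. apply partial_eq. now apply (der N SN t v p q).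
  - apply (locally_open_ext U); auto. intros [[[t v] p] q] Z.
    now apply (der M SM t v p q).
Qed.

(** * Implicit functions *)

Section Implicit.

Variables (F : R -> R -> R) (s0 v0 sg r : R).
Let Fs (s v : R) : R := Derive (fun t => F t v) s.
Let Fv (s v : R) : R := Derive (fun t => F s t) v.
Hypotheses (sg_sq : sg = 1 \/ sg = -1) (r_pos : 0 < r).
Hypothesis box : forall s v, Rabs (s - s0) <= r -> Rabs (v - v0) <= r ->
  smooth_near (pull2 F) (s, v, 0, 0) /\ 0 < sg * Fs s v.

Lemma box_derive_s s v : Rabs (s - s0) <= r -> Rabs (v - v0) <= r ->
  is_derive (fun t => F t v) s (Fs s v).
Proof.
  intros A B. apply Derive_correct.
  exact (smooth_near_dif _ _ (proj1 (box s v A B)) cx).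
Qed.

Lemma box_continuous s v : Rabs (s - s0) <= r -> Rabs (v - v0) <= r ->
  continuity_2d_pt F s v.
Proof.
  intros A B. apply (continuous_pull2 F s v 0 0).
  exact (smooth_near_continuous _ _ (proj1 (box s v A B))).
Qed.

Lemma box_differentiable s v : Rabs (s - s0) <= r -> Rabs (v - v0) <= r ->
  differentiable_pt_lim F s v (Fs s v) (Fv s v).
Proof.
  intros A B. destruct (box s v A B) as [S _].
  apply differentiable_of_partials.
  - apply (locally_pull2 _ s v 0 0). refine (filter_imp _ _ _ S).
    intros [[[a b] c] d] H. apply Derive_correct. exact (proj2 (H nil) cx).
  - apply smooth_near_partial with (i := cx), smooth_near_continuous in S.
    rewrite partial_pull2_cx in S. now apply continuous_pull2 in S.
  - apply Derive_correct. exact (smooth_near_dif _ _ S cu).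
Qed.

(** [sg] is the sign of the s-derivative on the box; by the mean value theorem sg F increases in s,
    and both signs share one argument. *)
Lemma box_monotone s s' v : Rabs (s - s0) <= r -> Rabs (s' - s0) <= r ->
  Rabs (v - v0) <= r -> s < s' -> sg * F s v < sg * F s' v.
Proof.
  intros A A' B L. apply Rabs_le_between in A. apply Rabs_le_between in A'.
  assert (between : forall t, s <= t <= s' -> Rabs (t - s0) <= r)
    by (intros; apply Rabs_le; lra).
  destruct (MVT_gen (fun t => F t v) s s' (fun t => Fs t v)) as (c & Hc & E);
    rewrite ?Rmin_left, ?Rmax_right in * by lra.
  - intros t T. apply box_derive_s; auto. apply between. lra.
  - intros t T. apply continuity_pt_filterlim.
    apply (ex_derive_continuous (fun t => F t v)). eexists. apply box_derive_s; auto.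
  - destruct (box c v (between c Hc) B) as [_ H].
    assert (sg * (F s' v - F s v) = sg * Fs c v * (s' - s)) by (rewrite E; ring).
    nra.
Qed.

Lemma locally_2d_lt (f g : R -> R -> R) x u :
  continuity_2d_pt f x u -> continuity_2d_pt g x u -> f x u < g x u ->
  locally_2d (fun a b => f a b < g a b) x u.
Proof.
  intros Cf Cg L. assert (E : 0 < (g x u - f x u) / 2) by lra.
  destruct (Cf (mkposreal _ E)) as [d Hd], (Cg (mkposreal _ E)) as [e He].
  exists (mkposreal _ (Rmin_stable_in_posreal d e)). simpl. intros a b A B.
  pose proof (Rmin_l d e). pose proof (Rmin_r d e).
  specialize (Hd a b). specialize (He a b). simpl in Hd, He.
  assert (Hd' := Rabs_def2 _ _ (Hd ltac:(lra) ltac:(lra))).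
  assert (He' := Rabs_def2 _ _ (He ltac:(lra) ltac:(lra))). lra.
Qed.

Lemma continuity_2d_scaled s v (x : R) :
  Rabs (s - s0) <= r -> Rabs (v - v0) <= r ->
  continuity_2d_pt (fun _ b => sg * F s b) x v.
Proof.
  intros A B. apply continuity_2d_pt_mult; [apply continuity_2d_pt_const|].
  intros eps. destruct (box_continuous s v A B eps) as [d H]. exists d.
  intros a b _ Hb. apply H; auto. rewrite Rminus_diag, Rabs_R0. apply cond_pos.
Qed.

Lemma continuity_2d_sg x v : continuity_2d_pt (fun a _ => sg * a) x v.
Proof.
  apply continuity_2d_pt_mult; [apply continuity_2d_pt_const | apply continuity_2d_pt_id1].
Qed.

(** At the base point sg t lies strictly between the values of sg F at s0 - r and s0 + r. This
    persists for nearby (t, v), and the intermediate value theorem gives the root. *)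
Lemma implicit_root : exists d : posreal, d <= r /\
  forall t v, Rabs (t - F s0 v0) < d -> Rabs (v - v0) < d ->
  exists s, Rabs (s - s0) < r /\ F s v = t.
Proof.
  assert (E0 : Rabs (v0 - v0) <= r) by (rewrite Rminus_diag, Rabs_R0; lra).
  assert (Em : Rabs (s0 - r - s0) <= r) by (apply Rabs_le; lra).
  assert (Ep : Rabs (s0 + r - s0) <= r) by (apply Rabs_le; lra).
  assert (Ec : Rabs (s0 - s0) <= r) by (rewrite Rminus_diag, Rabs_R0; lra).
  destruct (locally_2d_lt (fun _ b => sg * F (s0 - r) b) (fun a _ => sg * a) (F s0 v0) v0)
    as [d1 H1].
  { now apply continuity_2d_scaled. }
  { apply continuity_2d_sg. }
  { apply box_monotone; auto; lra. }
  destruct (locally_2d_lt (fun a _ => sg * a) (fun _ b => sg * F (s0 + r) b) (F s0 v0) v0)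
    as [d2 H2].
  { apply continuity_2d_sg. }
  { now apply continuity_2d_scaled. }
  { apply box_monotone; auto; lra. }
  assert (Rp : 0 < Rmin r (Rmin d1 d2)).
  { apply Rmin_glb_lt; auto. apply Rmin_glb_lt; apply cond_pos. }
  exists (mkposreal _ Rp). simpl. split; [apply Rmin_l|]. intros t v T V.
  pose proof (Rmin_l r (Rmin d1 d2)). pose proof (Rmin_r r (Rmin d1 d2)).
  pose proof (Rmin_l d1 d2). pose proof (Rmin_r d1 d2).
  specialize (H1 t v ltac:(lra) ltac:(lra)). specialize (H2 t v ltac:(lra) ltac:(lra)).
  simpl in H1, H2.
  destruct (IVT_interv (fun s => sg * F s v - sg * t) (s0 - r) (s0 + r)) as (s & Hs & E).
  - intros a A. apply continuity_pt_minus; [|now apply continuity_pt_const].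
    apply continuity_pt_mult; [now apply continuity_pt_const|].
    apply continuity_pt_filterlim. apply (ex_derive_continuous (fun s => F s v)).
    eexists. apply box_derive_s; [apply Rabs_le; lra | lra].
  - lra.
  - lra.
  - lra.
  - exists s. assert (Es : F s v = t) by (destruct sg_sq; subst sg; lra).
    split; auto. subst t. apply Rabs_lt_between'.
    (* A root at an endpoint would contradict the strict inequalities there. *)
    split; destruct (Req_dec s (s0 - r)) as [e|]; destruct (Req_dec s (s0 + r)) as [e'|];
      try (subst s; lra); lra.
Qed.

(** [S t v] solves F(s, v) = t for s with t kept as a variable, so it is a family of inverse
    functions usable as a change of coordinates. Monotonicity makes the root unique and, by
    squeezing, continuous; S_t = 1 / F_s and S_v = - F_v / F_s, taken at (S, v), are algebraic
    enough for the bootstrap. *)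
Lemma implicit_smooth : exists S : R -> R -> R,
  smooth_near (pull2 S) (F s0 v0, v0, 0, 0) /\
  locally_2d (fun t v => F (S t v) v = t) (F s0 v0) v0 /\
  locally_2d (fun s v => S (F s v) v = s) s0 v0.
Proof.
  destruct implicit_root as (d & dr & root).
  set (S := fun t v => epsilon (inhabits 0) (fun s => Rabs (s - s0) < r /\ F s v = t)).
  set (W := fun t v => Rabs (t - F s0 v0) < d /\ Rabs (v - v0) < d).
  assert (spec : forall t v, W t v -> Rabs (S t v - s0) < r /\ F (S t v) v = t).
  { intros t v [T V]. unfold S. apply epsilon_spec. now apply root. }
  assert (uniq : forall s v, W (F s v) v -> Rabs (s - s0) <= r -> S (F s v) v = s).
  { intros s v H A. destruct (spec _ _ H) as [B E]. destruct H as [_ V].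
    destruct (total_order_T (S (F s v) v) s) as [[L|e]|G]; auto.
    - assert (M := box_monotone (S (F s v) v) s v ltac:(lra) A ltac:(lra) L).
      rewrite E in M. lra.
    - assert (M := box_monotone s (S (F s v) v) v A ltac:(lra) ltac:(lra) G).
      rewrite E in M. lra. }
  assert (Wopen : forall t v, W t v -> locally_2d W t v).
  { intros t v H.
    assert (p1 : 0 < Rmin (d - Rabs (t - F s0 v0)) (d - Rabs (v - v0))).
    { destruct H. apply Rmin_glb_lt; lra. }
    exists (mkposreal _ p1). simpl. intros a b A B.
    pose proof (Rmin_l (d - Rabs (t - F s0 v0)) (d - Rabs (v - v0))).
    pose proof (Rmin_r (d - Rabs (t - F s0 v0)) (d - Rabs (v - v0))).
    split.
    - replace (a - F s0 v0) with ((a - t) + (t - F s0 v0)) by ring.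
      apply Rle_lt_trans with (1 := Rabs_triang _ _). lra.
    - replace (b - v0) with ((b - v) + (v - v0)) by ring.
      apply Rle_lt_trans with (1 := Rabs_triang _ _). lra. }
  assert (Sc : forall t v, W t v -> continuity_2d_pt S t v).
  { intros t v H. destruct (spec t v H) as [B E]. intros eps.
    set (s := S t v) in *. apply Rabs_lt_between' in B.
    (* The levels s - e and s + e stay inside the box. The values of F there separate t strictly,
       and the separation survives small changes of (t, v). *)
    set (e := Rmin (eps / 2) (Rmin ((s - (s0 - r)) / 2) ((s0 + r - s) / 2))).
    assert (e0 : 0 < e).
    { unfold e. repeat apply Rmin_glb_lt; try lra. destruct eps; simpl; lra. }
    assert (ee : e < eps /\ e < s - (s0 - r) /\ e < s0 + r - s).
    { unfold e. pose proof (Rmin_l (eps / 2) (Rmin ((s - (s0 - r)) / 2) ((s0 + r - s) / 2))).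
      pose proof (Rmin_r (eps / 2) (Rmin ((s - (s0 - r)) / 2) ((s0 + r - s) / 2))).
      pose proof (Rmin_l ((s - (s0 - r)) / 2) ((s0 + r - s) / 2)).
      pose proof (Rmin_r ((s - (s0 - r)) / 2) ((s0 + r - s) / 2)).
      destruct eps; simpl in *; lra. }
    assert (Vr : Rabs (v - v0) <= r) by (destruct H; lra).
    assert (Hs : Rabs (s - s0) <= r) by (apply Rabs_le; lra).
    assert (Hm : Rabs (s - e - s0) <= r) by (apply Rabs_le; lra).
    assert (Hp : Rabs (s + e - s0) <= r) by (apply Rabs_le; lra).
    assert (L1 : locally_2d (fun a b => sg * F (s - e) b < sg * a) t v).
    { apply (locally_2d_lt (fun _ b => sg * F (s - e) b) (fun a _ => sg * a)).
      - now apply continuity_2d_scaled.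
      - apply continuity_2d_sg.
      - rewrite <- E at 1. apply box_monotone; auto; lra. }
    assert (L2 : locally_2d (fun a b => sg * a < sg * F (s + e) b) t v).
    { apply (locally_2d_lt (fun a _ => sg * a) (fun _ b => sg * F (s + e) b)).
      - apply continuity_2d_sg.
      - now apply continuity_2d_scaled.
      - rewrite <- E at 1. apply box_monotone; auto; lra. }
    generalize (locally_2d_and _ _ _ _ (Wopen t v H) (locally_2d_and _ _ _ _ L1 L2)).
    apply locally_2d_impl, locally_2d_forall. intros a b (Wab & H1 & H2).
    destruct (spec a b Wab) as [B' E'].
    assert (Vb : Rabs (b - v0) <= r) by (destruct Wab; lra).
    assert (lo : s - e < S a b).
    { destruct (Rlt_le_dec (s - e) (S a b)) as [|[L|e']]; auto; exfalso.
      - assert (M := box_monotone (S a b) (s - e) b ltac:(lra) Hm Vb L).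
        rewrite E' in M. lra.
      - rewrite <- e', E' in H1. lra. }
    assert (hi : S a b < s + e).
    { destruct (Rlt_le_dec (S a b) (s + e)) as [|[L|e']]; auto; exfalso.
      - assert (M := box_monotone (s + e) (S a b) b Hp ltac:(lra) Vb L).
        rewrite E' in M. lra.
      - rewrite e', E' in H2. lra. }
    apply Rabs_def1; lra. }
  (* The derivative of S along the direction (al, be), applied below to (1, 0) and (0, 1). *)
  assert (Sd : forall t v, W t v -> forall al be, Rabs be <= 1 -> Rabs al <= 1 ->
    forall eps : posreal, exists dl : posreal, forall h, Rabs h < dl ->
    Rabs (S (t + al * h) (v + be * h) - S t v
          - (al - be * Fv (S t v) v) / Fs (S t v) v * h) <= eps * Rabs h).
  { intros t v H al be Hbe Hal eps. destruct (spec t v H) as [B E].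
    set (s := S t v) in *.
    assert (Vr : Rabs (v - v0) <= r) by (destruct H; lra).
    destruct (box s v ltac:(lra) Vr) as [_ pos].
    assert (N : Fs s v <> 0) by (intros e; rewrite e in pos; lra).
    assert (Np := Rabs_pos_lt _ N).
    set (L := (al - be * Fv s v) / Fs s v).
    assert (LB : 0 <= Rabs L) by apply Rabs_pos. assert (BB : 0 <= Rabs be) by apply Rabs_pos.
    (* The first bound lets half of |F_s| absorb the error proportional to the unknown remainder;
       the second makes what is left at most eps |h|. *)
    set (e1 := Rmin (Rabs (Fs s v) / 2) (eps * Rabs (Fs s v) / (2 * (Rabs L + Rabs be + 1)))).
    assert (e1p : 0 < e1).
    { unfold e1. apply Rmin_glb_lt; [lra|]. apply Rdiv_lt_0_compat; [|lra].
      apply Rmult_lt_0_compat; auto. apply cond_pos. }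
    assert (e1a : e1 <= Rabs (Fs s v) / 2) by apply Rmin_l.
    assert (e1b : e1 * (Rabs L + Rabs be) <= eps * Rabs (Fs s v) / 2).
    { apply Rle_trans with
        (eps * Rabs (Fs s v) / (2 * (Rabs L + Rabs be + 1)) * (Rabs L + Rabs be + 1)).
      - apply Rmult_le_compat; try lra. apply Rmin_r.
      - right. field. lra. }
    destruct (box_differentiable s v ltac:(lra) Vr (mkposreal _ e1p)) as [d1 H1].
    destruct (locally_2d_and _ _ _ _ (Wopen t v H) (Sc t v H d1)) as [d2 H2].
    exists (mkposreal _ (Rmin_stable_in_posreal d1 d2)). simpl. intros h Hh.
    pose proof (Rmin_l d1 d2). pose proof (Rmin_r d1 d2).
    assert (sc : forall c, Rabs c <= 1 -> Rabs (c * h) < Rmin d1 d2).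
    { intros c Hc. rewrite Rabs_mult. pose proof (Rabs_pos h). nra. }
    pose proof (sc al Hal). pose proof (sc be Hbe).
    destruct (H2 (t + al * h) (v + be * h)) as [Wh Sh].
    { replace (t + al * h - t) with (al * h) by ring. lra. }
    { replace (v + be * h - v) with (be * h) by ring. lra. }
    destruct (spec _ _ Wh) as [_ Eh]. fold s in Sh.
    specialize (H1 (S (t + al * h) (v + be * h)) (v + be * h) Sh). simpl in H1.
    rewrite Eh, E in H1. set (s' := S (t + al * h) (v + be * h)) in *.
    replace (v + be * h - v) with (be * h) in H1 by ring. specialize (H1 ltac:(lra)).
    replace (t + al * h - t - (Fs s v * (s' - s) + Fv s v * (be * h))) with
      (- (Fs s v * (s' - s - L * h))) in H1 by (unfold L; field; auto).
    rewrite Rabs_Ropp, Rabs_mult in H1.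
    assert (mx : Rmax (Rabs (s' - s)) (Rabs (be * h))
                 <= Rabs (s' - s - L * h) + (Rabs L + Rabs be) * Rabs h).
    { pose proof (Rabs_pos (s' - s - L * h)). pose proof (Rabs_pos h).
      apply Rmax_lub.
      - replace (s' - s) with ((s' - s - L * h) + L * h) at 1 by ring.
        apply Rle_trans with (1 := Rabs_triang _ _). rewrite Rabs_mult. nra.
      - rewrite Rabs_mult. nra. }
    set (X := Rabs (s' - s - L * h)) in *.
    assert (X0 : 0 <= X) by apply Rabs_pos. pose proof (Rabs_pos h) as h0.
    assert (A1 : Rabs (Fs s v) * X <= e1 * X + e1 * (Rabs L + Rabs be) * Rabs h) by nra.
    assert (A2 : e1 * X <= Rabs (Fs s v) / 2 * X) by nra.
    assert (A3 : e1 * (Rabs L + Rabs be) * Rabs h <= eps * Rabs (Fs s v) / 2 * Rabs h) by nra.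
    apply Rmult_le_reg_l with (Rabs (Fs s v) / 2); lra. }
  assert (lin : forall (g : R -> R) t L, (forall eps : posreal, exists dl : posreal,
      forall h, Rabs h < dl -> Rabs (g (t + h) - g t - L * h) <= eps * Rabs h) ->
      is_derive g t L).
  { intros g t L H. apply is_derive_Reals. intros eps Heps.
    assert (E2 : 0 < eps / 2) by lra. destruct (H (mkposreal _ E2)) as [dl Hd].
    exists dl. intros h Nh Hh. specialize (Hd h Hh). simpl in Hd.
    assert (Np := Rabs_pos_lt _ Nh).
    replace ((g (t + h) - g t) / h - L) with ((g (t + h) - g t - L * h) / h)
      by (field; auto).
    rewrite Rabs_div by auto. apply Rle_lt_trans with (eps / 2); [|lra].
    apply Rmult_le_reg_r with (Rabs h); auto.
    unfold Rdiv at 1. rewrite Rmult_assoc, Rinv_l by lra. lra. }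
  assert (St : forall t v, W t v ->
    is_derive (fun a => S a v) t (/ Fs (S t v) v)).
  { intros t v H. apply lin. intros eps.
    destruct (Sd t v H 1 0 ltac:(rewrite Rabs_R0; lra) ltac:(rewrite Rabs_R1; lra) eps)
      as [dl Hd].
    exists dl. intros h Hh. specialize (Hd h Hh).
    replace (t + 1 * h) with (t + h) in Hd by ring.
    replace (v + 0 * h) with v in Hd by ring.
    replace ((1 - 0 * Fv (S t v) v) / Fs (S t v) v) with (/ Fs (S t v) v) in Hd
      by (unfold Rdiv; ring). exact Hd. }
  assert (Sv : forall t v, W t v ->
    is_derive (fun b => S t b) v (- Fv (S t v) v / Fs (S t v) v)).
  { intros t v H. apply lin. intros eps.
    destruct (Sd t v H 0 1 ltac:(rewrite Rabs_R1; lra) ltac:(rewrite Rabs_R0; lra) eps)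
      as [dl Hd].
    exists dl. intros h Hh. specialize (Hd h Hh).
    replace (t + 0 * h) with t in Hd by ring.
    replace (v + 1 * h) with (v + h) in Hd by ring.
    replace ((0 - 1 * Fv (S t v) v) / Fs (S t v) v) with (- Fv (S t v) v / Fs (S t v) v)
      in Hd by (unfold Rdiv; ring). exact Hd. }
  assert (W0 : W (F s0 v0) v0).
  { split; rewrite Rminus_diag, Rabs_R0; apply cond_pos. }
  exists S. repeat split.
  - set (U := fun z : jet => let '(t, v, _, _) := z in W t v).
    assert (O : open U).
    { intros [[[t v] p] q] H. apply (locally_pull2 W). now apply Wopen. }
    assert (inbox : forall t v p q, U (t, v, p, q) ->
      smooth_near (pull2 F) (S t v, v, 0, 0) /\ 0 < sg * Fs (S t v) v).
    { intros t v p q H. destruct (spec t v H) as [B _]. apply box; [lra|].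
      destruct H; lra. }
    apply (smooth_on_near U); auto.
    apply (smooth_on_adjoin U (fun g => g = pull2 S)); auto.
    intros g ->. split.
    + intros [[[t v] p] q] H. split.
      * apply continuous_pull2. now apply Sc.
      * apply dif_pull2. split; eexists; [now apply St | now apply Sv].
    + set (B := fun h => smooth_on U h \/ h = pull2 S).
      assert (As : alg U B (fun z => Fs (pull2 S z) (coordinate cu z))).
      { apply alg_comp2.
        - apply alg_base. now right.
        - apply alg_base. left. now apply smooth_on_coordinate.
        - intros [[[t v] p] q] H. unfold Fs. rewrite <- partial_pull2_cx.
          now apply smooth_near_partial, (inbox t v p q). }
      assert (Av : alg U B (fun z => Fv (pull2 S z) (coordinate cu z))).
      { apply alg_comp2.
        - apply alg_base. now right.
        - apply alg_base. left. now apply smooth_on_coordinate.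
        - intros [[[t v] p] q] H. unfold Fv. rewrite <- partial_pull2_cu.
          now apply smooth_near_partial, (inbox t v p q). }
      assert (Ai : alg U B (fun z => / Fs (pull2 S z) (coordinate cu z))).
      { apply alg_inv; auto. intros [[[t v] p] q] H. simpl.
        destruct (inbox t v p q H) as [_ pos]. intros e. rewrite e in pos. lra. }
      intros i. destruct i;
      [| |exists (fun _ => 0); split; [apply alg_const|]; intros [[[x u] p] q] _;
        exact (Derive_const _ _)..].
      * eexists. split; [exact Ai|]. intros [[[t v] p] q] H.
        apply partial_eq. now apply St.
      * exists (fun z => -1 * Fv (pull2 S z) (coordinate cu z)
                         * / Fs (pull2 S z) (coordinate cu z)).
        split; [repeat apply alg_mult; auto; apply alg_const|].
        intros [[[t v] p] q] H.
        apply partial_eq. replace (-1 * _ * _) with (- Fv (S t v) v / Fs (S t v) v)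
          by (simpl; unfold Rdiv; ring). now apply Sv.
  - generalize (Wopen _ _ W0). apply locally_2d_impl, locally_2d_forall.
    intros t v H. now apply spec.
  - assert (C := box_continuous s0 v0 ltac:(rewrite Rminus_diag, Rabs_R0; lra)
      ltac:(rewrite Rminus_diag, Rabs_R0; lra) d).
    destruct C as [e He]. exists (mkposreal _ (Rmin_stable_in_posreal d e)). simpl.
    intros s v A B. pose proof (Rmin_l d e). pose proof (Rmin_r d e).
    apply uniq; [|lra]. split; [apply He; lra | lra].
Qed.

End Implicit.

Lemma implicit_function (F : R -> R -> R) (s0 v0 p q : R) :
  smooth_near (pull2 F) (s0, v0, p, q) ->
  Derive (fun s => F s v0) s0 <> 0 ->
  exists S : R -> R -> R,
    smooth_near (pull2 S) (F s0 v0, v0, 0, 0) /\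
    locally_2d (fun t v => F (S t v) v = t) (F s0 v0) v0 /\
    locally_2d (fun s v => S (F s v) v = s) s0 v0.
Proof.
  intros SF N.
  assert (Sg : exists sg, (sg = 1 \/ sg = -1) /\ 0 < sg * Derive (fun s => F s v0) s0).
  { destruct (total_order_T (Derive (fun s => F s v0) s0) 0) as [[L|E]|G];
      [exists (-1) | contradiction | exists 1]; split; auto; lra. }
  destruct Sg as (sg & sg1 & pos).
  assert (Cs : continuity_2d_pt (fun s v => sg * Derive (fun t => F t v) s) s0 v0).
  { apply continuity_2d_pt_mult; [apply continuity_2d_pt_const|].
    apply (continuous_pull2 _ s0 v0 p q). rewrite <- partial_pull2_cx.
    now apply smooth_near_continuous, smooth_near_partial. }
  assert (L1 := locally_2d_lt (fun _ _ => 0) _ s0 v0 (continuity_2d_pt_const _ _ 0) Cs pos).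
  assert (L2 := locally_plane _ _ _ _ _ (smooth_near_locally _ _
    (smooth_near_pull2 _ _ _ _ _ 0 0 SF))).
  destruct (locally_2d_and _ _ _ _ L1 L2) as [d H].
  apply (implicit_smooth F s0 v0 sg (d / 2)); auto.
  - destruct d; simpl; lra.
  - intros s v A B. assert (d / 2 < d) by (destruct d; simpl; lra).
    destruct (H s v) as [H1 H2]; [lra..|]. split; auto.
Qed.

(** * Functions of a single function *)

(** Balls of [jet] are boxes, so the coordinate segment from z to the hyperplane through [P] stays
    in the ball, and g is constant along it. *)
Lemma locally_constant_along (i : coord) (g : jet -> R) (P : jet) :
  locally P (fun z => dif g z /\ partial i g z = 0) ->
  locally P (fun z => g z = g (move i z (coordinate i P))).
Proof.
  intros [eps H]. exists eps. intros z Z.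
  assert (Zt : forall t, Rmin (coordinate i P) (coordinate i z) <= t
                 <= Rmax (coordinate i P) (coordinate i z) -> ball P eps (move i z t)).
  { intros t T. assert (B : Rabs (t - coordinate i P) < eps).
    { apply (between_ball _ (coordinate i z)); auto.
      destruct P as [[[x u] p] q], z as [[[a b] c] d], Z as [[[Za Zb] Zc] Zd].
      destruct i; simpl; assumption. }
    destruct P as [[[x u] p] q], z as [[[a b] c] d], Z as [[[Za Zb] Zc] Zd].
    destruct i; repeat split; assumption. }
  assert (dz : forall t, Rmin (coordinate i P) (coordinate i z) <= t
                 <= Rmax (coordinate i P) (coordinate i z) ->
               is_derive (slice i g z) t 0).
  { intros t T. destruct (H _ (Zt t T)) as [G0 G1].
    apply partial_is_derive with (i := i) in G0. rewrite G1 in G0.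
    destruct z as [[[a b] c] d], i; exact G0. }
  rewrite <- (slice_coordinate i g z), <- slice_move.
  destruct (total_order_T (coordinate i P) (coordinate i z)) as [[L|E]|L].
  - symmetry. apply (eq_is_derive (slice i g z)); auto.
    intros t T. apply dz. rewrite Rmin_left, Rmax_right; lra.
  - now rewrite E.
  - apply (eq_is_derive (slice i g z)); auto.
    intros t T. apply dz. rewrite Rmin_right, Rmax_left; lra.
Qed.

Lemma total_pull2 (r : R) (G : R -> R -> R) (z : jet) :
  total r (pull2 G) z
  = partial cx (pull2 G) z + coordinate cp z * partial cu (pull2 G) z.
Proof.
  unfold total. rewrite partial_pull2_cp, partial_pull2_cq.
  destruct z as [[[x u] p] q]. simpl. ring.
Qed.

(* The shear u = v + p0 x makes the x-derivative of phi equal to D_x phi at the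
   base point, so that phi and v are always local coordinates. *)
Lemma straighten (phi : R -> R -> R) (x0 u0 p0 q0 : R) :
  smooth_near (pull2 phi) (x0, u0, p0, q0) ->
  total 0 (pull2 phi) (x0, u0, p0, q0) <> 0 ->
  exists X : R -> R -> R,
    smooth_near (pull2 X) (phi x0 u0, u0 - p0 * x0, 0, 0) /\
    locally_2d (fun t v => phi (X t v) (v + p0 * X t v) = t) (phi x0 u0) (u0 - p0 * x0) /\
    locally ((x0, u0, p0, q0) : jet)
      (fun z => X (pull2 phi z) (coordinate cu z - p0 * coordinate cx z) = coordinate cx z).
Proof.
  intros S N. set (F := fun s v => phi s (v + p0 * s)). set (v0 := u0 - p0 * x0).
  assert (E0 : v0 + p0 * x0 = u0) by (unfold v0; ring).
  destruct (implicit_function F x0 v0 0 0) as (X & SX & H1 & H2).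
  - rewrite (pull2_ext F). unfold F.
    apply (smooth_near_comp2 phi (coordinate cx)
             (fun z => coordinate cu z + p0 * coordinate cx z) _ p0 q0).
    + apply smooth_near_coordinate.
    + apply smooth_near_plus; [apply smooth_near_coordinate|].
      apply smooth_near_mult; [apply smooth_near_const | apply smooth_near_coordinate].
    + simpl. now rewrite E0.
  - assert (Dp : is_derive (fun s => F s v0) x0
      (partial cx (pull2 phi) (x0, v0 + p0 * x0, p0, q0) * 1
       + partial cu (pull2 phi) (x0, v0 + p0 * x0, p0, q0) * p0)).
    { apply (is_derive_comp2 phi (fun s => s) (fun s => v0 + p0 * s)).
      - now rewrite E0.
      - apply @is_derive_id.
      - auto_derive; auto. ring. }
    intros Z. apply N. rewrite total_pull2. rewrite E0 in Dp.
    apply (is_derive_unique (fun s => F s v0)) in Dp.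
    transitivity (Derive (fun s => F s v0) x0); [|exact Z].
    symmetry. etransitivity; [exact Dp|]. simpl coordinate. ring.
  - unfold F in H1, H2, SX. rewrite E0 in H1, SX.
    exists X. split; [exact SX | split; [exact H1|]].
    refine (filter_imp _ _ _ (locally_comp2 (coordinate cx)
      (fun z => coordinate cu z - p0 * coordinate cx z) _ (x0, u0, p0, q0) _ _ H2)).
    + intros [[[x u] p] q] H. simpl in *.
      now replace (u - p0 * x + p0 * x) with u in H by ring.
    + apply continuous_coordinate.
    + apply @continuous_minus; [apply continuous_coordinate|].
      apply @continuous_mult; [apply @continuous_const | apply continuous_coordinate].
Qed.

Lemma locally_dif (g : jet -> R) (P : jet) : smooth_near g P -> locally P (dif g).
Proof.
  intros S. refine (filter_imp _ _ _ (smooth_near_locally _ _ S)).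
  intros z. apply smooth_near_dif.
Qed.

Lemma locally_total_nonzero (phi : R -> R -> R) (P : jet) :
  smooth_near (pull2 phi) P -> total 0 (pull2 phi) P <> 0 ->
  locally P (fun z => total 0 (pull2 phi) z <> 0).
Proof.
  intros S N. rewrite total_pull2 in N.
  refine (filter_imp _ _ _ (continuous_nonzero (fun z => partial cx (pull2 phi) z
    + coordinate cp z * partial cu (pull2 phi) z) P _ N)).
  - intros z Z. now rewrite total_pull2.
  - apply smooth_near_continuous, smooth_near_plus; [now apply smooth_near_partial|].
    apply smooth_near_mult; [apply smooth_near_coordinate | now apply smooth_near_partial].
Qed.

(** In the coordinates t = phi, v = u - p0 x of [straighten] the vanishing Jacobian says that g has
    zero v-derivative; r is g read off on the curve v = v0. *)
Lemma function_of (g phi : R -> R -> R) (P : jet) :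
  smooth_near (pull2 g) P -> smooth_near (pull2 phi) P -> total 0 (pull2 phi) P <> 0 ->
  locally P (fun z => partial cx (pull2 g) z * partial cu (pull2 phi) z
                      = partial cu (pull2 g) z * partial cx (pull2 phi) z) ->
  exists r : R -> R, smooth1_near r (pull2 phi P) /\
    locally P (fun z => pull2 g z = r (pull2 phi z)).
Proof.
  destruct P as [[[x0 u0] p0] q0]. intros Sg Sp N W.
  destruct (straighten phi x0 u0 p0 q0 Sp N) as (X & SX & H1 & H2).
  set (v0 := u0 - p0 * x0) in *. set (Q := (phi x0 u0, v0, 0, 0) : jet).
  set (U := fun z : jet => coordinate cu z + p0 * pull2 X z).
  assert (XQ : X (phi x0 u0) v0 = x0) by exact (locally_singleton _ _ H2).
  assert (UQ : v0 + p0 * x0 = u0) by (unfold v0; ring).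
  assert (SU : smooth_near U Q).
  { apply smooth_near_plus; [apply smooth_near_coordinate|].
    apply smooth_near_mult; [apply smooth_near_const | exact SX]. }
  assert (at_base : (pull2 X Q, U Q, 0, 0) = (x0, u0, 0, 0)).
  { unfold U; simpl. now rewrite XQ, UQ. }
  assert (along : locally Q (fun z =>
     g (pull2 X z) (U z) = g (X (coordinate cx z) v0) (v0 + p0 * X (coordinate cx z) v0))).
  { assert (SgX : smooth_near (fun z => g (pull2 X z) (U z)) Q).
    { apply (smooth_near_comp2 g _ _ _ 0 0); auto. rewrite at_base.
      now apply smooth_near_pull2 with p0 q0. }
    refine (filter_imp _ _ _ (locally_constant_along cu
      (fun z => g (pull2 X z) (U z)) Q _)).
    { intros [[[t v] p] q] H. exact H. }
    assert (C := locally_plane _ _ _ _ _ (filter_and _ _ (filter_and _ _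
      (smooth_near_locally _ _ Sg) (smooth_near_locally _ _ Sp))
      (filter_and _ _ (locally_total_nonzero _ _ Sp N) W))).
    assert (C' := locally_comp2 (pull2 X) U _ Q
      (smooth_near_continuous _ _ SX) (smooth_near_continuous _ _ SU)
      ltac:(unfold U; simpl; rewrite XQ, UQ; exact C)).
    assert (lev : locally Q (fun z => phi (pull2 X z) (U z) = coordinate cx z)).
    { apply locally_pull2 with (p := 0) (q := 0) in H1. refine (filter_imp _ _ _ H1).
      intros [[[t v] p] q] H. exact H. }
    generalize (filter_and _ _ (filter_and _ _ C' (locally_locally _ _ lev))
      (filter_and _ _ (locally_dif _ _ SgX) (filter_and _ _ (locally_dif _ _ SX)
        (locally_dif _ _ SU)))).
    apply filter_imp. intros z ((((Sg' & Sp') & N' & W') & L) & Dg & DX & DU).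
    split; auto.
    assert (EU : partial cu U z = 1 + p0 * partial cu (pull2 X) z).
    { apply partial_eq. apply is_slice_plus; [apply (partial_coordinate cu cu)|].
      replace (p0 * partial cu (pull2 X) z) with
        (0 * pull2 X z + p0 * partial cu (pull2 X) z) by ring.
      apply is_slice_mult; [apply is_slice_const | now apply partial_is_derive]. }
    rewrite (partial_eq _ _ _ _ (is_slice_comp2 cu g (pull2 X) U z _ _ _ _ Sg'
      (partial_is_derive cu _ z DX) (partial_is_derive cu _ z DU))).
    assert (P0 : partial cu (fun z => phi (pull2 X z) (U z)) z = 0).
    { transitivity (partial cu (coordinate cx) z); [now apply partial_ext_loc|].
      apply partial_eq, (partial_coordinate cu cx). }
    rewrite (partial_eq _ _ _ _ (is_slice_comp2 cu phi (pull2 X) U z _ _ _ _ Sp'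
      (partial_is_derive cu _ z DX) (partial_is_derive cu _ z DU))) in P0.
    rewrite EU in *. rewrite total_pull2 in N'. simpl coordinate in N'.
    set (gx := partial cx (pull2 g) _) in *. set (gu := partial cu (pull2 g) _) in *.
    set (px := partial cx (pull2 phi) _) in *. set (pu := partial cu (pull2 phi) _) in *.
    set (dX := partial cu (pull2 X) z) in *.
    (* The factor is D phi at slope p0. After multiplication, the v-derivative of g is a combination
       of the v-derivative of phi = t, which is zero, and of the Jacobian of g and phi. *)
    apply (Rmult_eq_reg_l (px + p0 * pu)); auto.
    transitivity ((gx + p0 * gu) * (px * dX + pu * (1 + p0 * dX))
       + (gx * pu - gu * px) * (p0 * dX - (1 + p0 * dX))); [ring|].
    rewrite P0, W'. ring. }
  exists (fun t => g (X t v0) (v0 + p0 * X t v0)).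
  assert (SXv : smooth_near (fun z => X (coordinate cx z) v0) Q).
  { apply (smooth_near_comp2 X (coordinate cx) (fun _ => v0) Q 0 0).
    - apply smooth_near_coordinate.
    - apply smooth_near_const.
    - exact SX. }
  split.
  - apply (smooth1_of_smooth_near _ Q).
    rewrite (pull2_ext (fun t _ => g (X t v0) (v0 + p0 * X t v0))).
    apply (smooth_near_comp2 g (fun z => X (coordinate cx z) v0)
      (fun z => v0 + p0 * X (coordinate cx z) v0) Q p0 q0); auto.
    + apply smooth_near_plus; [apply smooth_near_const|].
      apply smooth_near_mult; [apply smooth_near_const | exact SXv].
    + simpl. now rewrite XQ, UQ.
  - assert (A : locally_2d (fun t v => g (X t v) (v + p0 * X t v)
                             = g (X t v0) (v0 + p0 * X t v0)) (phi x0 u0) v0).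
    { apply (locally_pull2 _ _ _ 0 0). refine (filter_imp _ _ _ along).
      intros [[[t v] p] q] H. exact H. }
    assert (B := locally_comp2 (pull2 phi) (fun z => coordinate cu z - p0 * coordinate cx z)
      _ (x0, u0, p0, q0) (smooth_near_continuous _ _ Sp)
      ltac:(apply @continuous_minus; [apply continuous_coordinate|];
            apply @continuous_mult; [apply @continuous_const | apply continuous_coordinate])
      A).
    generalize (filter_and _ _ H2 B). apply filter_imp.
    intros [[[x u] p] q] [E1 E2]. simpl in *. rewrite E1 in E2.
    replace (u - p0 * x + p0 * x) with u in E2 by ring. exact E2.
Qed.

(** The curve v = v0 of [straighten] gives each value near phi(P) a preimage close to [P]. This
    converts properties of jets into properties of the variable xbar. *)
Lemma level_points (phi : R -> R -> R) (P : jet) (Q : jet -> Prop) :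
  smooth_near (pull2 phi) P -> total 0 (pull2 phi) P <> 0 -> locally P Q ->
  locally (pull2 phi P) (fun t => exists z, Q z /\ pull2 phi z = t).
Proof.
  destruct P as [[[x0 u0] p0] q0]. intros Sp N HQ.
  destruct (straighten phi x0 u0 p0 q0 Sp N) as (X & SX & H1 & H2).
  set (v0 := u0 - p0 * x0) in *. set (T := (phi x0 u0, v0, 0, 0) : jet).
  assert (XQ : X (phi x0 u0) v0 = x0) by exact (locally_singleton _ _ H2).
  assert (UQ : v0 + p0 * x0 = u0) by (unfold v0; ring).
  assert (Q2 := locally_plane _ _ _ _ _ HQ).
  assert (SXv : smooth_near (fun z => X (coordinate cx z) v0) T).
  { apply (smooth_near_comp2 X (coordinate cx) (fun _ => v0) T 0 0).
    - apply smooth_near_coordinate.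
    - apply smooth_near_const.
    - exact SX. }
  assert (SUv : smooth_near (fun z => v0 + p0 * X (coordinate cx z) v0) T).
  { apply smooth_near_plus; [apply smooth_near_const|].
    apply smooth_near_mult; [apply smooth_near_const | exact SXv]. }
  assert (L := locally_comp2 (fun z => X (coordinate cx z) v0)
    (fun z => v0 + p0 * X (coordinate cx z) v0) _ T
    (smooth_near_continuous _ _ SXv) (smooth_near_continuous _ _ SUv)
    ltac:(simpl; rewrite XQ, UQ; exact Q2)).
  apply locally_pull2 with (p := 0) (q := 0) in H1.
  generalize (locally_move cx T _ (filter_and _ _ H1 L)). apply filter_imp.
  intros t [A B]. simpl in A, B. now exists (X t v0, v0 + p0 * X t v0, p0, q0).
Qed.

(** * Potentials *)

(** The Poincare lemma on a rectangle: M is integrated along u = u0, then N in the direction of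
    u. *)
Lemma potential_plane (M N : R -> R -> R) (P : jet) :
  smooth_near (pull2 M) P -> smooth_near (pull2 N) P ->
  locally P (fun z => partial cx (pull2 N) z = partial cu (pull2 M) z) ->
  exists Phi : R -> R -> R, smooth_near (pull2 Phi) P /\
    locally P (fun z => partial cx (pull2 Phi) z = pull2 M z
                        /\ partial cu (pull2 Phi) z = pull2 N z).
Proof.
  destruct P as [[[x0 u0] p0] q0]. intros SM SN W.
  set (P := (x0, u0, p0, q0) : jet) in *.
  assert (SMu : smooth1_near (fun x => M x u0) x0).
  { apply (smooth1_of_smooth_near (fun x => M x u0) P).
    rewrite (pull2_ext (fun x _ => M x u0)).
    apply (smooth_near_comp2 M (coordinate cx) (fun _ => u0) P p0 q0); auto.
    - apply smooth_near_coordinate.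
    - apply smooth_near_const. }
  (* An antiderivative of M at u = u0, obtained as the solution of a first order equation with zero
     coefficient. *)
  destruct (linear_ode_smooth 0 (fun _ => 0) (fun x => M x u0) x0 0) as (c & _ & Sc & Ec).
  { unfold smooth1_near. apply filter_forall. intros t [|n]; [exact I|].
    apply (ex_derive_n_const 0 (S n)). }
  { exact SMu. }
  destruct (smooth_partial_integral N x0 u0 p0 q0 SN) as [SI DI].
  assert (Sc2 := smooth_near_of_smooth1 c P Sc).
  exists (fun x u => c x + RInt (N x) u0 u).
  assert (EP : pull2 (fun x u => c x + RInt (N x) u0 u)
    = fun z => pull2 (fun x _ => c x) z + pull2 (fun x u => RInt (N x) u0 u) z).
  { jet_ext. }
  rewrite EP. split; [now apply smooth_near_plus|].
  assert (B := locally_plane _ _ _ _ _ (filter_and _ _ SM (filter_and _ _ SN W))).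
  destruct B as [eps B].
  assert (near : locally P (fun z => Rabs (coordinate cx z - x0) < eps
                                     /\ Rabs (coordinate cu z - u0) < eps)).
  { exists eps. intros [[[x u] p] q] [[[A C] _] _]. split; [exact A | exact C]. }
  assert (Lc : locally P (fun z => Derive c (coordinate cx z) = M (coordinate cx z) u0
                                   /\ ex_derive c (coordinate cx z))).
  { apply (continuous_coordinate cx P
      (fun t => Derive c t = M t u0 /\ ex_derive c t)).
    generalize (filter_and _ _ Ec (smooth1_near_locally _ _ Sc)). apply filter_imp.
    intros t [E S]. split; [|now apply smooth1_near_ex_derive].
    simpl in E. change (Derive (fun x => c x) t) with (Derive c t) in E. rewrite E.
    eq_in_R. ring. }
  generalize (filter_and _ _ near (filter_and _ _ Lc DI)). apply filter_imp.
  intros [[[x u] p] q] ((Bx & Bu) & (Dc & Xc) & Iu & Ix). simpl in Bx, Bu, Dc, Xc.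
  split.
  - transitivity (M x u0 + (M x u - M x u0)); [apply partial_eq | simpl; ring].
    apply (is_slice_plus cx (pull2 (fun x _ => c x)) (pull2 (fun x u => RInt (N x) u0 u))).
    + simpl. rewrite <- Dc. now apply Derive_correct.
    (* By closedness the integral of N_x over [u0, u] is that of M_u, which is M(x, u) - M(x,
       u0). *)
    + simpl. rewrite <- (RInt_Derive (M x) u0 u).
      * erewrite RInt_ext; [exact Ix|]. intros s Hs. symmetry.
        apply B; auto. apply (between_ball u0 u); auto. lra.
      * intros s Hs. destruct (B x s Bx (between_ball u0 u s eps Hs Bu)) as (A & _ & _).
        exact (proj2 (A nil) cu).
      * intros s Hs. destruct (B x s Bx (between_ball u0 u s eps Hs Bu)) as (A & _ & _).
        apply @ex_derive_continuous. exact (proj2 (A (cu :: nil)) cu).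
  - transitivity (0 + N x u); [apply partial_eq | simpl; ring].
    apply (is_slice_plus cu (pull2 (fun x _ => c x)) (pull2 (fun x u => RInt (N x) u0 u))).
    + apply @is_derive_const.
    + exact Iu.
Qed.

(** For psi = Psi(phi, v) with v = u - p0 x the Jacobian is Psi_v (phi_x + p0 phi_u). The second
    factor is nonzero near [P], so Psi is a partial integral in v of the quotient. *)
Lemma jacobian_prescribed (phi Del : R -> R -> R) (P : jet) :
  smooth_near (pull2 phi) P -> smooth_near (pull2 Del) P ->
  total 0 (pull2 phi) P <> 0 ->
  exists psi : R -> R -> R, smooth_near (pull2 psi) P /\
    locally P (fun z => jacobian phi psi z = pull2 Del z).
Proof.
  destruct P as [[[x0 u0] p0] q0]. intros Sp Sd N.
  set (P := (x0, u0, p0, q0) : jet) in *.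
  destruct (straighten phi x0 u0 p0 q0 Sp N) as (X & SX & H1 & H2).
  set (v0 := u0 - p0 * x0) in *. set (Q := (phi x0 u0, v0, 0, 0) : jet).
  assert (XQ : X (phi x0 u0) v0 = x0) by exact (locally_singleton _ _ H2).
  assert (UQ : v0 + p0 * x0 = u0) by (unfold v0; ring).
  set (E := fun x u => Del x u
    / (Derive (fun t => phi t u) x + p0 * Derive (fun t => phi x t) u)).
  assert (EE : pull2 E = fun z => pull2 Del z
    / (partial cx (pull2 phi) z + p0 * partial cu (pull2 phi) z)).
  { jet_ext. }
  rewrite total_pull2 in N. simpl coordinate in N.
  assert (Sden : smooth_near (fun z => partial cx (pull2 phi) z
                                       + p0 * partial cu (pull2 phi) z) P).
  { apply smooth_near_plus; [now apply smooth_near_partial|].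
    apply smooth_near_mult; [apply smooth_near_const | now apply smooth_near_partial]. }
  assert (SE : smooth_near (pull2 E) P).
  { rewrite EE. now apply smooth_near_div. }
  set (G := fun t v => E (X t v) (v + p0 * X t v)).
  assert (SG : smooth_near (pull2 G) Q).
  { unfold G. rewrite (pull2_comp E X (fun t v => v + p0 * X t v)).
    apply (smooth_near_comp2 E (pull2 X) (pull2 (fun t v => v + p0 * X t v)) Q p0 q0); auto.
    - rewrite (pull2_ext (fun t v => v + p0 * X t v)).
      apply smooth_near_plus; [apply smooth_near_coordinate|].
      apply smooth_near_mult; [apply smooth_near_const|].
      rewrite <- (pull2_ext X). exact SX.
    - simpl. now rewrite XQ, UQ. }
  destruct (smooth_partial_integral G (phi x0 u0) v0 0 0 SG) as [SI DI].
  set (Psi := fun t v => RInt (G t) v0 v) in *.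
  set (V := fun z : jet => coordinate cu z - p0 * coordinate cx z).
  assert (SV : smooth_near V P).
  { apply smooth_near_minus; [apply smooth_near_coordinate|].
    apply smooth_near_mult; [apply smooth_near_const | apply smooth_near_coordinate]. }
  exists (fun x u => Psi (phi x u) (u - p0 * x)).
  assert (Epsi : pull2 (fun x u => Psi (phi x u) (u - p0 * x))
                 = fun z => Psi (pull2 phi z) (V z)).
  { jet_ext. }
  unfold jacobian. rewrite Epsi. split.
  { now apply (smooth_near_comp2 Psi (pull2 phi) V P 0 0). }
  assert (D2 : locally_2d (fun t v => smooth_near (pull2 Psi) (t, v, 0, 0) /\
     is_derive (fun s => RInt (G t) v0 s) v (G t v)) (phi x0 u0) v0).
  { apply (locally_pull2 _ _ _ 0 0).
    generalize (filter_and _ _ (smooth_near_locally _ _ SI) DI). apply filter_imp.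
    intros [[[t v] p] q] (A & B & _). split; auto. now apply smooth_near_pull2 with p q. }
  assert (D2' := locally_comp2 (pull2 phi) V _ P (smooth_near_continuous _ _ Sp)
    (smooth_near_continuous _ _ SV) D2).
  generalize (filter_and _ _ (filter_and _ _ D2' H2) (filter_and _ _
    (filter_and _ _ (locally_dif _ _ Sp) (locally_dif _ _ SV))
    (continuous_nonzero _ _ (smooth_near_continuous _ _ Sden) N))).
  apply filter_imp. intros z (((SP & dP) & EX) & (dphi & dV) & Nz).
  rewrite (partial_eq _ _ _ _ (is_slice_comp2 cx Psi (pull2 phi) V z _ _ _ _ SP
      (partial_is_derive cx _ z dphi) (partial_is_derive cx _ z dV))).
  rewrite (partial_eq _ _ _ _ (is_slice_comp2 cu Psi (pull2 phi) V z _ _ _ _ SP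
      (partial_is_derive cu _ z dphi) (partial_is_derive cu _ z dV))).
  assert (Vx : partial cx V z = - p0).
  { apply partial_eq. destruct z as [[[x u] p] q].
    change (is_derive (fun t => u - p0 * t) x (- p0)). auto_derive; auto. ring. }
  assert (Vu : partial cu V z = 1).
  { apply partial_eq. destruct z as [[[x u] p] q].
    change (is_derive (fun t => t - p0 * x) u 1). auto_derive; auto. }
  assert (Pv : partial cu (pull2 Psi) (pull2 phi z, V z, 0, 0)
    = pull2 Del z / (partial cx (pull2 phi) z + p0 * partial cu (pull2 phi) z)).
  { transitivity (pull2 E z); [|now rewrite EE].
    apply partial_eq. simpl. replace (pull2 E z) with (G (pull2 phi z) (V z)); [exact dP|].
    unfold G. unfold V in *. rewrite EX. destruct z as [[[x u] p] q]. simpl.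
    f_equal. ring. }
  rewrite Vx, Vu, Pv. field. exact Nz.
Qed.

Lemma reduce_q (g : jet -> R) (P : jet) :
  smooth_near g P -> locally P (fun z => partial cq g z = 0) ->
  locally P (fun z =>
    g z = pull3 (fun x u p => g (x, u, p, coordinate cq P)) z).
Proof.
  intros S E. refine (filter_imp _ _ _ (locally_constant_along cq g P _)).
  - intros [[[x u] p] q] H. exact H.
  - exact (filter_and _ _ (locally_dif _ _ S) E).
Qed.

Lemma reduce_pq (g : jet -> R) (P : jet) :
  smooth_near g P -> locally P (fun z => partial cp g z = 0) ->
  locally P (fun z => partial cq g z = 0) ->
  locally P (fun z =>
    g z = pull2 (fun x u => g (x, u, coordinate cp P, coordinate cq P)) z).
Proof.
  intros S Ep Eq.
  assert (A := locally_constant_along cq g P (filter_and _ _ (locally_dif _ _ S) Eq)).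
  assert (B := locally_constant_along cp g P (filter_and _ _ (locally_dif _ _ S) Ep)).
  destruct A as [e1 A], B as [e2 B].
  exists (mkposreal _ (Rmin_stable_in_posreal e1 e2)). simpl.
  intros z Z.
  assert (Z1 : ball P e1 z) by (apply ball_le with (2 := Z); apply Rmin_l).
  assert (Z2 : ball P e2 z) by (apply ball_le with (2 := Z); apply Rmin_r).
  rewrite (A z Z1). destruct P as [[[x0 u0] p0] q0], z as [[[x u] p] q].
  destruct Z2 as [[[Zx Zu] Zp] Zq].
  apply (B (x, u, p, q0)). repeat split; auto. apply ball_center.
Qed.

(** * Derivations *)

(** [emb] is the inclusion of a coordinate plane; the two-variable theorem on mixed derivatives is
    transported once for all six planes. *)
Lemma schwarz_embedded (g : jet -> R) (emb : R -> R -> jet) (i j : coord) (x y : R) :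
  (forall Q : jet -> Prop, locally (emb x y) Q -> locally_2d (fun a b => Q (emb a b)) x y) ->
  (forall h a b, slice i h (emb a b) = fun t => h (emb t b)) ->
  (forall h a b, slice j h (emb a b) = fun t => h (emb a t)) ->
  (forall a b, coordinate i (emb a b) = a) ->
  (forall a b, coordinate j (emb a b) = b) ->
  smooth_near g (emb x y) ->
  partial i (partial j g) (emb x y) = partial j (partial i g) (emb x y).
Proof.
  intros L Si Sj Ci Cj S.
  assert (Pi : forall h a b, partial i h (emb a b) = Derive (fun t => h (emb t b)) a).
  { intros. unfold partial. now rewrite Si, Ci. }
  assert (Pj : forall h a b, partial j h (emb a b) = Derive (fun t => h (emb a t)) b).
  { intros. unfold partial. now rewrite Sj, Cj. }
  assert (E1 : forall a b, partial i (partial j g) (emb a b) =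
    Derive (fun z => Derive (fun t => g (emb z t)) b) a).
  { intros. rewrite Pi. apply Derive_ext. intros. apply Pj. }
  assert (E2 : forall a b, partial j (partial i g) (emb a b) =
    Derive (fun z => Derive (fun t => g (emb t z)) a) b).
  { intros. rewrite Pj. apply Derive_ext. intros. apply Pi. }
  rewrite E1, E2. apply (Schwarz (fun a b => g (emb a b))).
  - generalize (L _ S). apply locally_2d_impl, locally_2d_forall. intros a b H.
    assert (D1 := proj2 (H nil)). assert (D2 := proj2 (H (j :: nil)) i).
    assert (D3 := proj2 (H (i :: nil)) j). simpl in D1, D2, D3.
    assert (Di := D1 i). assert (Dj := D1 j).
    rewrite Si, Ci in Di, D2. rewrite Sj, Cj in Dj, D3.
    repeat split; auto.
    + apply ex_derive_ext with (2 := D2). intros t. apply Pj.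
    + apply ex_derive_ext with (2 := D3). intros t. apply Pi.
  - intros eps. assert (C := proj1 (locally_singleton _ _ S (i :: j :: nil)) _
      (locally_ball _ eps)).
    generalize (L _ C). apply locally_2d_impl, locally_2d_forall. intros a b H.
    rewrite <- !E1. exact H.
  - intros eps. assert (C := proj1 (locally_singleton _ _ S (j :: i :: nil)) _
      (locally_ball _ eps)).
    generalize (L _ C). apply locally_2d_impl, locally_2d_forall. intros a b H.
    rewrite <- !E2. exact H.
Qed.

Ltac box := intros; repeat split; simpl; try apply ball_center; assumption.

Lemma partial_comm (i j : coord) (g : jet -> R) (P : jet) :
  smooth_near g P -> partial i (partial j g) P = partial j (partial i g) P.
Proof.
  destruct P as [[[x u] p] q]. intros S.

  assert (loc : forall (emb : R -> R -> jet) a b, (forall (eps : posreal) a' b',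
    Rabs (a' - a) < eps -> Rabs (b' - b) < eps -> ball (emb a b) eps (emb a' b')) ->
    forall Q : jet -> Prop, locally (emb a b) Q -> locally_2d (fun a b => Q (emb a b)) a b).
  { intros emb a b H Q [eps HQ]. exists eps. intros a' b' A B. now apply HQ, H. }
  assert (Hxu := schwarz_embedded g (fun a b => (a, b, p, q)) cx cu x u
    (loc (fun a b => (a, b, p, q)) x u ltac:(box))).
  assert (Hxp := schwarz_embedded g (fun a b => (a, u, b, q)) cx cp x p
    (loc (fun a b => (a, u, b, q)) x p ltac:(box))).
  assert (Hxq := schwarz_embedded g (fun a b => (a, u, p, b)) cx cq x q
    (loc (fun a b => (a, u, p, b)) x q ltac:(box))).
  assert (Hup := schwarz_embedded g (fun a b => (x, a, b, q)) cu cp u p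
    (loc (fun a b => (x, a, b, q)) u p ltac:(box))).
  assert (Huq := schwarz_embedded g (fun a b => (x, a, p, b)) cu cq u q
    (loc (fun a b => (x, a, p, b)) u q ltac:(box))).
  assert (Hpq := schwarz_embedded g (fun a b => (x, u, a, b)) cp cq p q
    (loc (fun a b => (x, u, a, b)) p q ltac:(box))).
  destruct i, j; try reflexivity;
    first [apply Hxu | apply Hxp | apply Hxq | apply Hup | apply Huq | apply Hpq
      | symmetry; first [apply Hxu | apply Hxp | apply Hxq | apply Hup | apply Huq
                        | apply Hpq]];
    first [exact S | intros; reflexivity].
Qed.

(** Common interface of [partial i] and [D f], so that a computation is done once for both.
    [derivation_ext] makes the operators local: an identity valid on an open set may be
    differentiated. *)
Record derivation (d : (jet -> R) -> jet -> R) : Prop := {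
  derivation_ext : forall g h z, locally z (fun y => g y = h y) -> d g z = d h z;
  derivation_const : forall c z, d (fun _ => c) z = 0;
  derivation_plus : forall g h z, dif g z -> dif h z ->
    d (fun y => g y + h y) z = d g z + d h z;
  derivation_mult : forall g h z, dif g z -> dif h z ->
    d (fun y => g y * h y) z = d g z * h z + g z * d h z;
  derivation_comp : forall k g z l, dif g z -> is_derive k (g z) l ->
    d (fun y => k (g y)) z = l * d g z }.

Lemma partial_derivation (i : coord) : derivation (partial i).
Proof.
  split.
  - intros. now apply partial_ext_loc.
  - intros. apply partial_eq, is_slice_const.
  - intros. now apply partial_eq, is_slice_plus; apply partial_is_derive.
  - intros. now apply partial_eq, is_slice_mult; apply partial_is_derive.
  - intros. now apply partial_eq, is_slice_comp1; [apply partial_is_derive|].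
Qed.

Lemma D_derivation (f : jet -> R) : derivation (D f).
Proof.
  split; unfold D, total; intros.
  - now rewrite !(partial_ext_loc _ g h z).
  - rewrite !(derivation_const _ (partial_derivation _)). ring.
  - rewrite !(derivation_plus _ (partial_derivation _)) by auto. ring.
  - rewrite !(derivation_mult _ (partial_derivation _)) by auto. ring.
  - rewrite !(derivation_comp _ (partial_derivation _) k g z l) by auto. ring.
Qed.

(** The value is bundled with the existence of partial derivatives, because [Derive] has a value
    even where there is no derivative; the rules propagate both. *)
Definition isd (d : (jet -> R) -> jet -> R) (g : jet -> R) (z : jet) (l : R) : Prop :=
  dif g z /\ d g z = l.

Section Rules.

Variable d : (jet -> R) -> jet -> R.
Hypothesis der : derivation d.

Lemma isd_refl g z : dif g z -> isd d g z (d g z).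
Proof. now split. Qed.

Lemma isd_const c z : isd d (fun _ => c) z 0.
Proof.
  split; [|now apply derivation_const]. intros i. eexists. apply is_slice_const.
Qed.

Lemma isd_plus g h z a b :
  isd d g z a -> isd d h z b -> isd d (fun y => g y + h y) z (a + b).
Proof.
  intros [G <-] [H <-]. split; [|now apply derivation_plus].
  intros i. eexists. apply is_slice_plus; now apply partial_is_derive.
Qed.

Lemma isd_mult g h z a b :
  isd d g z a -> isd d h z b -> isd d (fun y => g y * h y) z (a * h z + g z * b).
Proof.
  intros [G <-] [H <-]. split; [|now apply derivation_mult].
  intros i. eexists. apply is_slice_mult; now apply partial_is_derive.
Qed.

Lemma isd_comp k g z a l :
  isd d g z a -> is_derive k (g z) l -> isd d (fun y => k (g y)) z (l * a).
Proof.
  intros [G <-] K. split; [|now apply derivation_comp].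
  intros i. eexists. apply is_slice_comp1; [now apply partial_is_derive | exact K].
Qed.

Lemma isd_opp g z a : isd d g z a -> isd d (fun y => - g y) z (- a).
Proof.
  intros G. replace (- a) with (-1 * a) by ring.
  apply (isd_comp Ropp); auto. auto_derive; auto.
Qed.

Lemma isd_minus g h z a b :
  isd d g z a -> isd d h z b -> isd d (fun y => g y - h y) z (a - b).
Proof. intros G H. apply isd_plus; auto. now apply isd_opp. Qed.

Lemma isd_inv g z a : isd d g z a -> g z <> 0 -> isd d (fun y => / g y) z (- a / g z ^ 2).
Proof.
  intros G N. replace (- a / g z ^ 2) with (- / g z ^ 2 * a) by (field; auto).
  apply (isd_comp Rinv); auto. now apply is_derive_Rinv.
Qed.

Lemma isd_div g h z a b :
  isd d g z a -> isd d h z b -> h z <> 0 ->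
  isd d (fun y => g y / h y) z ((a * h z - g z * b) / h z ^ 2).
Proof.
  intros G H N.
  replace ((a * h z - g z * b) / h z ^ 2) with (a * / h z + g z * (- b / h z ^ 2))
    by (field; auto).
  apply isd_mult; auto. now apply isd_inv.
Qed.

Lemma isd_pow g z a n :
  isd d g z a -> isd d (fun y => g y ^ n) z (INR n * g z ^ pred n * a).
Proof.
  intros G. apply (isd_comp (fun x => x ^ n)); auto.
  apply is_derive_Reals, derivable_pt_lim_pow.
Qed.

Lemma derivation_eq (U : jet -> Prop) (F E : jet -> R) (z : jet) (l : R) :
  open U -> (forall y, U y -> F y = E y) -> U z -> isd d E z l -> d F z = l.
Proof.
  intros O H Z [_ <-]. apply derivation_ext; auto. now apply (locally_open_ext U).
Qed.

End Rules.

Lemma smooth_on_D (U : jet -> Prop) (f g : jet -> R) :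
  open U -> smooth_on U f -> smooth_on U g -> smooth_on U (D f g).
Proof.
  intros O F G. unfold D, total.
  repeat first [apply (smooth_on_plus U O) | apply (smooth_on_mult U O)];
    auto using smooth_on_partial, smooth_on_coordinate.
Qed.

Ltac solve_smooth :=
  lazymatch goal with
  | |- smooth_on _ (fun _ => ?c) => apply smooth_on_const; assumption
  | |- smooth_on ?U (fun z => (@?g z + @?h z)%R) =>
      apply (smooth_on_plus U ltac:(assumption) g h); solve_smooth
  | |- smooth_on ?U (fun z => (@?g z - @?h z)%R) =>
      apply (smooth_on_minus U ltac:(assumption) g h); solve_smooth
  | |- smooth_on ?U (fun z => (@?g z * @?h z)%R) =>
      apply (smooth_on_mult U ltac:(assumption) g h); solve_smooth
  | |- smooth_on ?U (fun z => (@?g z / @?h z)%R) =>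
      apply (smooth_on_div U ltac:(assumption) g h);
      [solve_smooth | solve_smooth | try assumption]
  | |- smooth_on ?U (fun z => (- @?g z)%R) =>
      apply (smooth_on_opp U ltac:(assumption) g); solve_smooth
  | |- smooth_on ?U (fun z => pow (@?g z) ?n) =>
      apply (smooth_on_pow U ltac:(assumption) g n); solve_smooth
  | |- smooth_on ?U (fun z => ?g z) => change (fun z => g z) with g; solve_smooth
  | |- smooth_on _ (partial ?i ?g) =>
      first [assumption | apply smooth_on_partial; solve_smooth]
  | |- smooth_on _ (D ?f ?g) =>
      first [assumption | apply smooth_on_D; [assumption | solve_smooth | solve_smooth]]
  | |- smooth_on _ (coordinate ?i) => apply smooth_on_coordinate; assumption
  | |- _ => try assumption
  end.

Ltac solve_derivation :=
  first [apply partial_derivation | apply D_derivation | assumption].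

(* Computes the value of a derivation on an explicit expression; the
   expression is inspected syntactically because unification would unfold
   [D] into a sum. *)
Ltac derive :=
  lazymatch goal with
  | |- isd ?d (fun _ => ?c) _ _ => apply isd_const; solve_derivation
  | |- isd ?d (fun z => (@?g z + @?h z)%R) _ _ =>
      apply (isd_plus d ltac:(solve_derivation) g h); derive
  | |- isd ?d (fun z => (@?g z - @?h z)%R) _ _ =>
      apply (isd_minus d ltac:(solve_derivation) g h); derive
  | |- isd ?d (fun z => (@?g z * @?h z)%R) _ _ =>
      apply (isd_mult d ltac:(solve_derivation) g h); derive
  | |- isd ?d (fun z => (@?g z / @?h z)%R) _ _ =>
      apply (isd_div d ltac:(solve_derivation) g h); [derive | derive | cbv beta; auto]
  | |- isd ?d (fun z => (- @?g z)%R) _ _ =>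
      apply (isd_opp d ltac:(solve_derivation) g); derive
  | |- isd ?d (fun z => pow (@?g z) ?n) _ _ =>
      apply (isd_pow d ltac:(solve_derivation) g); derive
  | |- isd ?d (fun z => ?g z) ?y ?l => change (isd d g y l); derive
  | Z : ?U ?z |- isd ?d ?g ?z _ =>
      apply isd_refl; apply (smooth_on_dif U); [solve_smooth | assumption]
  end.

(* Rewrites the left-hand side [d F z] of the goal, where [F = E] on [U] by [H]. *)
Tactic Notation "derive_using" uconstr(U) uconstr(E) uconstr(H) :=
  lazymatch goal with
  | |- ?d ?F ?z = _ =>
      eapply eq_trans;
      [eapply (derivation_eq d ltac:(solve_derivation) U F E z _ ltac:(assumption));
        [exact H | assumption | derive]
      | cbv beta]
  end.

(** * Commutators with D and the variational derivative *)

Section Equation.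

Variables (f : jet -> R) (U : jet -> Prop).
Hypotheses (O : open U) (Sf : smooth_on U f).

Lemma near_of_on g z : smooth_on U g -> U z -> smooth_near g z.
Proof. intros G Z. now apply (smooth_on_near U). Qed.

Lemma partial_coordinate_eq i j z :
  partial i (coordinate j) z
  = match i, j with cx, cx | cu, cu | cp, cp | cq, cq => 1 | _, _ => 0 end.
Proof. apply partial_eq, partial_coordinate. Qed.

(** Mixed partial derivatives commute, so only the coefficients p, q and f of D contribute: [d_u, D]
    = f_u d_q, [d_p, D] = d_u + f_p d_q, [d_q, D] = d_p + f_q d_q. *)
Lemma partial_D (i : coord) (g : jet -> R) (z : jet) :
  smooth_on U g -> U z ->
  partial i (D f g) z
  = D f (partial i g) z + partial i f z * partial cq g z
    + match i with cp => partial cu g z | cq => partial cp g z | _ => 0 end.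
Proof.
  intros Sg Z.
  derive_using U (fun y => partial cx g y + coordinate cp y * partial cu g y
    + coordinate cq y * partial cp g y + f y * partial cq g y)
    (fun y _ => eq_refl).
  rewrite !partial_coordinate_eq. unfold D, total.
  rewrite !(partial_comm _ i) by now apply near_of_on.
  destruct i; ring.
Qed.

Lemma derivation_zero d g z :
  derivation d -> (forall y, U y -> g y = 0) -> U z -> d g z = 0.
Proof.
  intros Dd H Z. apply (derivation_eq d Dd U g (fun _ => 0) z); auto.
  now apply isd_const.
Qed.

Lemma derivation_on d g h z :
  derivation d -> (forall y, U y -> g y = h y) -> U z -> d g z = d h z.
Proof.
  intros Dd H Z. apply (derivation_ext d Dd). now apply (locally_open_ext U).
Qed.

Lemma partial_comm_on i j g z :
  smooth_on U g -> U z -> partial i (partial j g) z = partial j (partial i g) z.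
Proof. intros G Z. now apply partial_comm, near_of_on. Qed.

(* The variational derivative of g(x, u, u', u''), which annihilates total
   derivatives of functions of (x, u, u'). *)
Definition euler (g : jet -> R) (z : jet) : R :=
  partial cu g z - D f (partial cp g) z + D f (D f (partial cq g)) z.

(** Commuting d_q with D, write F = f_q. The terms D F_p, 9 + 9 from D^2 F and -27 from D f_p, leave
    the -9 of the variational derivative; of the 63 F_u that appear, 54 belong to 3 I_7. *)
Lemma euler_I3 z : U z ->
  54 * partial cq (I3 f) z = 3 * I7 f z + 9 * euler (partial cq f) z.
Proof.
  intros Z. set (F := partial cq f).
  assert (SF : smooth_on U F) by now apply smooth_on_partial.
  assert (e1 : forall y, U y -> partial cq (D f F) y
     = D f (partial cq F) y + F y * partial cq F y + partial cp F y).
  { intros y Y. now apply partial_D. }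
  assert (e2 : partial cp (D f F) z
     = D f (partial cp F) z + partial cp f z * partial cq F z + partial cu F z)
    by now apply partial_D.
  assert (e3 : partial cq (D f (D f F)) z
     = D f (partial cq (D f F)) z + F z * partial cq (D f F) z + partial cp (D f F) z).
  { apply partial_D; auto. now apply smooth_on_D. }
  assert (e4 : D f (partial cq (D f F)) z = D f (D f (partial cq F)) z
     + (D f F z * partial cq F z + F z * D f (partial cq F) z) + D f (partial cp F) z).
  { derive_using U (fun y => D f (partial cq F) y + F y * partial cq F y + partial cp F y)
      e1. ring. }
  assert (c1 : forall y, U y -> partial cq (partial cp f) y = partial cp F y).
  { intros y Y. now apply partial_comm_on. }
  assert (c2 : partial cq (partial cu f) z = partial cu F z) by now apply partial_comm_on.
  assert (e5 : partial cq (D f (partial cp f)) z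
     = D f (partial cp F) z + F z * partial cp F z + partial cp (partial cp f) z).
  { rewrite partial_D by (auto; now apply smooth_on_partial).
    rewrite (derivation_on (D f) _ _ z (D_derivation f) c1 Z), c1 by auto. reflexivity. }
  assert (e0 : partial cq (I3 f) z = 1 / 54 * (12 * F z ^ 2 * partial cq F z
     + 18 * partial cq F z * (partial cp f z - D f F z)
     + 18 * F z * (partial cp F z - partial cq (D f F) z)
     + 9 * partial cq (D f (D f F)) z - 27 * partial cq (D f (partial cp f)) z
     + 54 * partial cu F z)).
  { derive_using U (fun y => 1 / 54 * (4 * F y ^ 3 + 18 * F y * (partial cp f y - D f F y)
       + 9 * D f (D f F) y - 27 * D f (partial cp f) y + 54 * partial cu f y))
      (fun y _ => eq_refl).
    rewrite c1, c2 by auto. simpl. ring. }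
  rewrite e0, e3, e4, e5, e2, e1 by auto.
  unfold I7, euler. fold F. rewrite c1, c2 by auto. field.
Qed.

Lemma euler_linear (a b : R) g h k z :
  smooth_on U h -> smooth_on U k -> (forall y, U y -> g y = a * h y + b * k y) ->
  U z -> euler g z = a * euler h z + b * euler k z.
Proof.
  intros Sh Sk E Z. unfold euler.
  assert (P : forall i y, U y -> partial i g y = a * partial i h y + b * partial i k y).
  { intros i y Y. derive_using U (fun y => a * h y + b * k y) E. ring. }
  assert (Dq : forall y, U y -> D f (partial cq g) y
     = a * D f (partial cq h) y + b * D f (partial cq k) y).
  { intros y Y. derive_using U (fun y => a * partial cq h y + b * partial cq k y) (P cq).
    ring. }
  assert (Dp : D f (partial cp g) z = a * D f (partial cp h) z + b * D f (partial cp k) z).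
  { derive_using U (fun y => a * partial cp h y + b * partial cp k y) (P cp). ring. }
  assert (DDq : D f (D f (partial cq g)) z
     = a * D f (D f (partial cq h)) z + b * D f (D f (partial cq k)) z).
  { derive_using U (fun y => a * D f (partial cq h) y + b * D f (partial cq k) y) Dq. ring. }
  rewrite P, Dp, DDq by auto. ring.
Qed.

(** Without q-dependence the terms in f drop out of the commutators. *)
Lemma partial_D_first_order i g z :
  smooth_on U g -> (forall y, U y -> partial cq g y = 0) -> U z ->
  partial i (D f g) z = D f (partial i g) z
    + match i with cp => partial cu g z | cq => partial cp g z | _ => 0 end.
Proof.
  intros Sg Q Z. rewrite partial_D by auto. rewrite Q by auto. ring.
Qed.

Lemma partial_q_D_first_order g z :
  smooth_on U g -> (forall y, U y -> partial cq g y = 0) -> U z ->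
  partial cq (D f g) z = partial cp g z.
Proof.
  intros Sg Q Z. rewrite partial_D_first_order by auto.
  rewrite (derivation_zero (D f) (partial cq g)); auto using D_derivation. ring.
Qed.

(** D n / n is the total derivative of log |n|, a function of (x, u, p), and such total derivatives
    are annihilated. Computing with the quotient makes the sign of n irrelevant. *)
Lemma euler_log_derivative n z :
  smooth_on U n -> (forall y, U y -> n y <> 0) -> (forall y, U y -> partial cq n y = 0) ->
  U z -> euler (fun y => D f n y / n y) z = 0.
Proof.
  intros Sn N Q Z. unfold euler. set (L := fun y => D f n y / n y).
  assert (Lq : forall y, U y -> partial cq L y = partial cp n y / n y).
  { intros y Y. derive_using U (fun y => D f n y / n y) (fun y _ => eq_refl).
    rewrite partial_q_D_first_order, Q by auto. field. auto. }
  assert (Lp : forall y, U y -> partial cp L y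
     = (D f (partial cp n) y + partial cu n y) / n y - D f n y * partial cp n y / n y ^ 2).
  { intros y Y. derive_using U (fun y => D f n y / n y) (fun y _ => eq_refl).
    rewrite partial_D_first_order by auto. field. auto. }
  assert (Lu : partial cu L z
     = D f (partial cu n) z / n z - D f n z * partial cu n z / n z ^ 2).
  { derive_using U (fun y => D f n y / n y) (fun y _ => eq_refl).
    rewrite partial_D_first_order by auto. field. auto. }
  assert (DLq : forall y, U y -> D f (partial cq L) y
     = D f (partial cp n) y / n y - partial cp n y * D f n y / n y ^ 2).
  { intros y Y. derive_using U (fun y => partial cp n y / n y) Lq. field. auto. }
  rewrite Lu.
  replace (D f (partial cp L) z) with
    ((D f (D f (partial cp n)) z + D f (partial cu n) z) / n z
     - (D f (partial cp n) z + partial cu n z) * D f n z / n z ^ 2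
     - (D f (D f n) z * partial cp n z + D f n z * D f (partial cp n) z) / n z ^ 2
     + 2 * D f n z * partial cp n z * D f n z / n z ^ 3).
  2: { symmetry. derive_using U (fun y => (D f (partial cp n) y + partial cu n y) / n y
         - D f n y * partial cp n y / n y ^ 2) Lp; [now apply pow_nonzero, N|].
       simpl. field. auto. }
  replace (D f (D f (partial cq L)) z) with
    (D f (D f (partial cp n)) z / n z - D f (partial cp n) z * D f n z / n z ^ 2
     - (D f (partial cp n) z * D f n z + partial cp n z * D f (D f n) z) / n z ^ 2
     + 2 * partial cp n z * D f n z * D f n z / n z ^ 3).
  2: { symmetry. derive_using U (fun y => D f (partial cp n) y / n y
         - partial cp n y * D f n y / n y ^ 2) DLq; [now apply pow_nonzero, N|].
       simpl. field. auto. }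
  field. auto.
Qed.

End Equation.

(** From g_q = 0 one gets g_pp = (D g_p)_q = g_uq = 0, hence g = M + p N. The p-free part of g_u = D
    g_p is then M_u = N_x, the closedness required by [potential_plane]. *)
Lemma potential (f g : jet -> R) (U : jet -> Prop) (P : jet) :
  open U -> smooth_on U f -> smooth_on U g -> U P ->
  (forall z, U z -> partial cq g z = 0) ->
  (forall z, U z -> partial cu g z = D f (partial cp g) z) ->
  exists Phi : R -> R -> R, smooth_near (pull2 Phi) P /\
    locally P (fun z => D f (pull2 Phi) z = g z).
Proof.
  intros O Sf Sg UP Q E.
  assert (Sgp : smooth_on U (partial cp g)) by now apply smooth_on_partial.
  assert (pq : forall z, U z -> partial cq (partial cp g) z = 0).
  { intros z Z. rewrite (partial_comm_on U) by auto.
    apply (derivation_zero U O (partial cp)); auto. apply partial_derivation. }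
  assert (pp : forall z, U z -> partial cp (partial cp g) z = 0).
  { intros z Z. rewrite <- (partial_q_D_first_order f U) by auto.
    rewrite <- (derivation_on U O (partial cq) _ _ z (partial_derivation _) E Z).
    rewrite (partial_comm_on U) by auto.
    apply (derivation_zero U O (partial cu)); auto. apply partial_derivation. }
  set (M := fun z => g z - coordinate cp z * partial cp g z).
  assert (SM : smooth_on U M) by (unfold M; solve_smooth).
  assert (dM : forall i z, U z -> partial i M z = partial i g z
    - (match i with cp => 1 | _ => 0 end * partial cp g z
       + coordinate cp z * partial i (partial cp g) z)).
  { intros i z Z.
    derive_using U (fun z => g z - coordinate cp z * partial cp g z) (fun y _ => eq_refl).
    rewrite partial_coordinate_eq. destruct i; ring. }
  destruct P as [[[x0 u0] p0] q0]. set (P := (x0, u0, p0, q0) : jet) in *.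
  assert (near : forall Q : jet -> Prop, (forall z, U z -> Q z) -> locally P Q).
  { intros H. now apply (locally_open_ext U). }
  assert (Mp : forall z, U z -> partial cp M z = 0).
  { intros z Z. rewrite dM, pp by auto. ring. }
  assert (Mq : forall z, U z -> partial cq M z = 0).
  { intros z Z. rewrite dM, pq, Q by auto. ring. }
  assert (RM := reduce_pq M P (smooth_on_near U M P O UP SM) (near _ Mp) (near _ Mq)).
  assert (RN := reduce_pq (partial cp g) P (smooth_on_near U _ P O UP Sgp)
    (near _ pp) (near _ pq)).
  set (M2 := fun x u => M (x, u, coordinate cp P, coordinate cq P)) in *.
  set (N2 := fun x u => partial cp g (x, u, coordinate cp P, coordinate cq P)) in *.
  destruct (potential_plane M2 N2 P) as (Phi & SPhi & EPhi).
  - apply (smooth_near_ext_loc M); auto. now apply (smooth_on_near U).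
  - apply (smooth_near_ext_loc (partial cp g)); auto. now apply (smooth_on_near U).
  - generalize (filter_and _ _ (near U (fun z Z => Z)) (filter_and _ _
      (locally_locally _ _ RM) (locally_locally _ _ RN))).
    apply filter_imp. intros z (Z & LM & LN).
    rewrite <- (partial_ext_loc cx _ _ z LN), <- (partial_ext_loc cu _ _ z LM).
    rewrite dM, E by auto. unfold D, total.
    rewrite pp, pq by auto. eq_in_R. ring.
  - exists Phi. split; auto.
    generalize (filter_and _ _ EPhi (filter_and _ _ RM RN)). apply filter_imp.
    intros z ((Ex & Eu) & EM & EN). unfold D. rewrite total_pull2, Ex, Eu, <- EM, <- EN.
    unfold M. eq_in_R. ring.
Qed.

(** * Prolongation of a point transformation along the equation *)

Section Transformation.

Variables (f : jet -> R) (U : jet -> Prop) (phi psi : jet -> R).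
Hypotheses (O : open U) (Sf : smooth_on U f) (Sphi : smooth_on U phi)
  (Spsi : smooth_on U psi).
Hypotheses (phi_p : forall z, U z -> partial cp phi z = 0)
  (phi_q : forall z, U z -> partial cq phi z = 0)
  (psi_p : forall z, U z -> partial cp psi z = 0)
  (psi_q : forall z, U z -> partial cq psi z = 0).

(** Derivatives of ubar with respect to xbar along solutions, with u''' already replaced by f. *)
Definition along1 (z : jet) : R := D f psi z / D f phi z.
Definition along2 (z : jet) : R := D f along1 z / D f phi z.
Definition along3 (z : jet) : R := D f along2 z / D f phi z.

(* The variation of ubar at fixed xbar; it equals the Jacobian of (phi, psi)
   divided by D_x phi, and is the function a_1. *)
Definition vertical (z : jet) : R := partial cu psi z - partial cu phi z * along1 z.

Let A := D f phi.
Let m := vertical.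
Hypothesis A_nz : forall z, U z -> A z <> 0.

Lemma A_smooth : smooth_on U A.
Proof. now apply smooth_on_D. Qed.

Lemma along1_smooth : smooth_on U along1.
Proof.
  apply smooth_on_div; auto using A_smooth. now apply smooth_on_D.
Qed.

Lemma along2_smooth : smooth_on U along2.
Proof.
  apply smooth_on_div; auto using A_smooth. apply smooth_on_D; auto using along1_smooth.
Qed.

Lemma vertical_smooth : smooth_on U vertical.
Proof.
  pose proof along1_smooth. unfold vertical. solve_smooth.
Qed.

Lemma vertical_jacobian z : U z ->
  A z * m z = partial cx phi z * partial cu psi z - partial cu phi z * partial cx psi z.
Proof.
  intros Z. unfold m, vertical, along1. fold A.
  transitivity (A z * partial cu psi z - partial cu phi z * D f psi z).
  - field. auto.
  - unfold A, D, total. rewrite phi_p, phi_q, psi_p, psi_q by auto. ring.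
Qed.

Lemma A_derivatives z : U z ->
  partial cq A z = 0 /\ partial cp A z = partial cu phi z /\
  partial cu A z = D f (partial cu phi) z.
Proof.
  intros Z. unfold A. repeat split; rewrite (partial_D_first_order f U O Sf) by auto.
  - rewrite phi_p, (derivation_zero U O (D f) (partial cq phi)); auto using D_derivation. ring.
  - rewrite (derivation_zero U O (D f) (partial cp phi)); auto using D_derivation. ring.
  - ring.
Qed.

Lemma phi_u_derivatives z : U z ->
  partial cq (partial cu phi) z = 0 /\ partial cp (partial cu phi) z = 0.
Proof.
  intros Z. rewrite !(partial_comm_on U O _ cu) by auto.
  split; apply (derivation_zero U O (partial cu)); auto using partial_derivation.
Qed.

(** The operator d_u - (phi_u / A) D differentiates at fixed xbar. It sends ubar to m and, as it
    commutes with D / A here, ubar_1 to (D / A) m, which is the u-clause. *)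
Lemma along1_derivatives z : U z ->
  partial cq along1 z = 0 /\ partial cp along1 z = m z / A z /\
  partial cu along1 z = D f m z / A z + partial cu phi z * along2 z.
Proof.
  intros Z. pose proof A_smooth as SA. pose proof along1_smooth as S1.
  destruct (A_derivatives z Z) as (Aq & Ap & Au).
  assert (SP : smooth_on U (D f psi)) by now apply smooth_on_D.
  assert (Pq : partial cq (D f psi) z = 0).
  { rewrite partial_q_D_first_order with (U := U) by auto. auto. }
  assert (Pp : partial cp (D f psi) z = partial cu psi z).
  { rewrite partial_D_first_order with (U := U) by auto.
    rewrite (derivation_zero U O (D f) (partial cp psi)); auto using D_derivation. ring. }
  assert (Pu : partial cu (D f psi) z = D f (partial cu psi) z).
  { rewrite partial_D_first_order with (U := U) by auto. ring. }
  assert (E : forall y, U y -> along1 y = D f psi y / A y) by reflexivity.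
  split; [|split].
  - derive_using U (fun y => D f psi y / A y) E. rewrite Pq, Aq. field. auto.
  - derive_using U (fun y => D f psi y / A y) E. rewrite Pp, Ap.
    unfold m, vertical. rewrite E by auto. field. auto.
  - replace (D f m z) with (D f (partial cu psi) z
      - (D f (partial cu phi) z * along1 z + partial cu phi z * D f along1 z)).
    2: { symmetry. derive_using U (fun y => partial cu psi y - partial cu phi y * along1 y)
           (fun y _ => eq_refl). ring. }
    derive_using U (fun y => D f psi y / A y) E. rewrite Pu, Au.
    unfold along2. fold A. rewrite E by auto. field. auto.
Qed.

Lemma along2_derivatives z : U z ->
  partial cq along2 z = m z / A z ^ 2 /\
  partial cp along2 z = 2 * D f m z / A z ^ 2 - m z * D f A z / A z ^ 3 /\
  partial cu along2 z = D f (D f m) z / A z ^ 2 - D f m z * D f A z / A z ^ 3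
                        + partial cu phi z * along3 z.
Proof.
  intros Z. pose proof A_smooth as SA. pose proof along1_smooth as S1.
  pose proof along2_smooth as S2. pose proof vertical_smooth as Sm. fold m in Sm.
  destruct (A_derivatives z Z) as (Aq & Ap & Au).
  destruct (along1_derivatives z Z) as (_ & yp & yu).
  assert (y1q : forall y, U y -> partial cq along1 y = 0)
    by (intros; now apply along1_derivatives).
  assert (y1p : forall y, U y -> partial cp along1 y = m y / A y)
    by (intros; now apply along1_derivatives).
  assert (y1u : forall y, U y ->
    partial cu along1 y = D f m y / A y + partial cu phi y * along2 y)
    by (intros; now apply along1_derivatives).
  assert (E1 : D f along1 z = A z * along2 z).
  { unfold along2. fold A. field. auto. }
  assert (E2 : D f along2 z = A z * along3 z).
  { unfold along3. fold A. field. auto. }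
  assert (E : forall y, U y -> along2 y = D f along1 y / A y) by reflexivity.
  assert (SD1 : smooth_on U (D f along1)) by now apply smooth_on_D.
  split; [|split].
  - derive_using U (fun y => D f along1 y / A y) E.
    rewrite (partial_q_D_first_order f U), Aq, yp by auto. field. auto.
  - assert (DT : D f (partial cp along1) z
      = (D f m z * A z - m z * D f A z) / A z ^ 2).
    { derive_using U (fun y => m y / A y) y1p. reflexivity. }
    derive_using U (fun y => D f along1 y / A y) E.
    rewrite (partial_D_first_order f U), Ap, DT, yu, E1 by auto. field. auto.
  - assert (DT : D f (partial cu along1) z
      = (D f (D f m) z * A z - D f m z * D f A z) / A z ^ 2
        + (D f (partial cu phi) z * along2 z + partial cu phi z * D f along2 z)).
    { derive_using U (fun y => D f m y / A y + partial cu phi y * along2 y) y1u.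
      reflexivity. }
    derive_using U (fun y => D f along1 y / A y) E.
    rewrite (partial_D_first_order f U), Au, DT, E1, E2 by auto. field. auto.
Qed.

(** Here f enters, through the q-derivative m / A^2 of [along2]. After division by that factor, the
    remaining terms are the coefficients of the operator (A^3 / m) (D / A)^3 m. *)
Lemma along3_derivatives z : U z ->
  A z * partial cq along3 z
    = m z / A z ^ 2 * partial cq f z + 3 * D f m z / A z ^ 2 - 3 * m z * D f A z / A z ^ 3 /\
  A z * partial cp along3 z
    = m z / A z ^ 2 * partial cp f z + 3 * D f (D f m) z / A z ^ 2
      - 6 * D f m z * D f A z / A z ^ 3 - m z * D f (D f A) z / A z ^ 3
      + 3 * m z * D f A z ^ 2 / A z ^ 4 /\
  A z * partial cu along3 z - partial cu phi z * D f along3 z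
    = m z / A z ^ 2 * partial cu f z + D f (D f (D f m)) z / A z ^ 2
      - 3 * D f (D f m) z * D f A z / A z ^ 3 - D f m z * D f (D f A) z / A z ^ 3
      + 3 * D f m z * D f A z ^ 2 / A z ^ 4.
Proof.
  intros Z. pose proof A_smooth as SA.
  pose proof along2_smooth as S2. pose proof vertical_smooth as Sm. fold m in Sm.
  destruct (A_derivatives z Z) as (Aq & Ap & Au).
  destruct (along2_derivatives z Z) as (yq & yp & yu).
  assert (y2q : forall y, U y -> partial cq along2 y = m y / A y ^ 2)
    by (intros; now apply along2_derivatives).
  assert (y2p : forall y, U y -> partial cp along2 y
     = 2 * D f m y / A y ^ 2 - m y * D f A y / A y ^ 3)
    by (intros; now apply along2_derivatives).
  assert (y2u : forall y, U y -> partial cu along2 y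
     = D f (D f m) y / A y ^ 2 - D f m y * D f A y / A y ^ 3
       + partial cu phi y * along3 y)
    by (intros; now apply along2_derivatives).
  assert (N2 : A z ^ 2 <> 0) by (apply pow_nonzero; auto).
  assert (N3 : A z ^ 3 <> 0) by (apply pow_nonzero; auto).
  assert (E2 : D f along2 z = A z * along3 z).
  { unfold along3. fold A. field. auto. }
  assert (E : forall y, U y -> along3 y = D f along2 y / A y) by reflexivity.
  assert (SD2 : smooth_on U (D f along2)) by now apply smooth_on_D.
  assert (S3 : smooth_on U along3) by (apply smooth_on_div; auto).
  assert (DTq : D f (partial cq along2) z
     = D f m z / A z ^ 2 - 2 * m z * D f A z / A z ^ 3).
  { derive_using U (fun y => m y / A y ^ 2) y2q. simpl. field. auto. }
  assert (DTp : D f (partial cp along2) z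
     = 2 * D f (D f m) z / A z ^ 2 - 5 * D f m z * D f A z / A z ^ 3
       - m z * D f (D f A) z / A z ^ 3 + 3 * m z * D f A z ^ 2 / A z ^ 4).
  { derive_using U (fun y => 2 * D f m y / A y ^ 2 - m y * D f A y / A y ^ 3) y2p.
    simpl. field. auto. }
  assert (DTu : D f (partial cu along2) z
     = D f (D f (D f m)) z / A z ^ 2 - 3 * D f (D f m) z * D f A z / A z ^ 3
       - D f m z * D f (D f A) z / A z ^ 3 + 3 * D f m z * D f A z ^ 2 / A z ^ 4
       + (D f (partial cu phi) z * along3 z + partial cu phi z * D f along3 z)).
  { derive_using U (fun y => D f (D f m) y / A y ^ 2 - D f m y * D f A y / A y ^ 3
       + partial cu phi y * along3 y) y2u. simpl. field. auto. }
  split; [|split].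
  - replace (partial cq along3 z) with
      ((partial cq (D f along2) z * A z - D f along2 z * partial cq A z) / A z ^ 2).
    2: { symmetry. derive_using U (fun y => D f along2 y / A y) E. reflexivity. }
    rewrite (partial_D f U), Aq, DTq, yq, yp by auto. field. auto.
  - replace (partial cp along3 z) with
      ((partial cp (D f along2) z * A z - D f along2 z * partial cp A z) / A z ^ 2).
    2: { symmetry. derive_using U (fun y => D f along2 y / A y) E. reflexivity. }
    rewrite (partial_D f U), Ap, DTp, yq, yu, E2 by auto. field. auto.
  - replace (partial cu along3 z) with
      ((partial cu (D f along2) z * A z - D f along2 z * partial cu A z) / A z ^ 2).
    2: { symmetry. derive_using U (fun y => D f along2 y / A y) E. reflexivity. }
    rewrite (partial_D f U), Au, DTu, yq, E2 by auto. field. auto.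
Qed.

End Transformation.

(** * The invariants of the canonical form *)

Section Form.

Variables (f : jet -> R) (U : jet -> Prop) (A m : jet -> R).
Hypotheses (O : open U) (Sf : smooth_on U f) (SA : smooth_on U A) (Sm : smooth_on U m).
Hypotheses (A_nz : forall z, U z -> A z <> 0) (m_nz : forall z, U z -> m z <> 0).
Hypothesis form_q : forall z, U z ->
  partial cq f z = 3 * (D f A z / A z - D f m z / m z).

(* [form_q], [form_p] and [form_u] give the coefficients of the operator
   D^3 - f_q D^2 - f_p D - f_u = (A^3 / m) (D / A)^3 m. *)
Definition form_p (z : jet) : R :=
  - 3 * D f (D f m) z / m z + 6 * D f m z * D f A z / (m z * A z)
  + D f (D f A) z / A z - 3 * D f A z ^ 2 / A z ^ 2.

Definition form_u (z : jet) : R :=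
  - D f (D f (D f m)) z / m z + 3 * D f (D f m) z * D f A z / (m z * A z)
  + D f m z * D f (D f A) z / (m z * A z) - 3 * D f m z * D f A z ^ 2 / (m z * A z ^ 2).

Lemma D_fq z : U z -> D f (partial cq f) z
  = 3 * (D f (D f A) z / A z - D f A z ^ 2 / A z ^ 2
         - D f (D f m) z / m z + D f m z ^ 2 / m z ^ 2).
Proof.
  intros Z. derive_using U (fun y => 3 * (D f A y / A y - D f m y / m y)) form_q.
  field. auto.
Qed.

Lemma pow_nz n g : (forall z, U z -> g z <> 0) -> forall z, U z -> g z ^ n <> 0.
Proof. intros N z Z. now apply pow_nonzero, N. Qed.

(** With f_q and f_p substituted, the terms of I_3 built from them, including D^2 f_q and D f_p, add
    up to - [form_u]; only the excess of f_u remains. *)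
Lemma I3_form z : U z -> (forall y, U y -> partial cp f y = form_p y) ->
  I3 f z = partial cu f z - form_u z.
Proof.
  intros Z Hp. pose proof (pow_nz 2 A A_nz) as A2. pose proof (pow_nz 2 m m_nz) as m2.
  assert (mA : forall y, U y -> m y * A y <> 0)
    by (intros; apply Rmult_integral_contrapositive; auto).
  assert (DDF : D f (D f (partial cq f)) z =
    3 * (D f (D f (D f A)) z / A z - 3 * D f (D f A) z * D f A z / A z ^ 2
         + 2 * D f A z ^ 3 / A z ^ 3
         - D f (D f (D f m)) z / m z + 3 * D f (D f m) z * D f m z / m z ^ 2
         - 2 * D f m z ^ 3 / m z ^ 3)).
  { derive_using U (fun z => 3 * (D f (D f A) z / A z - D f A z ^ 2 / A z ^ 2
         - D f (D f m) z / m z + D f m z ^ 2 / m z ^ 2)) D_fq. simpl. field. auto. }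
  assert (DP : D f (partial cp f) z =
    - 3 * (D f (D f (D f m)) z / m z - D f (D f m) z * D f m z / m z ^ 2)
    + 6 * (D f (D f m) z * D f A z / (m z * A z) + D f m z * D f (D f A) z / (m z * A z)
           - D f m z * D f A z * (D f m z * A z + m z * D f A z) / (m z * A z) ^ 2)
    + D f (D f (D f A)) z / A z - D f (D f A) z * D f A z / A z ^ 2
    - 6 * D f A z * D f (D f A) z / A z ^ 2 + 6 * D f A z ^ 3 / A z ^ 3).
  { derive_using U (fun z => - 3 * D f (D f m) z / m z
      + 6 * D f m z * D f A z / (m z * A z)
      + D f (D f A) z / A z - 3 * D f A z ^ 2 / A z ^ 2) Hp. simpl. field. auto. }
  unfold I3. rewrite DDF, DP, D_fq, Hp, form_q by auto. unfold form_p, form_u.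
  field. auto.
Qed.

(** Only f_q is assumed to have its form, so the defect of f_p stays visible. Necessity uses the
    identity with zero defect to compute K; sufficiency uses it with H solving the Riccati equation
    to conclude that the defect is zero. *)
Lemma I8_form (b H : jet -> R) z :
  smooth_on U b -> smooth_on U H -> (forall y, U y -> b y <> 0) ->
  (forall y, U y -> J f y = b y * A y) ->
  (forall y, U y -> D f b y = J f y * H y * b y) -> U z ->
  I8 f z = J f z ^ 4 * (2 / J f z * D f H z + H z ^ 2)
           + J f z ^ 2 * (partial cp f z - form_p z).
Proof.
  intros Sb SH b_nz HJ Hb Z.
  assert (Db : forall y, U y -> D f b y = b y * A y * H y * b y).
  { intros y Y. rewrite Hb, HJ by auto. reflexivity. }
  assert (DDb : D f (D f b) z = D f b z * A z * H z * b z + b z * D f A z * H z * b z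
    + b z * A z * D f H z * b z + b z * A z * H z * D f b z).
  { derive_using U (fun y => b y * A y * H y * b y) Db. ring. }
  assert (DJ : forall y, U y -> D f (J f) y = D f b y * A y + b y * D f A y).
  { intros y Y. derive_using U (fun y => b y * A y) HJ. ring. }
  assert (DDJ : D f (D f (J f)) z
    = D f (D f b) z * A z + 2 * D f b z * D f A z + b z * D f (D f A) z).
  { derive_using U (fun y => D f b y * A y + b y * D f A y) DJ. ring. }
  unfold I8. rewrite DDJ, DJ, DDb, Db, HJ, D_fq, form_q by auto. unfold form_p.
  field. auto.
Qed.

End Form.

Lemma J_cube f z : J f z ^ 3 = I3 f z.
Proof. apply cbrt_cube. Qed.

(** K of the canonical equation as a function of xbar; convertible to the expression inside
    [four_symmetries]. *)
Definition curvature (a : R -> R) (t : R) : R :=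
  (2 * a t * Derive_n a 2 t - 3 * Derive a t ^ 2) / a t ^ 4.

Lemma ex_derive_n_2 (a : R -> R) (t : R) :
  smooth1_near a t -> ex_derive (Derive a) t /\ ex_derive (Derive_n a 2) t.
Proof.
  intros S. apply smooth1_near_Derive in S as S1.
  split; [now apply smooth1_near_ex_derive|].
  apply smooth1_near_Derive, smooth1_near_ex_derive in S1. exact S1.
Qed.

Lemma ex_derive_curvature (a : R -> R) (t : R) :
  smooth1_near a t -> a t <> 0 -> ex_derive (curvature a) t.
Proof.
  intros S N. destruct (ex_derive_n_2 a t S) as [E1 E2].
  pose proof (smooth1_near_ex_derive a t S) as E0.
  unfold curvature. auto_derive. repeat split; auto.
  apply (pow_nonzero _ 4), N.
Qed.

(** * Necessity: invariants of an equation carried to the canonical form *)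

Section Canonical.

Variables (f : jet -> R) (U : jet -> Prop) (phi psi : jet -> R) (a : R -> R).
Hypotheses (O : open U) (Sf : smooth_on U f) (Sphi : smooth_on U phi)
  (Spsi : smooth_on U psi).
Hypotheses (phi_p : forall z, U z -> partial cp phi z = 0)
  (phi_q : forall z, U z -> partial cq phi z = 0)
  (psi_p : forall z, U z -> partial cp psi z = 0)
  (psi_q : forall z, U z -> partial cq psi z = 0).
Let A := D f phi.
Let m := vertical f phi psi.
Hypotheses (A_nz : forall z, U z -> A z <> 0) (m_nz : forall z, U z -> m z <> 0).
Hypotheses (Sa : forall z, U z -> smooth1_near a (phi z))
  (a_nz : forall z, U z -> a (phi z) <> 0).
Hypothesis canonical_form :
  forall z, U z -> along3 f phi psi z = a (phi z) ^ 3 * psi z.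

Let al := fun z => a (phi z).

Lemma al_smooth : smooth_on U al.
Proof.
  intros z Z. apply (locally_singleton z).
  apply smooth_near_comp1; auto. now apply (near_of_on U).
Qed.

Lemma derivation_al d z : derivation d -> U z -> d al z = Derive a (phi z) * d phi z.
Proof.
  intros Dd Z. apply (derivation_comp d Dd); [now apply (smooth_on_dif U)|].
  now apply Derive_correct, smooth1_near_ex_derive, Sa.
Qed.

(** Differentiate ubar_3 = a^3 ubar. In q and p the right side gives zero, while d_u - (phi_u / A) D
    kills a(phi) and leaves a^3 m; [along3_derivatives] then determines f_q, f_p and f_u. *)
Lemma canonical_forms z : U z ->
  partial cq f z = 3 * (D f A z / A z - D f m z / m z) /\
  partial cp f z = form_p f A m z /\
  partial cu f z = (al z * A z) ^ 3 + form_u f A m z.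
Proof.
  intros Z. destruct (along3_derivatives f U phi psi O Sf Sphi Spsi
    phi_p phi_q psi_p psi_q A_nz z Z) as (Hq & Hp & Hu).
  fold A m in Hq, Hp, Hu. pose proof al_smooth as Sal.
  assert (d3 : forall d, derivation d ->
    d (along3 f phi psi) z = 3 * al z ^ 2 * d al z * psi z + al z ^ 3 * d psi z).
  { intros d Dd. derive_using U (fun y => al y ^ 3 * psi y) canonical_form. simpl. ring. }
  rewrite d3, derivation_al, phi_q, psi_q in Hq by auto using partial_derivation.
  rewrite d3, derivation_al, phi_p, psi_p in Hp by auto using partial_derivation.
  rewrite !d3, !derivation_al in Hu by auto using partial_derivation, D_derivation.
  fold A in Hu.
  assert (Am : A z * partial cu psi z - partial cu phi z * D f psi z = A z * m z).
  { unfold m, vertical, along1. fold A. field. auto. }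
  assert (Hu' : al z ^ 3 * (A z * m z) = m z / A z ^ 2 * partial cu f z
      + D f (D f (D f m)) z / A z ^ 2
      - 3 * D f (D f m) z * D f A z / A z ^ 3 - D f m z * D f (D f A) z / A z ^ 3
      + 3 * D f m z * D f A z ^ 2 / A z ^ 4).
  { rewrite <- Am, <- Hu. ring. }
  clear Hu Am. pose proof (A_nz z Z) as Az. pose proof (m_nz z Z) as mz.
  split; [|split].
  - replace (partial cq f z) with (A z ^ 2 / m z * (m z / A z ^ 2 * partial cq f z
      + 3 * D f m z / A z ^ 2 - 3 * m z * D f A z / A z ^ 3)
      + 3 * (D f A z / A z - D f m z / m z)) by (field; auto).
    rewrite <- Hq. field. auto.
  - unfold form_p. replace (partial cp f z) with (A z ^ 2 / m z * (m z / A z ^ 2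
      * partial cp f z + 3 * D f (D f m) z / A z ^ 2
      - 6 * D f m z * D f A z / A z ^ 3 - m z * D f (D f A) z / A z ^ 3
      + 3 * m z * D f A z ^ 2 / A z ^ 4)
      - 3 * D f (D f m) z / m z + 6 * D f m z * D f A z / (m z * A z)
      + D f (D f A) z / A z - 3 * D f A z ^ 2 / A z ^ 2) by (field; auto).
    rewrite <- Hp. field. auto.
  - unfold form_u.
    replace ((al z * A z) ^ 3) with (A z ^ 2 / m z * (al z ^ 3 * (A z * m z)))
      by (field; auto).
    rewrite Hu'. field. auto.
Qed.

Lemma canonical_m_smooth : smooth_on U m.
Proof. now apply vertical_smooth. Qed.

Lemma canonical_A_smooth : smooth_on U A.
Proof. now apply smooth_on_D. Qed.

Lemma canonical_J z : U z -> J f z = al z * A z.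
Proof.
  intros Z. apply cube_inj. rewrite J_cube.
  rewrite (I3_form f U A m) with (z := z); auto using canonical_m_smooth, canonical_A_smooth.
  - destruct (canonical_forms z Z) as (_ & _ & E). rewrite E. ring.
  - intros y Y. now apply canonical_forms.
  - intros y Y. now apply canonical_forms.
Qed.

(** The value of D b / (J b) for b = a(phi) and J = a A. *)
Definition canonical_H (z : jet) : R := Derive a (phi z) / a (phi z) ^ 2.

Lemma canonical_H_smooth : smooth_on U canonical_H.
Proof.
  pose proof al_smooth. apply (smooth_on_div U O (fun z => Derive a (phi z))).
  - intros z Z. apply (locally_singleton z).
    apply smooth_near_comp1; [now apply (near_of_on U)|]. now apply smooth1_near_Derive, Sa.
  - now apply (smooth_on_pow U O al).
  - intros z Z. now apply pow_nonzero, a_nz.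
Qed.

Lemma canonical_b z : U z -> D f al z = J f z * canonical_H z * al z.
Proof.
  intros Z. rewrite derivation_al, canonical_J by auto using D_derivation.
  unfold canonical_H. fold A. change (al z) with (a (phi z)). field. auto.
Qed.

Lemma canonical_J_nz z : U z -> J f z <> 0.
Proof.
  intros Z. rewrite canonical_J by auto. apply Rmult_integral_contrapositive.
  split; [now apply a_nz | now apply A_nz].
Qed.

Lemma canonical_K z : U z ->
  K f z = 2 / J f z * D f canonical_H z + canonical_H z ^ 2.
Proof.
  intros Z. unfold K. rewrite (I8_form f U A m O Sf canonical_A_smooth canonical_m_smooth
    A_nz m_nz (fun y Y => proj1 (canonical_forms y Y)) al canonical_H z);
    auto using al_smooth, canonical_H_smooth, canonical_J, canonical_b.
  destruct (canonical_forms z Z) as (_ & E & _). rewrite E.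
  pose proof (canonical_J_nz z Z). field. auto.
Qed.

Lemma canonical_K_curvature z : U z -> K f z = curvature a (phi z).
Proof.
  intros Z. rewrite canonical_K by auto.
  destruct (ex_derive_n_2 a (phi z) (Sa z Z)) as [E1 E2].
  pose proof (smooth1_near_ex_derive a (phi z) (Sa z Z)) as E0.
  assert (N := a_nz z Z).
  assert (Hk : is_derive (fun t => Derive a t / a t ^ 2) (phi z)
    (Derive_n a 2 (phi z) / a (phi z) ^ 2 - 2 * Derive a (phi z) ^ 2 / a (phi z) ^ 3)).
  { auto_derive.
    - repeat split; auto.
    - change (Derive (fun x => Derive (fun x0 => a x0) x) (phi z)) with
        (Derive_n a 2 (phi z)).
      change (Derive (fun x => Derive a x) (phi z)) with (Derive_n a 2 (phi z)).
      change (Derive (fun x => a x) (phi z)) with (Derive a (phi z)).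
      field. auto. }
  assert (DH := derivation_comp (D f) (D_derivation f) (fun t => Derive a t / a t ^ 2) phi z
    _ (smooth_on_dif U phi z Sphi Z) Hk).
  change (D f canonical_H z = (Derive_n a 2 (phi z) / a (phi z) ^ 2
    - 2 * Derive a (phi z) ^ 2 / a (phi z) ^ 3) * A z) in DH.
  rewrite DH, canonical_J by auto. pose proof (A_nz z Z).
  unfold curvature, canonical_H. change (al z) with (a (phi z)). field. auto.
Qed.

Lemma derivation_K d z : derivation d -> U z ->
  d (K f) z = Derive (curvature a) (phi z) * d phi z.
Proof.
  intros Dd Z. rewrite (derivation_on U O d (K f) (fun y => curvature a (phi y)) z)
    by auto using canonical_K_curvature.
  apply (derivation_comp d Dd); [now apply (smooth_on_dif U)|].
  apply Derive_correct, ex_derive_curvature; auto.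
Qed.

(** This is the formula for f_q, with A = J / a(phi) and hence D A / A = D J / J - J H. *)
Lemma canonical_D_m z : U z ->
  D f m z = (D f (J f) z / J f z - 1 / 3 * partial cq f z - J f z * canonical_H z) * m z.
Proof.
  intros Z. pose proof al_smooth. pose proof canonical_A_smooth as SA'.
  assert (DJ : D f (J f) z = D f al z * A z + al z * D f A z).
  { derive_using U (fun y => al y * A y) canonical_J. ring. }
  destruct (canonical_forms z Z) as (E & _ & _).
  rewrite E, DJ, canonical_b, canonical_J by auto.
  pose proof (A_nz z Z). pose proof (m_nz z Z). pose proof (a_nz z Z).
  change (a (phi z)) with (al z) in *. field. auto.
Qed.

Lemma vertical_derivatives z : U z ->
  partial cq m z = 0 /\ partial cp m z = - partial cu phi z * m z / A z.
Proof.
  intros Z. destruct (along1_derivatives f U phi psi O Sf Sphi Spsi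
    phi_p phi_q psi_p psi_q A_nz z Z) as (yq & yp & _). fold A m in yp.
  destruct (phi_u_derivatives U phi O Sphi phi_p phi_q z Z) as (Bq & Bp).
  pose proof (along1_smooth f U phi psi O Sf Sphi Spsi A_nz).
  assert (Pp : partial cp (partial cu psi) z = 0).
  { rewrite (partial_comm_on U) by auto.
    apply (derivation_zero U O); auto using partial_derivation. }
  assert (Pq : partial cq (partial cu psi) z = 0).
  { rewrite (partial_comm_on U) by auto.
    apply (derivation_zero U O); auto using partial_derivation. }
  split;
    derive_using U (fun y => partial cu psi y - partial cu phi y * along1 f phi psi y)
      (fun y _ => eq_refl).
  - rewrite Pq, Bq, yq. ring.
  - rewrite Pp, Bp, yp. field. auto.
Qed.

(** Everything follows from J = a A, f_q = 3 (D A / A - D m / m), K being a function of phi, and the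
    partial derivatives of A and m. *)
Lemma canonical_invariants z : U z ->
  I1 f z = 0 /\ I2 f z = 0 /\ I4 f z = 0 /\ I5 f z = 0 /\ I6 f z = 0 /\ I7 f z = 0 /\
  I9 f z = 0 /\ I10 f z = 0 /\ I11 f z = 0.
Proof.
  intros Z. pose proof canonical_A_smooth as SA'. pose proof canonical_m_smooth as Sm.
  pose proof al_smooth as Sal.
  assert (SB : smooth_on U (partial cu phi)) by now apply smooth_on_partial.
  assert (Ad : forall y, U y -> partial cq A y = 0 /\ partial cp A y = partial cu phi y /\
    partial cu A y = D f (partial cu phi) y) by (intros; now apply (A_derivatives f U)).
  assert (Bd : forall y, U y -> partial cq (partial cu phi) y = 0 /\
    partial cp (partial cu phi) y = 0) by (intros; now apply (phi_u_derivatives U)).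
  (* The q-derivatives of D A and D m are A_p = phi_u and m_p = - phi_u m / A; each contributes 3
     phi_u / A. *)
  assert (fqq : forall y, U y -> partial cq (partial cq f) y = 6 * partial cu phi y / A y).
  { intros y Y. derive_using U (fun y => 3 * (D f A y / A y - D f m y / m y))
      (fun y Y => proj1 (canonical_forms y Y)).
    rewrite !(partial_q_D_first_order f U) by (auto; intros; first [now apply Ad | now apply vertical_derivatives]).
    destruct (Ad y Y) as (-> & -> & _). destruct (vertical_derivatives y Y) as (-> & ->).
    field. auto. }
  assert (Jd : forall y, U y -> partial cq (J f) y = 0 /\
    partial cp (J f) y = al y * partial cu phi y).
  { intros y Y. destruct (Ad y Y) as (Aq & Ap & _).
    split; derive_using U (fun y => al y * A y) canonical_J;
      rewrite derivation_al, ?phi_p, ?phi_q by auto using partial_derivation;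
      rewrite ?Aq, ?Ap; ring. }
  destruct (Ad z Z) as (Aq & Ap & Au). destruct (Bd z Z) as (Bq & Bp).
  assert (comm : forall i j g y, smooth_on U g -> U y ->
    partial i (partial j g) y = partial j (partial i g) y)
    by (intros; now apply (partial_comm_on U)).
  split; [|split; [|split; [|split; [|split; [|split; [|split; [|split]]]]]]].
  - unfold I1. derive_using U (fun y => 6 * partial cu phi y / A y) fqq.
    rewrite Bq, Aq. field. auto.
  - unfold I2.
    replace (partial cq (partial cq (partial cp f)) z) with
      (partial cp (partial cq (partial cq f)) z).
    2: { rewrite (comm cp cq) by (auto; now apply smooth_on_partial).
         apply (derivation_on U O); auto using partial_derivation. }
    rewrite fqq by auto.
    replace (partial cp (partial cq (partial cq f)) z) with
      (- 6 * partial cu phi z ^ 2 / A z ^ 2).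
    2: { symmetry. derive_using U (fun y => 6 * partial cu phi y / A y) fqq.
         rewrite Bp, Ap. field. auto. }
    field. auto.
  - unfold I4. now apply Jd.
  - unfold I5. destruct (Jd z Z) as (_ & ->). rewrite fqq, canonical_J by auto. field. auto.
  - unfold I6.
    replace (D f (partial cp (J f)) z) with
      (D f al z * partial cu phi z + al z * D f (partial cu phi) z).
    2: { symmetry. derive_using U (fun y => al y * partial cu phi y)
           (fun y Y => proj2 (Jd y Y)). ring. }
    replace (partial cu (J f) z) with
      (partial cu al z * A z + al z * D f (partial cu phi) z).
    2: { symmetry. derive_using U (fun y => al y * A y) canonical_J. rewrite Au. ring. }
    rewrite !derivation_al by auto using partial_derivation, D_derivation. fold A. ring.
  (* I_7 is read off from [euler_I3]: (I_3)_q = 0 because a A is free of q, and the variational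
     derivative of f_q is zero because f_q is a combination of logarithmic derivatives. *)
  - assert (E := euler_I3 f U O Sf z Z).
    assert (E3 : partial cq (I3 f) z = 0).
    { assert (E3 : forall y, U y -> I3 f y = (al y * A y) ^ 3)
        by (intros y Y; rewrite <- J_cube, canonical_J by auto; reflexivity).
      derive_using U (fun y => (al y * A y) ^ 3) E3.
      rewrite derivation_al, phi_q, Aq by auto using partial_derivation. simpl. ring. }
    rewrite (euler_linear f U O Sf 3 (-3) (partial cq f)
      (fun y => D f A y / A y) (fun y => D f m y / m y)) in E; auto.
    + rewrite !(euler_log_derivative f U) in E; auto.
      * lra.
      * intros y Y. now apply vertical_derivatives.
      * intros y Y. now apply Ad.
    + apply smooth_on_div; auto. now apply smooth_on_D.
    + apply smooth_on_div; auto. now apply smooth_on_D.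
    + intros y Y. destruct (canonical_forms y Y) as (-> & _). ring.
  - unfold I9. rewrite derivation_K, phi_q by auto using partial_derivation. ring.
  - unfold I10. rewrite derivation_K, phi_p by auto using partial_derivation. ring.
  - unfold I11. rewrite !derivation_K, fqq by auto using partial_derivation, D_derivation.
    fold A. field. auto.
Qed.

End Canonical.

(** * Prolongations and carrying the equation *)

Lemma pull2_p (G : R -> R -> R) (z : jet) : partial cp (pull2 G) z = 0.
Proof. rewrite partial_pull2_cp. now destruct z as [[[x u] p] q]. Qed.

Lemma pull2_q (G : R -> R -> R) (z : jet) : partial cq (pull2 G) z = 0.
Proof. rewrite partial_pull2_cq. now destruct z as [[[x u] p] q]. Qed.

Lemma total_pull2_D (f : jet -> R) (r : R) (G : R -> R -> R) (z : jet) :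
  total r (pull2 G) z = D f (pull2 G) z.
Proof. unfold D. now rewrite !total_pull2. Qed.

Lemma total_ext_loc (r : R) (g h : jet -> R) (z : jet) :
  locally z (fun y => g y = h y) -> total r g z = total r h z.
Proof. intros E. unfold total. now rewrite !(partial_ext_loc _ g h z E). Qed.

Lemma total_D (f g : jet -> R) (r : R) (z : jet) :
  total r g z = D f g z + (r - f z) * partial cq g z.
Proof. unfold D, total. ring. Qed.

Section Prolongation.

Variables (f : jet -> R) (U : jet -> Prop) (phi psi : R -> R -> R).
Hypotheses (O : open U) (Sf : smooth_on U f) (Sphi : smooth_on U (pull2 phi))
  (Spsi : smooth_on U (pull2 psi)).
Let A := D f (pull2 phi).
Let m := vertical f (pull2 phi) (pull2 psi).
Hypothesis A_nz : forall z, U z -> A z <> 0.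

Lemma prolong1_along z : prolong1 phi psi z = along1 f (pull2 phi) (pull2 psi) z.
Proof. unfold prolong1, along1. now rewrite !(total_pull2_D f). Qed.

Lemma prolong2_along z : U z ->
  prolong2 phi psi z = along2 f (pull2 phi) (pull2 psi) z.
Proof.
  intros Z. unfold prolong2, along2.
  rewrite (total_ext_loc 0 _ (along1 f (pull2 phi) (pull2 psi)))
    by (apply filter_forall; intros; apply prolong1_along).
  rewrite (total_D f). destruct (along1_derivatives f U (pull2 phi) (pull2 psi) O Sf Sphi Spsi
    (fun z _ => pull2_p phi z) (fun z _ => pull2_q phi z) (fun z _ => pull2_p psi z)
    (fun z _ => pull2_q psi z) A_nz z Z) as (-> & _).
  rewrite !(total_pull2_D f). f_equal. ring.
Qed.

(** [total r] exceeds [D f] by (r - f) d_q; the q-derivative m / A^2 of [along2] is divided by A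
    once more. *)
Lemma prolong3_along r z : U z ->
  prolong3 phi psi r z
  = along3 f (pull2 phi) (pull2 psi) z + (r - f z) * (m z / A z ^ 3).
Proof.
  intros Z. unfold prolong3, along3.
  rewrite (total_ext_loc r _ (along2 f (pull2 phi) (pull2 psi)))
    by (apply (locally_open_ext U); auto; apply prolong2_along).
  rewrite (total_D f). destruct (along2_derivatives f U (pull2 phi) (pull2 psi) O Sf Sphi Spsi
    (fun z _ => pull2_p phi z) (fun z _ => pull2_q phi z) (fun z _ => pull2_p psi z)
    (fun z _ => pull2_q psi z) A_nz z Z) as (-> & _).
  rewrite !(total_pull2_D f). fold A m. field. auto.
Qed.

Lemma jacobian_vertical z : U z -> jacobian phi psi z = A z * m z.
Proof.
  intros Z. symmetry. apply (vertical_jacobian f U); auto; intros;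
    first [apply pull2_p | apply pull2_q].
Qed.

(** The prolonged third derivative is affine in r with nonzero slope m / A^3, so the canonical
    equation holds for r = f(z) and for no other r. *)
Lemma carries_on (a : R -> R) P : U P ->
  (forall z, U z -> m z <> 0) ->
  (forall z, U z -> along3 f (pull2 phi) (pull2 psi) z
                    = a (pull2 phi z) ^ 3 * pull2 psi z) ->
  carries phi psi f (canonical a) P.
Proof.
  intros UP m_nz H. split.
  - split; [|split].
    + now apply (smooth_on_near U).
    + now apply (smooth_on_near U).
    + apply (locally_open_ext U); auto. intros z Z.
      rewrite jacobian_vertical, (total_pull2_D f) by auto. split; auto.
  - apply (locally_open_ext U); auto. intros z Z r.
    rewrite prolong3_along by auto. unfold canonical. rewrite H by auto.
    assert (N : m z / A z ^ 3 <> 0).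
    { apply Rmult_integral_contrapositive. split; auto.
      apply Rinv_neq_0_compat, pow_nonzero. auto. }
    split.
    + intros ->. ring.
    + intros E. assert (E0 : (r - f z) * (m z / A z ^ 3) = 0) by lra.
      apply Rmult_integral in E0. destruct E0; [lra | contradiction].
Qed.

End Prolongation.

Ltac from_conj H :=
  let E := fresh in pose proof H as E; hnf in E; decompose [and] E; assumption.

(** All local conditions are realised on one open set, where the preceding calculations apply; the
    last clause is the canonical equation at r = f(z). *)
Lemma carries_open (f : jet -> R) (phi psi : R -> R -> R) (a : R -> R) (P : jet) :
  smooth_near f P -> carries_to_canonical f phi psi a P ->
  exists U, open U /\ U P /\ smooth_on U f /\ smooth_on U (pull2 phi) /\
    smooth_on U (pull2 psi) /\
    (forall z, U z -> D f (pull2 phi) z <> 0) /\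
    (forall z, U z -> vertical f (pull2 phi) (pull2 psi) z <> 0) /\
    (forall z, U z -> smooth1_near a (pull2 phi z)) /\
    (forall z, U z -> a (pull2 phi z) <> 0) /\
    (forall z, U z -> Derive (curvature a) (pull2 phi z) <> 0) /\
    (forall z, U z -> along3 f (pull2 phi) (pull2 psi) z
                      = a (pull2 phi z) ^ 3 * pull2 psi z).
Proof.
  intros Sf (Sa & Fa & (Sphi & Spsi & T) & C).
  assert (Cphi := smooth_near_continuous _ _ Sphi).
  assert (La : locally P (fun z => smooth1_near a (pull2 phi z)))
    by exact (Cphi _ (smooth1_near_locally _ _ Sa)).
  assert (Lf : locally P (fun z => a (pull2 phi z) <> 0
    /\ Derive (curvature a) (pull2 phi z) <> 0)) by exact (Cphi _ Fa).
  destruct (locally_open_nbhd P _ (filter_and _ _ (filter_and _ _ (filter_and _ _ Sf Sphi)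
    (filter_and _ _ Spsi T)) (filter_and _ _ C (filter_and _ _ La Lf)))) as (U & O & UP & H).
  assert (S1 : smooth_on U f) by (intros z Z; from_conj (H z Z)).
  assert (S2 : smooth_on U (pull2 phi)) by (intros z Z; from_conj (H z Z)).
  assert (S3 : smooth_on U (pull2 psi)) by (intros z Z; from_conj (H z Z)).
  assert (A_nz : forall z, U z -> D f (pull2 phi) z <> 0).
  { intros z Z. rewrite <- (total_pull2_D f 0). from_conj (H z Z). }
  exists U. split; [exact O|]. split; [exact UP|]. split; [exact S1|]. split; [exact S2|].
  split; [exact S3|]. split; [exact A_nz|]. split; [|split; [|split; [|split]]].
  - intros z Z E. destruct (H z Z) as ((_ & _ & N & _) & _). apply N.
    rewrite (jacobian_vertical f U), E by auto. ring.
  - intros z Z. from_conj (H z Z).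
  - intros z Z. from_conj (H z Z).
  - intros z Z. from_conj (H z Z).
  - intros z Z. destruct (H z Z) as (_ & Cz & _).
    assert (E := proj1 (Cz (f z)) eq_refl).
    rewrite (prolong3_along f U) in E by auto. rewrite Rminus_diag in E.
    unfold canonical in E. rewrite <- E. eq_in_R. ring.
Qed.

Lemma reduce_q_pull3 (g : jet -> R) (U : jet -> Prop) (P : jet) :
  open U -> U P -> smooth_on U g -> (forall z, U z -> partial cq g z = 0) ->
  exists h : R -> R -> R -> R, locally P (fun z => g z = pull3 h z).
Proof.
  intros O UP S Q. exists (fun x u p => g (x, u, p, coordinate cq P)).
  apply reduce_q; [now apply (smooth_on_near U) | now apply (locally_open_ext U)].
Qed.

(** The transformation dictates the auxiliary functions: b = a(phi), H = (a' / a^2)(phi) and a_1 =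
    [vertical], which is a function of (x, u, p) because its q-derivative vanishes. *)
Lemma auxiliary_of_carries (f : jet -> R) (phi psi : R -> R -> R) (a : R -> R) (P : jet) :
  smooth_near f P -> carries_to_canonical f phi psi a P ->
  exists (H b : R -> R -> R) (a1 : R -> R -> R -> R),
    auxiliary f H b a1 P /\ transformation_system f b a1 phi psi P /\
    locally P (fun z => a (pull2 phi z) = pull2 b z).
Proof.
  intros Sf HC. destruct (carries_open f phi psi a P Sf HC) as
    (U & O & UP & S1 & S2 & S3 & A_nz & m_nz & Sa & a_nz & k_nz & E).
  set (H := fun x u => Derive a (phi x u) / a (phi x u) ^ 2).
  assert (HE : pull2 H = canonical_H (pull2 phi) a).
  { jet_ext. }
  assert (bE : pull2 (fun x u => a (phi x u)) = fun z => a (pull2 phi z)).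
  { jet_ext. }
  assert (pp := pull2_p phi). assert (pq := pull2_q phi).
  assert (sp := pull2_p psi). assert (sq := pull2_q psi).
  assert (Sm : smooth_on U (vertical f (pull2 phi) (pull2 psi)))
    by now apply vertical_smooth.
  destruct (reduce_q_pull3 (vertical f (pull2 phi) (pull2 psi)) U P O UP Sm)
    as (a1 & Ea1).
  { intros z Z. apply (vertical_derivatives f U); auto. }
  exists H, (fun x u => a (phi x u)), a1.
  unfold auxiliary, aux_H, aux_b, aux_a1, transformation_system. rewrite HE, bE.
  assert (near : forall Q : jet -> Prop, (forall z, U z -> Q z) -> locally P Q).
  { intros Q HQ. now apply (locally_open_ext U). }
  assert (Sal : smooth_on U (fun z => a (pull2 phi z))) by now apply al_smooth.
  assert (LJ : locally P (fun z => U z /\ J f z = a (pull2 phi z) * D f (pull2 phi) z)).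
  { apply near. intros z Z. split; auto. now apply (canonical_J f U (pull2 phi) (pull2 psi)). }
  split; [split; [|split]|split].
  - split; [apply (smooth_on_near U); auto; now apply canonical_H_smooth|].
    apply near. intros z Z. symmetry. now apply (canonical_K f U (pull2 phi) (pull2 psi)).
  - split; [now apply (smooth_on_near U)|]. apply near. intros z Z. split; auto.
    now apply (canonical_b f U (pull2 phi) (pull2 psi)).
  - split.
    + apply (smooth_near_ext_loc (vertical f (pull2 phi) (pull2 psi))); auto.
      now apply (smooth_on_near U).
    + generalize (filter_and _ _ (near U (fun z Z => Z)) (locally_locally _ _ Ea1)).
      apply filter_imp. intros z (Z & L). assert (L0 := locally_singleton _ _ L).
      rewrite <- (derivation_ext (D f) (D_derivation f) _ _ z L). simpl in L0.
      rewrite <- L0. split; auto.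
      now apply (canonical_D_m f U (pull2 phi) (pull2 psi) a).
  - split; [now apply (smooth_on_near U)|]. split; [now apply (smooth_on_near U)|].
    generalize (filter_and _ _ LJ Ea1). apply filter_imp. intros z ((Z & EJ) & E1).
    rewrite (jacobian_vertical f U), <- E1, EJ by auto.
    split; field; auto.
  - apply near. reflexivity.
Qed.

(** D K is the derivative of [curvature a] at phi times D phi, hence nonzero. An identically zero
    I_8 would make K and D K zero, so genericity leaves I_8 nowhere zero. *)
Lemma invariants_of_equivalent (f : jet -> R) (P : jet) :
  smooth_near f P -> generic_point f P -> equivalent_to_canonical f P ->
  invariant_conditions f P.
Proof.
  intros Sf G (phi & psi & a & HC). destruct (carries_open f phi psi a P Sf HC) as
    (U & O & UP & S1 & S2 & S3 & A_nz & m_nz & Sa & a_nz & k_nz & E).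
  assert (pp := pull2_p phi). assert (pq := pull2_q phi).
  assert (sp := pull2_p psi). assert (sq := pull2_q psi).
  assert (DK : forall z, U z -> D f (K f) z <> 0).
  { intros z Z. rewrite (derivation_K f U (pull2 phi) (pull2 psi) a)
      by auto using D_derivation.
    apply Rmult_integral_contrapositive. auto. }
  assert (I8_nz : locally P (fun z => I8 f z <> 0)).
  { destruct G as [G | G]; auto. exfalso. apply (DK P UP).
    rewrite (derivation_ext (D f) (D_derivation f) (K f) (fun _ => 0) P).
    - apply (derivation_const _ (D_derivation f)).
    - refine (filter_imp _ _ _ G). intros z Z. unfold K. rewrite Z. apply Rmult_0_l. }
  assert (LU : locally P U) by now apply O.
  unfold invariant_conditions. generalize (filter_and _ _ LU I8_nz). apply filter_imp. intros z (Z & N8).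
  split; [|split; [|split]]; auto.
  - now apply (canonical_invariants f U (pull2 phi) (pull2 psi) a).
  - rewrite <- J_cube. apply pow_nonzero.
    now apply (canonical_J_nz f U (pull2 phi) (pull2 psi) a).
Qed.

(** * Integration of the auxiliary system *)

(** The pointwise body of [invariant_conditions], named so that it can be assumed throughout an open
    set. *)
Definition invariants_at (f : jet -> R) (z : jet) : Prop :=
  (I1 f z = 0 /\ I2 f z = 0 /\ I4 f z = 0 /\ I5 f z = 0 /\ I6 f z = 0 /\
   I7 f z = 0 /\ I9 f z = 0 /\ I10 f z = 0 /\ I11 f z = 0) /\
  (I3 f z <> 0 /\ I8 f z <> 0 /\ D f (K f) z <> 0).

Section Sufficiency.

Variables (f : jet -> R) (U : jet -> Prop) (P : jet).
Hypotheses (O : open U) (UP : U P) (Sf : smooth_on U f).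
Hypothesis inv : forall z, U z -> invariants_at f z.

Let j := J f.

Lemma J_nz z : U z -> j z <> 0.
Proof.
  intros Z E. destruct (inv z Z) as (_ & N & _). apply N. rewrite <- J_cube.
  fold j. rewrite E. ring.
Qed.

Lemma J_smooth : smooth_on U j.
Proof.
  apply (smooth_on_cbrt U (I3 f) O).
  - apply (smooth_on_ext U (fun y => 1 / 54 * (4 * partial cq f y ^ 3
      + 18 * partial cq f y * (partial cp f y - D f (partial cq f) y)
      + 9 * D f (D f (partial cq f)) y - 27 * D f (partial cp f) y
      + 54 * partial cu f y)) _ O (fun y _ => eq_refl)). solve_smooth.
  - intros z Z. from_conj (inv z Z).
Qed.

Lemma K_smooth : smooth_on U (K f).
Proof.
  pose proof J_smooth as SJ.
  apply (smooth_on_ext U (fun z => 1 / 3 * ((partial cq f z ^ 2 + 3 * partial cp f z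
    - 3 * D f (partial cq f) z) * j z ^ 2
    + 6 * j z * D f (D f j) z - 9 * D f j z ^ 2) / j z ^ 4) _ O (fun y _ => eq_refl)).
  solve_smooth. intros z Z. apply pow_nonzero, J_nz, Z.
Qed.

Lemma J_q z : U z -> partial cq j z = 0.
Proof. intros Z. from_conj (inv z Z). Qed.

Lemma K_q z : U z -> partial cq (K f) z = 0.
Proof. intros Z. from_conj (inv z Z). Qed.

Lemma K_p z : U z -> partial cp (K f) z = 0.
Proof. intros Z. from_conj (inv z Z). Qed.

Lemma fqq_J z : U z -> partial cq (partial cq f) z = 6 * partial cp j z / j z.
Proof.
  intros Z. destruct (inv z Z) as ((_ & _ & _ & E & _) & _). unfold I5 in E. fold j in E.
  pose proof (J_nz z Z). apply (Rmult_eq_reg_r (j z)); auto. field_simplify; auto. lra.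
Qed.

Lemma J_u z : U z -> partial cu j z = D f (partial cp j) z.
Proof.
  intros Z. destruct (inv z Z) as ((_ & _ & _ & _ & E & _) & _). unfold I6 in E.
  fold j in E. lra.
Qed.

Lemma euler_fq z : U z -> euler f (partial cq f) z = 0.
Proof.
  intros Z. pose proof J_smooth. assert (E := euler_I3 f U O Sf z Z).
  destruct (inv z Z) as ((_ & _ & _ & _ & _ & E7 & _) & _). rewrite E7 in E.
  assert (E3 : partial cq (I3 f) z = 0).
  { derive_using U (fun y => j y ^ 3) (fun y _ => eq_sym (J_cube f y)).
    rewrite J_q by auto. ring. }
  rewrite E3 in E. lra.
Qed.

(** On functions of a potential phi of J, the operator D / J is differentiation in phi, so the
    equation reads 2 H' + H^2 = k. The substitution H = 2 y' / y turns it into 4 y'' = k y. *)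
Lemma exists_H : exists H : R -> R -> R, aux_H f H P.
Proof.
  pose proof J_smooth as SJ. pose proof K_smooth as SK.
  destruct (potential f j U P O Sf SJ UP J_q J_u) as (phi & Sphi & Ephi).
  assert (near : forall Q : jet -> Prop, (forall z, U z -> Q z) -> locally P Q).
  { intros Q HQ. now apply (locally_open_ext U). }
  assert (RK := reduce_pq (K f) P (smooth_on_near U _ P O UP SK)
    (near _ K_p) (near _ K_q)).
  set (K2 := fun x u => K f (x, u, coordinate cp P, coordinate cq P)) in *.
  assert (SK2 : smooth_near (pull2 K2) P).
  { apply (smooth_near_ext_loc (K f)); auto. now apply (smooth_on_near U). }
  assert (N0 : total 0 (pull2 phi) P <> 0).
  { rewrite (total_pull2_D f), (locally_singleton _ _ Ephi). now apply J_nz. }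
  (* With f_qq expressed by I_5 and J_p = phi_u, the condition I_11 = 0 is the vanishing of the
     Jacobian of K and phi. *)
  destruct (function_of K2 phi P SK2 Sphi N0) as (k & Sk & Ek).
  { generalize (filter_and _ _ (filter_and _ _ (near U (fun z Z => Z)) (locally_dif _ _ SK2))
      (filter_and _ _ (filter_and _ _ (locally_locally _ _ RK) (locally_locally _ _ Ephi))
        (smooth_near_locally _ _ Sphi))).
    apply filter_imp. intros z ((Z & dK) & (LK & Lphi) & Sz).
    destruct (inv z Z) as ((_ & _ & _ & _ & _ & _ & _ & _ & E11) & _).
    unfold I11 in E11. rewrite fqq_J in E11 by auto.
    rewrite <- !(partial_ext_loc _ _ _ z LK).
    destruct (smooth_near_open _ _ Sz) as (V & OV & Vz & SV).
    assert (Sf' : exists W, open W /\ W z /\ smooth_on W f /\ smooth_on W (pull2 phi)).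
    { apply smooth_near_open2; auto. now apply (smooth_on_near U). }
    destruct Sf' as (W & OW & Wz & SWf & SWphi).
    assert (Jp : partial cp j z = partial cu (pull2 phi) z).
    { rewrite <- (partial_ext_loc cp _ _ z Lphi).
      rewrite (partial_D_first_order f W OW SWf) by (auto; intros; apply pull2_q).
      rewrite (derivation_zero W OW (D f) (partial cp (pull2 phi)));
        auto using D_derivation, pull2_p. ring. }
    assert (DK : D f (K f) z = partial cx (K f) z + coordinate cp z * partial cu (K f) z).
    { unfold D, total. rewrite K_p, K_q by auto. ring. }
    assert (Dphi := locally_singleton _ _ Lphi). simpl in Dphi. unfold D in Dphi.
    rewrite total_pull2 in Dphi. fold j in Dphi.
    rewrite Jp, DK in E11. pose proof (J_nz z Z) as Nj.
    assert (E : partial cu (pull2 phi) z * (partial cx (K f) z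
      + coordinate cp z * partial cu (K f) z) = j z * partial cu (K f) z).
    { apply (Rmult_eq_reg_l (6 / j z)); [|now apply Rmult_integral_contrapositive; split;
        [lra | apply Rinv_neq_0_compat]].
      transitivity (6 * partial cu (K f) z); [|field; auto].
      transitivity (6 * partial cu (pull2 phi) z / j z *
         (partial cx (K f) z + coordinate cp z * partial cu (K f) z)); [field; auto|].
      eq_in_R. lra. }
    rewrite <- Dphi in E. eq_in_R. lra. }
  set (t0 := pull2 phi P) in *.
  assert (Sk4 : smooth1_near (fun t => / 4 * k t) t0).
  { apply (smooth1_of_smooth_near _ (t0, 0, 0, 0)).
    apply (smooth_near_ext_loc (fun z => / 4 * pull2 (fun x _ => k x) z)).
    - apply filter_forall. now intros [[[x u] p] q].
    - apply smooth_near_mult; [apply smooth_near_const | now apply smooth_near_of_smooth1]. }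
  (* The initial value 1 keeps y nonzero near t0, so that y' / y is defined. *)
  destruct (linear_ode_smooth 1 (fun t => / 4 * k t) (fun _ => 0) t0 1 Sk4) as (y & y0 & Sy & Ey).
  { unfold smooth1_near. apply filter_forall. intros t [|n]; [exact I|].
    apply (ex_derive_n_const 0 (S n)). }
  assert (Sy1 := smooth1_near_Derive _ _ Sy).
  exists (fun x u => 2 * Derive y (phi x u) / y (phi x u)). unfold aux_H.
  assert (HE : pull2 (fun x u => 2 * Derive y (phi x u) / y (phi x u))
    = fun z => 2 * Derive y (pull2 phi z) / y (pull2 phi z)).
  { jet_ext. }
  rewrite HE. split.
  - apply smooth_near_div.
    + apply smooth_near_mult; [apply smooth_near_const | now apply smooth_near_comp1].
    + now apply smooth_near_comp1.
    + fold t0. rewrite y0. lra.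
  - assert (Cphi := smooth_near_continuous _ _ Sphi).
    assert (Ly : locally t0 (fun t => Derive_n y 2 t = / 4 * k t * y t + 0 /\
      (y t <> 0 /\ smooth1_near y t))).
    { assert (Cy : continuous y t0).
      { apply @ex_derive_continuous. now apply smooth1_near_ex_derive. }
      assert (Ny : locally t0 (fun t => y t <> 0)).
      { apply (Cy (fun v => v <> 0)). apply (open_neq 0 (y t0)). rewrite y0. lra. }
      exact (filter_and _ _ Ey (filter_and _ _ Ny (smooth1_near_locally _ _ Sy))). }
    generalize (filter_and _ _ (filter_and _ _ (near U (fun z Z => Z)) (Cphi _ Ly))
      (filter_and _ _ (filter_and _ _ RK Ek) (filter_and _ _ Ephi (locally_dif _ _ Sphi)))).
    apply filter_imp. intros z ((Z & E2 & Ny & Syz) & (EK & Ekz) & Ej & dphi).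
    set (t := pull2 phi z) in *.
    assert (Hd : is_derive (fun t => 2 * Derive y t / y t) t
      (2 * Derive_n y 2 t / y t - 2 * Derive y t ^ 2 / y t ^ 2)).
    { pose proof (smooth1_near_ex_derive _ _ Syz).
      pose proof (smooth1_near_ex_derive _ _ (smooth1_near_Derive _ _ Syz)).
      auto_derive; [repeat split; auto|].
      change (Derive (fun x => Derive (fun x0 => y x0) x) t) with (Derive_n y 2 t).
      change (Derive (fun x => Derive y x) t) with (Derive_n y 2 t).
      change (Derive (fun x => y x) t) with (Derive y t). field. auto. }
    assert (DH := derivation_comp (D f) (D_derivation f) (fun t => 2 * Derive y t / y t)
      (pull2 phi) z _ dphi Hd).
    assert (DH' : D f (fun z => 2 * Derive y (pull2 phi z) / y (pull2 phi z)) z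
      = (2 * Derive_n y 2 t / y t - 2 * Derive y t ^ 2 / y t ^ 2) * j z)
      by (rewrite <- Ej; exact DH).
    rewrite DH', EK, Ekz, E2. fold j t. pose proof (J_nz z Z). eq_in_R. field. auto.
Qed.

Section WithH.

Variable H : R -> R -> R.
Let h := pull2 H.
Hypothesis Sh : smooth_on U h.
Hypothesis H_eq : forall z, U z -> 2 / j z * D f h z + h z ^ 2 = K f z.

Lemma D_h z : U z -> D f h z = j z * (K f z - h z ^ 2) / 2.
Proof. intros Z. rewrite <- H_eq by auto. pose proof (J_nz z Z). field. auto. Qed.

(** As h depends on (x, u) only, the p-derivative of D h is h_u; applied to D h = J (K - h^2) / 2
    this gives h_u = J_p (K - h^2) / 2. *)
Lemma h_u z : U z -> j z * partial cu h z = partial cp j z * D f h z.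
Proof.
  intros Z. pose proof J_smooth as SJ. pose proof K_smooth as SK.
  assert (E : partial cu h z = partial cp j z * (K f z - h z ^ 2) / 2).
  { transitivity (partial cp (D f h) z).
    - rewrite (partial_D_first_order f U O Sf) by (auto; intros; apply pull2_q).
      rewrite (derivation_zero U O (D f) (partial cp h)); auto using D_derivation.
      + ring.
      + intros; apply pull2_p.
    - derive_using U (fun y => j y * (K f y - h y ^ 2) / 2) D_h.
      rewrite K_p by auto. unfold h. rewrite pull2_p. field. }
  rewrite D_h, E by auto. field.
Qed.

Lemma jh_q z : U z -> partial cq (fun y => j y * h y) z = 0.
Proof.
  intros Z. pose proof J_smooth.
  derive_using U (fun y => j y * h y) (fun y _ => eq_refl).
  rewrite J_q by auto. unfold h. rewrite pull2_q. ring.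
Qed.

Lemma jh_p z : U z -> partial cp (fun y => j y * h y) z = partial cp j z * h z.
Proof.
  intros Z. pose proof J_smooth.
  derive_using U (fun y => j y * h y) (fun y _ => eq_refl).
  unfold h. rewrite pull2_p. ring.
Qed.

(** By [J_u] and [h_u], (J h)_u = D(J_p) h + J_p D h = D(J_p h). *)
Lemma jh_closed z : U z ->
  partial cu (fun y => j y * h y) z = D f (partial cp (fun y => j y * h y)) z.
Proof.
  intros Z. pose proof J_smooth.
  derive_using U (fun y => j y * h y) (fun y _ => eq_refl).
  symmetry. derive_using U (fun y => partial cp j y * h y) jh_p.
  rewrite <- J_u, h_u by auto. ring.
Qed.

(** A potential of J H serves as log b, so b is an exponential and has no zero. *)
Lemma exists_b : exists b : R -> R -> R, aux_b f H b P.
Proof.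
  pose proof J_smooth as SJ.
  destruct (potential f (fun y => j y * h y) U P O Sf) as (Phi & SPhi & EPhi);
    auto using jh_q, jh_closed.
  { now apply smooth_on_mult. }
  exists (fun x u => exp (Phi x u)). unfold aux_b.
  assert (E : pull2 (fun x u => exp (Phi x u)) = fun z => exp (pull2 Phi z)).
  { jet_ext. }
  rewrite E. split; [now apply smooth_near_exp|].
  generalize (filter_and _ _ EPhi (locally_dif _ _ SPhi)). apply filter_imp.
  intros z (Ez & dz). split; [apply Rgt_not_eq, exp_pos|].
  rewrite (derivation_comp (D f) (D_derivation f) exp (pull2 Phi) z (exp (pull2 Phi z)) dz)
    by (apply is_derive_Reals, derivable_pt_lim_exp).
  rewrite Ez. fold j h. eq_in_R. ring.
Qed.

(** The right side of the equation for log a_1 depends on q through D J / J - f_q / 3. Adding D log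
    |J| cancels this dependence by I_5: the function 2 D J / J - f_q / 3 - J H satisfies the
    conditions of [potential], so it equals D Phi, and a_1 = exp(Phi) / J. *)
Lemma exists_a1 : exists a1 : R -> R -> R -> R, aux_a1 f H a1 P.
Proof.
  pose proof J_smooth as SJ. pose proof J_nz as Nj.
  set (l := fun y => D f j y / j y).
  assert (Sl : smooth_on U l).
  { apply smooth_on_div; auto using J_nz. now apply smooth_on_D. }
  assert (SF : smooth_on U (partial cq f)) by now apply smooth_on_partial.
  set (s := fun y => 2 * l y + (- / 3) * partial cq f y).
  assert (Ss : smooth_on U s) by (unfold s; solve_smooth).
  assert (Es : forall z, U z -> euler f s z = 0).
  { intros z Z. rewrite (euler_linear f U O Sf 2 (- / 3) s l (partial cq f)); auto.
    rewrite euler_fq by auto. unfold l.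
    rewrite (euler_log_derivative f U O Sf j); auto using J_nz, J_q. ring. }
  assert (sq : forall z, U z -> partial cq s z = 0).
  { intros z Z.
    assert (lq : partial cq l z = partial cp j z / j z).
    { derive_using U (fun y => D f j y / j y) (fun y _ => eq_refl).
      rewrite (partial_q_D_first_order f U), J_q by auto using J_q. field. now apply J_nz. }
    derive_using U (fun y => 2 * l y + (- / 3) * partial cq f y) (fun y _ => eq_refl).
    rewrite lq, fqq_J by auto. field. now apply J_nz. }
  (* With s_q = 0, the vanishing of the variational derivative of s is exactly the closedness that
     [potential] asks for. *)
  assert (su : forall z, U z -> partial cu s z = D f (partial cp s) z).
  { intros z Z. specialize (Es z Z). unfold euler in Es.
    rewrite (derivation_zero U O (D f) (D f (partial cq s))) in Es; auto using D_derivation.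
    - lra.
    - intros y Y. apply (derivation_zero U O); auto using D_derivation. }
  set (jh := fun y => j y * h y) in *.
  assert (Sjh : smooth_on U jh) by now apply smooth_on_mult.
  set (g := fun y => s y - jh y).
  assert (Sg : smooth_on U g) by now apply smooth_on_minus.
  assert (gd : forall d z, derivation d -> U z -> d g z = d s z - d jh z).
  { intros d z Dd Z. derive_using U (fun y => s y - jh y) (fun y _ => eq_refl). ring. }
  destruct (potential f g U P O Sf Sg UP) as (Phi & SPhi & EPhi).
  { intros z Z. rewrite gd, sq, jh_q by auto using partial_derivation. ring. }
  { intros z Z. rewrite gd, su, jh_closed by auto using partial_derivation.
    symmetry. derive_using U (fun y => partial cp s y - partial cp jh y)
      (fun y Y => gd (partial cp) y (partial_derivation cp) Y). reflexivity. }
  assert (RJ := reduce_q j P (smooth_on_near U j P O UP SJ)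
    (locally_open_ext U _ P O UP J_q)).
  (* J with q frozen at its base value, since a_1 has to be a function of (x, u, p); it agrees with
     J near [P]. *)
  set (j3 := fun x u p => j (x, u, p, coordinate cq P)) in *.
  exists (fun x u p => exp (Phi x u) / j3 x u p). unfold aux_a1.
  assert (E : pull3 (fun x u p => exp (Phi x u) / j3 x u p)
              = fun z => exp (pull2 Phi z) / pull3 j3 z).
  { jet_ext. }
  rewrite E.
  assert (L : locally P (fun z => exp (pull2 Phi z) / j z = exp (pull2 Phi z) / pull3 j3 z)).
  { refine (filter_imp _ _ _ RJ). intros z ->. reflexivity. }
  split.
  - apply (smooth_near_ext_loc _ _ _ L). apply smooth_near_div.
    + now apply smooth_near_exp.
    + now apply (smooth_on_near U).
    + now apply J_nz.
  - assert (LU : locally P U) by now apply O.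
    generalize (filter_and _ _ (filter_and _ _ LU (locally_locally _ _ L))
      (filter_and _ _ EPhi (locally_dif _ _ SPhi))).
    apply filter_imp. intros z ((Z & Lz) & Ez & dz).
    assert (DE : D f (fun z => exp (pull2 Phi z) / j z) z
      = D f (fun z => exp (pull2 Phi z) / pull3 j3 z) z)
      by exact (derivation_ext (D f) (D_derivation f) _ _ z Lz).
    rewrite <- DE.
    assert (Lz0 := locally_singleton _ _ Lz). simpl in Lz0. rewrite <- Lz0.
    pose proof (J_nz z Z) as Nz.
    assert (X := isd_div (D f) (D_derivation f) (fun z => exp (pull2 Phi z)) j z _ _
      (isd_comp (D f) (D_derivation f) exp (pull2 Phi) z _ _
        (isd_refl (D f) _ _ dz) (proj2 (is_derive_Reals _ _ _) (derivable_pt_lim_exp _)))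
      (isd_refl (D f) j z (smooth_on_dif U j z SJ Z)) Nz).
    destruct X as (_ & ->). rewrite Ez. split.
    + apply Rmult_integral_contrapositive. split; [apply Rgt_not_eq, exp_pos|].
      now apply Rinv_neq_0_compat.
    + unfold g, s, l, jh. fold j h. eq_in_R. field. auto.
Qed.

Section WithB.

Variables (b : R -> R -> R) (a1 : R -> R -> R -> R).
Let bb := pull2 b.
Let aa := pull3 a1.
Hypotheses (Sb : smooth_on U bb) (Sa : smooth_on U aa).
Hypotheses (b_nz : forall z, U z -> bb z <> 0) (a1_nz : forall z, U z -> aa z <> 0).
Hypothesis b_eq : forall z, U z -> D f bb z = j z * h z * bb z.
Hypothesis a1_eq : forall z, U z ->
  D f aa z = (D f j z / j z - 1 / 3 * partial cq f z - j z * h z) * aa z.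

Lemma bb_p z : partial cp bb z = 0.
Proof. apply pull2_p. Qed.

Lemma bb_q z : partial cq bb z = 0.
Proof. apply pull2_q. Qed.

Lemma b_u z : U z -> partial cu bb z = partial cp j z * h z * bb z.
Proof.
  intros Z. pose proof J_smooth.
  transitivity (partial cp (D f bb) z).
  - rewrite (partial_D_first_order f U O Sf) by (auto; intros; apply pull2_q).
    rewrite (derivation_zero U O (D f) (partial cp bb)); auto using D_derivation.
    + ring.
    + intros; apply pull2_p.
  - derive_using U (fun y => j y * h y * bb y) b_eq.
    unfold bb, h. rewrite !pull2_p. ring.
Qed.

Lemma jb_p z : U z -> partial cp (fun y => j y / bb y) z = partial cp j z / bb z.
Proof.
  intros Z. pose proof J_smooth. pose proof b_nz as Nb.
  derive_using U (fun y => j y / bb y) (fun y _ => eq_refl).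
  rewrite bb_p. field. auto.
Qed.

(** J b_u and J_p D b both equal J J_p H b, which makes J / b closed in the sense of [potential]. *)
Lemma exists_phi : exists phi : R -> R -> R, smooth_near (pull2 phi) P /\
  locally P (fun z => D f (pull2 phi) z = j z / bb z).
Proof.
  pose proof J_smooth as SJ. pose proof b_nz as Nb.
  apply (potential f (fun y => j y / bb y) U P); auto.
  - now apply smooth_on_div.
  - intros z Z. derive_using U (fun y => j y / bb y) (fun y _ => eq_refl).
    rewrite bb_q, J_q by auto. field. auto.
  - intros z Z. derive_using U (fun y => j y / bb y) (fun y _ => eq_refl).
    symmetry. derive_using U (fun y => partial cp j y / bb y) jb_p.
    rewrite J_u, b_u, b_eq by auto. field. auto.
Qed.

Lemma aa_q z : partial cq aa z = 0.
Proof. destruct z as [[[x u] p] q]. exact (Derive_const (a1 x u p) q). Qed.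

(** The q-derivative of D a_1 is (a_1)_p, and that of the right side of its equation is (J_p / J - 2
    J_p / J) a_1 by I_5. Hence J a_1 does not depend on p. *)
Lemma aa_p z : U z -> partial cp aa z = - partial cp j z / j z * aa z.
Proof.
  intros Z. pose proof J_smooth as SJ. pose proof J_nz as Nj.
  transitivity (partial cq (D f aa) z).
  - symmetry. apply (partial_q_D_first_order f U); auto using aa_q.
  - derive_using U (fun y => (D f j y / j y - 1 / 3 * partial cq f y - j y * h y) * aa y)
      a1_eq.
    rewrite (partial_q_D_first_order f U), aa_q, J_q, fqq_J by auto using J_q.
    unfold h. rewrite pull2_q. field. auto.
Qed.

(** J a_1 / b is a function of (x, u), so once phi is known it can be prescribed as a Jacobian. *)
Lemma exists_phi_psi : exists phi psi : R -> R -> R, transformation_system f b a1 phi psi P.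
Proof.
  pose proof J_smooth as SJ. pose proof J_nz as Nj. pose proof b_nz as Nb.
  destruct exists_phi as (phi & Sphi & Ephi).
  set (de := fun z => j z * aa z / bb z).
  assert (Sde : smooth_on U de) by (unfold de; solve_smooth).
  assert (near : forall Q : jet -> Prop, (forall z, U z -> Q z) -> locally P Q).
  { intros Q HQ. now apply (locally_open_ext U). }
  assert (Rd : locally P (fun z => de z
    = pull2 (fun x u => de (x, u, coordinate cp P, coordinate cq P)) z)).
  { apply reduce_pq; [now apply (smooth_on_near U) | apply near; intros z Z ..].
    - derive_using U (fun z => j z * aa z / bb z) (fun y _ => eq_refl).
      rewrite bb_p, aa_p by auto. field. auto.
    - derive_using U (fun z => j z * aa z / bb z) (fun y _ => eq_refl).
      rewrite bb_q, aa_q, J_q by auto. field. auto. }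
  destruct (jacobian_prescribed phi _ P Sphi
    (smooth_near_ext_loc _ _ P Rd (smooth_on_near U de P O UP Sde))) as (psi & Spsi & Epsi).
  { rewrite (total_pull2_D f), (locally_singleton _ _ Ephi).
    apply Rmult_integral_contrapositive_currified; auto. now apply Rinv_neq_0_compat, Nb. }
  exists phi, psi. split; [exact Sphi|]. split; [exact Spsi|].
  generalize (filter_and _ _ Ephi (filter_and _ _ Rd Epsi)). apply filter_imp.
  intros z (E1 & E2 & E3). split; [exact E1|]. rewrite E3, <- E2. reflexivity.
Qed.

(** * Sufficiency: the transformed equation for an arbitrary solution of the system *)

Section WithTransformation.

Variables phi psi : R -> R -> R.
Let ph := pull2 phi.
Let ps := pull2 psi.
Hypotheses (Sphi : smooth_on U ph) (Spsi : smooth_on U ps).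
Hypothesis phi_eq : forall z, U z -> D f ph z = j z / bb z.
Hypothesis jac_eq : forall z, U z -> jacobian phi psi z = j z * aa z / bb z.

Let A := D f ph.
Let m := vertical f ph ps.

Lemma Dphi_nz z : U z -> A z <> 0.
Proof.
  intros Z. unfold A. rewrite phi_eq by auto.
  apply Rmult_integral_contrapositive_currified; [now apply J_nz|].
  now apply Rinv_neq_0_compat, b_nz.
Qed.

Lemma vertical_a1 z : U z -> m z = aa z.
Proof.
  intros Z. pose proof (Dphi_nz z Z) as N. apply (Rmult_eq_reg_l (A z)); auto.
  unfold A, m, ph, ps. rewrite <- (jacobian_vertical f U) by auto using Dphi_nz.
  rewrite jac_eq by auto. fold ph. rewrite phi_eq by auto.
  pose proof (b_nz z Z). field. auto.
Qed.

Lemma vertical_nz z : U z -> m z <> 0.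
Proof. intros Z. rewrite vertical_a1 by auto. auto. Qed.

Lemma J_b_Dphi z : U z -> j z = bb z * A z.
Proof.
  intros Z. unfold A. rewrite phi_eq by auto. pose proof (b_nz z Z). field. auto.
Qed.

Lemma Dphi_vertical_smooth : smooth_on U m.
Proof. apply vertical_smooth; auto using Dphi_nz. Qed.

Lemma Dphi_smooth : smooth_on U A.
Proof. now apply smooth_on_D. Qed.

(** The equation for a_1 solved for f_q, with m = a_1 and A = J / b. *)
Lemma transformed_fq z : U z -> partial cq f z = 3 * (D f A z / A z - D f m z / m z).
Proof.
  intros Z. pose proof J_smooth as SJ. pose proof J_nz as Nj. pose proof b_nz as Nb.
  assert (DA : D f A z = (D f j z * bb z - j z * D f bb z) / bb z ^ 2).
  { derive_using U (fun y => j y / bb y) phi_eq. reflexivity. }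
  rewrite DA, (derivation_on U O (D f) m aa z) by auto using D_derivation, vertical_a1.
  rewrite a1_eq, b_eq, vertical_a1 by auto. unfold A. rewrite phi_eq by auto.
  pose proof (a1_nz z Z). field. auto.
Qed.

(** The Riccati equation and K = I_8 / J^4 cancel the main term of [I8_form], leaving J^2 times the
    defect of f_p. *)
Lemma transformed_fp z : U z -> partial cp f z = form_p f A m z.
Proof.
  intros Z. pose proof (J_nz z Z) as Nj.
  assert (E := I8_form f U A m O Sf Dphi_smooth Dphi_vertical_smooth Dphi_nz vertical_nz transformed_fq bb h z
    Sb Sh b_nz J_b_Dphi b_eq Z).
  fold j in E. rewrite (H_eq z Z) in E. unfold K in E. fold j in E.
  assert (E' : j z ^ 2 * (partial cp f z - form_p f A m z) = 0).
  { replace (I8 f z) with (j z ^ 4 * (I8 f z / j z ^ 4)) in E at 1 by (field; auto). lra. }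
  apply Rmult_integral in E'. destruct E' as [E' | E']; [|lra].
  exfalso. now apply (pow_nonzero (j z) 2 Nj).
Qed.

Lemma transformed_fu z : U z -> partial cu f z = (bb z * A z) ^ 3 + form_u f A m z.
Proof.
  intros Z. assert (E := I3_form f U A m O Sf Dphi_smooth Dphi_vertical_smooth Dphi_nz vertical_nz transformed_fq z
    Z transformed_fp).
  rewrite <- J_cube in E. fold j in E. rewrite J_b_Dphi in E by auto. lra.
Qed.

(** As phi_u = A_p = J_p / b, both sides equal J J_p H; in terms of x and u this is the vanishing
    Jacobian of b and phi. *)
Lemma b_depends_on_phi z : U z -> A z * partial cu bb z = partial cu ph z * D f bb z.
Proof.
  intros Z. pose proof J_smooth as SJ. pose proof (b_nz z Z).
  destruct (A_derivatives f U ph O Sf Sphi (fun z _ => pull2_p phi z)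
    (fun z _ => pull2_q phi z) z Z) as (_ & <- & _).
  fold A. rewrite (derivation_on U O (partial cp) A (fun y => j y / bb y) z)
    by auto using partial_derivation.
  rewrite jb_p, b_u, b_eq by auto. unfold A. rewrite phi_eq by auto. field. auto.
Qed.

(** The inhomogeneous term c(xbar) of the transformed equation. *)
Let res := fun z => along3 f ph ps z - bb z ^ 3 * ps z.

Lemma residual_smooth : smooth_on U res.
Proof.
  pose proof Dphi_nz as N. pose proof Dphi_smooth as S1.
  assert (S2 : smooth_on U (along2 f ph ps)) by now apply along2_smooth.
  assert (S3 : smooth_on U (along3 f ph ps)).
  { apply smooth_on_div; auto. now apply smooth_on_D. }
  unfold res. solve_smooth.
Qed.

(** The computation of [canonical_forms] in reverse: the known f_q and f_p make the q- and
    p-derivatives vanish, and f_u gives the last clause, the vanishing Jacobian of the residual and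
    phi. *)
Lemma residual_derivatives z : U z ->
  partial cq res z = 0 /\ partial cp res z = 0 /\
  A z * partial cu res z = partial cu ph z * D f res z.
Proof.
  intros Z. pose proof Dphi_nz as N. pose proof Dphi_smooth as S1. pose proof vertical_nz as Nm.
  assert (S2 : smooth_on U (along2 f ph ps)) by now apply along2_smooth.
  assert (S3 : smooth_on U (along3 f ph ps)).
  { apply smooth_on_div; auto. now apply smooth_on_D. }
  destruct (along3_derivatives f U ph ps O Sf Sphi Spsi (fun z _ => pull2_p phi z)
    (fun z _ => pull2_q phi z) (fun z _ => pull2_p psi z) (fun z _ => pull2_q psi z)
    Dphi_nz z Z) as (Hq & Hp & Hu). fold A m in Hq, Hp, Hu.
  pose proof (N z Z) as Az. pose proof (Nm z Z) as mz.
  assert (dr : forall d, derivation d -> d res z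
    = d (along3 f ph ps) z - (3 * bb z ^ 2 * d bb z * ps z + bb z ^ 3 * d ps z)).
  { intros d Dd.
    derive_using U (fun z => along3 f ph ps z - bb z ^ 3 * ps z) (fun y _ => eq_refl).
    simpl. ring. }
  rewrite !dr by auto using partial_derivation, D_derivation.
  split; [|split].
  - replace (partial cq bb z) with 0 by (symmetry; apply pull2_q).
    replace (partial cq ps z) with 0 by (symmetry; apply pull2_q).
    apply (Rmult_eq_reg_l (A z)); auto. rewrite Rmult_minus_distr_l, Hq, transformed_fq
      by auto. field. auto.
  - replace (partial cp bb z) with 0 by (symmetry; apply pull2_p).
    replace (partial cp ps z) with 0 by (symmetry; apply pull2_p).
    apply (Rmult_eq_reg_l (A z)); auto. rewrite Rmult_minus_distr_l, Hp, transformed_fp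
      by auto. unfold form_p. field. auto.
  - assert (Am : A z * partial cu ps z - partial cu ph z * D f ps z = A z * m z).
    { unfold m, vertical, along1. fold A. field. auto. }
    assert (E : A z * partial cu (along3 f ph ps) z
      - partial cu ph z * D f (along3 f ph ps) z = bb z ^ 3 * (A z * m z)).
    { rewrite Hu, transformed_fu by auto. unfold form_u. field. auto. }
    pose proof (b_depends_on_phi z Z) as Eb.
    apply Rminus_diag_uniq.
    transitivity ((A z * partial cu (along3 f ph ps) z
      - partial cu ph z * D f (along3 f ph ps) z)
      - bb z ^ 3 * (A z * partial cu ps z - partial cu ph z * D f ps z)
      - 3 * bb z ^ 2 * ps z * (A z * partial cu bb z - partial cu ph z * D f bb z));
      [ring|].
    rewrite E, Am, Eb. ring.
Qed.

(** In A g_u - phi_u D g the terms with p cancel, leaving the Jacobian phi_x g_u - phi_u g_x. *)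
Lemma function_of_phi (g : R -> R -> R) :
  smooth_near (pull2 g) P ->
  locally P (fun z => A z * partial cu (pull2 g) z = partial cu ph z * D f (pull2 g) z) ->
  exists r : R -> R, smooth1_near r (ph P) /\ locally P (fun z => pull2 g z = r (ph z)).
Proof.
  intros Sg E. apply (function_of g phi P Sg).
  - now apply (smooth_on_near U).
  - rewrite (total_pull2_D f). now apply Dphi_nz.
  - refine (filter_imp _ _ _ E). intros z Ez. unfold A, ph in Ez.
    rewrite <- !(total_pull2_D f 0), !total_pull2 in Ez. eq_in_R. lra.
Qed.

(** Subtracting g(phi) from psi lowers each ubar_i by g^(i)(phi) and changes neither m nor the
    Jacobian. If g''' = abar^3 g + rho with rho the residual, then abar^3 psi + rho - g''' = abar^3
    (psi - g). *)
Lemma corrected_transformation : exists g abar : R -> R,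
  smooth1_near g (pull2 phi P) /\
  let psi' := fun x u => psi x u - g (phi x u) in
  transformation_system f b a1 phi psi' P /\
  carries_to_canonical f phi psi' abar P /\
  locally P (fun z => abar (pull2 phi z) = pull2 b z).
Proof.
  assert (LU : locally P U) by now apply O.
  assert (near : forall Q : jet -> Prop, (forall z, U z -> Q z) -> locally P Q).
  { intros Q HQ. now apply (locally_open_ext U). }
  destruct (function_of_phi b (smooth_on_near U bb P O UP Sb) (near _ b_depends_on_phi))
    as (abar & Sab & Eab).
  pose proof residual_smooth as Sr.
  assert (Rr := reduce_pq res P (smooth_on_near U res P O UP Sr)
    (near _ (fun z Z => proj1 (proj2 (residual_derivatives z Z))))
    (near _ (fun z Z => proj1 (residual_derivatives z Z)))).
  set (res2 := fun x u => res (x, u, coordinate cp P, coordinate cq P)) in *.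
  destruct (function_of_phi res2) as (rho & Srho & Erho).
  { apply (smooth_near_ext_loc res); auto. now apply (smooth_on_near U). }
  { generalize (filter_and _ _ LU (locally_locally _ _ Rr)). apply filter_imp.
    intros z (Z & L).
    rewrite <- (derivation_ext (partial cu) (partial_derivation cu) _ _ z L).
    rewrite <- (derivation_ext (D f) (D_derivation f) _ _ z L).
    now apply residual_derivatives. }
  set (t0 := ph P) in *.
  assert (Sab3 : smooth1_near (fun t => abar t ^ 3) t0).
  { apply (smooth1_of_smooth_near _ (t0, 0, 0, 0)).
    assert (S1 := smooth_near_of_smooth1 abar (t0, 0, 0, 0) Sab).
    apply (smooth_near_ext_loc (fun z => pull2 (fun x _ => abar x) z
      * (pull2 (fun x _ => abar x) z * pull2 (fun x _ => abar x) z))).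
    - apply filter_forall. intros [[[x u] p] q]. simpl. eq_in_R. ring.
    - now repeat apply smooth_near_mult. }
  (* A third order equation, as the order is one more than the first argument; the initial value 0
     is an arbitrary choice. *)
  destruct (linear_ode_smooth 2 (fun t => abar t ^ 3) rho t0 0 Sab3 Srho)
    as (g & _ & Sg & Eg).
  exists g, abar. split; [exact Sg|]. intros psi'.
  assert (Cphi : continuous ph P) by now apply (smooth_on_continuous U).
  assert (L1 : locally P (fun z => smooth1_near abar (ph z)))
    by exact (Cphi _ (smooth1_near_locally _ _ Sab)).
  assert (L2 : locally P (fun z => smooth1_near g (ph z)))
    by exact (Cphi _ (smooth1_near_locally _ _ Sg)).
  assert (L3 : locally P (fun z => Derive_n g 3 (ph z) = abar (ph z) ^ 3 * g (ph z)
    + rho (ph z))) by exact (Cphi _ Eg).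
  destruct (locally_open_nbhd P _ (filter_and _ _ (filter_and _ _ LU Eab)
    (filter_and _ _ (filter_and _ _ Rr Erho) (filter_and _ _ L1 (filter_and _ _ L2 L3)))))
    as (V & OV & VP & HV).
  assert (VU : forall z, V z -> U z) by (intros z Z; from_conj (HV z Z)).
  assert (Sf' : smooth_on V f) by now apply (smooth_on_subset U).
  assert (Sph' : smooth_on V ph) by now apply (smooth_on_subset U).
  assert (Sps' : smooth_on V ps) by now apply (smooth_on_subset U).
  assert (N' : forall z, V z -> D f ph z <> 0) by (intros; apply Dphi_nz; auto).
  assert (Sgz : forall z, V z -> smooth1_near g (ph z)) by (intros z Z; from_conj (HV z Z)).
  assert (Saz : forall z, V z -> smooth1_near abar (ph z))
    by (intros z Z; from_conj (HV z Z)).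
  assert (Ebz : forall z, V z -> bb z = abar (ph z)) by (intros z Z; from_conj (HV z Z)).
  assert (Erz : forall z, V z -> along3 f ph ps z = bb z ^ 3 * ps z + rho (ph z)).
  { intros z Z. assert (E : res z = rho (ph z)).
    { transitivity (pull2 res2 z); from_conj (HV z Z). }
    unfold res in E. lra. }
  assert (Egz : forall z, V z -> Derive_n g 3 (ph z) = abar (ph z) ^ 3 * g (ph z)
    + rho (ph z)) by (intros z Z; from_conj (HV z Z)).
  set (G := fun n z => Derive_n g n (ph z)).
  assert (Sgn : forall n z, V z -> smooth1_near (Derive_n g n) (ph z)).
  { intros n z Z. induction n as [|n IH]; [now apply Sgz|]. now apply smooth1_near_Derive. }
  assert (SG : forall n, smooth_on V (G n)).
  { intros n z Z. apply (locally_singleton z).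
    apply smooth_near_comp1; [now apply (near_of_on V) | now apply Sgn]. }
  assert (DG : forall d n z, derivation d -> V z -> d (G n) z = G (S n) z * d ph z).
  { intros d n z Dd Z. apply (derivation_comp d Dd); [now apply (smooth_on_dif V)|].
    apply Derive_correct, smooth1_near_ex_derive. now apply Sgn. }
  assert (Eps : pull2 psi' = fun z => ps z - G 0%nat z).
  { jet_ext. }
  assert (Sps2 : smooth_on V (pull2 psi')).
  { rewrite Eps. apply smooth_on_minus; auto. }
  assert (dps : forall d z, derivation d -> V z ->
    d (pull2 psi') z = d ps z - G 1%nat z * d ph z).
  { intros d z Dd Z. pose proof (SG 0%nat). rewrite Eps.
    derive_using V (fun z => ps z - G 0%nat z) (fun y _ => eq_refl).
    now rewrite DG by auto. }
  assert (S1 : smooth_on V (along1 f ph ps)) by now apply along1_smooth.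
  assert (S2 : smooth_on V (along2 f ph ps)) by now apply along2_smooth.
  assert (al1 : forall z, V z -> along1 f ph (pull2 psi') z = along1 f ph ps z - G 1%nat z).
  { intros z Z. unfold along1. rewrite dps by auto using D_derivation. field. auto. }
  assert (al2 : forall z, V z -> along2 f ph (pull2 psi') z = along2 f ph ps z - G 2%nat z).
  { intros z Z. unfold along2. pose proof (SG 1%nat).
    replace (D f (along1 f ph (pull2 psi')) z) with (D f (along1 f ph ps) z
      - D f (G 1%nat) z).
    - rewrite DG by auto using D_derivation. field. auto.
    - symmetry. derive_using V (fun z => along1 f ph ps z - G 1%nat z) al1. reflexivity. }
  assert (al3 : forall z, V z -> along3 f ph (pull2 psi') z = along3 f ph ps z - G 3%nat z).
  { intros z Z. unfold along3. pose proof (SG 2%nat).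
    replace (D f (along2 f ph (pull2 psi')) z) with (D f (along2 f ph ps) z
      - D f (G 2%nat) z).
    - rewrite DG by auto using D_derivation. field. auto.
    - symmetry. derive_using V (fun z => along2 f ph ps z - G 2%nat z) al2. reflexivity. }
  assert (mE : forall z, V z -> vertical f ph (pull2 psi') z = m z).
  { intros z Z. unfold m, vertical. rewrite al1, dps by auto using partial_derivation. ring. }
  assert (m_nz' : forall z, V z -> vertical f ph (pull2 psi') z <> 0).
  { intros z Z. rewrite mE by auto. apply vertical_nz; auto. }
  assert (canon : forall z, V z ->
    along3 f ph (pull2 psi') z = abar (ph z) ^ 3 * pull2 psi' z).
  { intros z Z. rewrite al3, Erz, Eps, Ebz by auto. unfold G at 1. rewrite Egz by auto.
    unfold G. simpl. ring. }
  assert (ab_nz : forall z, V z -> abar (ph z) <> 0).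
  { intros z Z. rewrite <- Ebz by auto. auto. }
  split; [|split; [split; [|split]|]].
  - split; [now apply (smooth_on_near U)|]. split; [now apply (smooth_on_near V)|].
    apply (locally_open_ext V); auto. intros z Z. split; [now apply phi_eq, VU|].
    rewrite (jacobian_vertical f V) by auto. fold ph. rewrite mE, vertical_a1, phi_eq by auto.
    pose proof (b_nz z (VU z Z)). fold j aa bb. field. auto.
  - exact Sab.
  - unfold four_symmetries.
    (* [four_symmetries] speaks of values xbar near phi(P). Each is phi(z) with z in V, where a zero
       derivative of [curvature abar] would force D K = 0. *)
    assert (LL := level_points phi P V (smooth_on_near U ph P O UP Sphi)
      ltac:(rewrite (total_pull2_D f); now apply Dphi_nz) (OV P VP)).
    refine (filter_imp _ _ _ LL). intros t (z & Z & <-). split; [now apply ab_nz|].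
    intros E. destruct (inv z (VU z Z)) as (_ & _ & _ & NK). apply NK.
    rewrite (derivation_K f V ph (pull2 psi') abar); auto using D_derivation;
      try (intros; first [apply pull2_p | apply pull2_q]).
    change (Derive (curvature abar) (ph z) = 0) in E. rewrite E. ring.
  - apply (carries_on f V); auto.
  - apply (locally_open_ext V); auto. intros z Z. symmetry. now apply Ebz.
Qed.

End WithTransformation.

End WithB.

End WithH.

End Sufficiency.

(** * The steps of the construction near a point *)

Lemma exists_auxiliary_b_a1 (f : jet -> R) (P : jet) (H : R -> R -> R) :
  smooth_near f P -> invariant_conditions f P -> aux_H f H P ->
  exists (b : R -> R -> R) (a1 : R -> R -> R -> R), aux_b f H b P /\ aux_a1 f H a1 P.
Proof.
  intros Sf Inv (SH & EH).
  destruct (locally_open_nbhd P _ (filter_and _ _ (filter_and _ _ Sf Inv)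
    (filter_and _ _ SH EH))) as (U & O & UP & HU).
  assert (Sf' : smooth_on U f) by (intros z Z; exact (proj1 (proj1 (HU z Z)))).
  assert (SH' : smooth_on U (pull2 H)) by (intros z Z; exact (proj1 (proj2 (HU z Z)))).
  destruct (exists_b f U P O UP Sf' (fun z Z => proj2 (proj1 (HU z Z))) H SH'
    (fun z Z => proj2 (proj2 (HU z Z)))) as (b & Hb).
  destruct (exists_a1 f U P O UP Sf' (fun z Z => proj2 (proj1 (HU z Z))) H SH'
    (fun z Z => proj2 (proj2 (HU z Z)))) as (a1 & Ha1).
  now exists b, a1.
Qed.

(** [T] carries whatever further local condition is at hand, so that one open set serves all of
    them. *)
Lemma auxiliary_open (f : jet -> R) (P : jet) (H b : R -> R -> R)
    (a1 : R -> R -> R -> R) (T : jet -> Prop) :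
  smooth_near f P -> invariant_conditions f P -> auxiliary f H b a1 P -> locally P T ->
  exists U, open U /\ U P /\ smooth_on U f /\ smooth_on U (pull2 H) /\
    smooth_on U (pull2 b) /\ smooth_on U (pull3 a1) /\
    (forall z, U z -> invariants_at f z) /\
    (forall z, U z -> 2 / J f z * D f (pull2 H) z + pull2 H z ^ 2 = K f z) /\
    (forall z, U z -> pull2 b z <> 0) /\
    (forall z, U z -> D f (pull2 b) z = (J f z * pull2 H z) * pull2 b z) /\
    (forall z, U z -> pull3 a1 z <> 0) /\
    (forall z, U z -> D f (pull3 a1) z
      = (D f (J f) z / J f z - 1 / 3 * partial cq f z - J f z * pull2 H z)
        * pull3 a1 z) /\
    (forall z, U z -> T z).
Proof.
  intros Sf Inv ((SH & EH) & (Sb & Eb) & (Sa & Ea)) HT.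
  destruct (locally_open_nbhd P _ (filter_and _ _ (filter_and _ _ (filter_and _ _ Sf SH)
    (filter_and _ _ Sb Sa)) (filter_and _ _ (filter_and _ _ Inv EH)
      (filter_and _ _ Eb (filter_and _ _ Ea HT))))) as (U & O & UP & HU).
  exists U. split; [exact O|]. split; [exact UP|].
  repeat match goal with |- _ /\ _ => split end;
    intros z Z; destruct (HU z Z) as (((A1 & A2) & A3 & A4) & (A5 & A6) & (A7 & A8)
      & (A9 & A10) & A11); assumption.
Qed.

Lemma exists_transformation (f : jet -> R) (P : jet) (H b : R -> R -> R)
    (a1 : R -> R -> R -> R) :
  smooth_near f P -> invariant_conditions f P -> auxiliary f H b a1 P ->
  exists phi psi : R -> R -> R, transformation_system f b a1 phi psi P.
Proof.
  intros Sf Inv Aux.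
  destruct (auxiliary_open f P H b a1 _ Sf Inv Aux (filter_true (F := locally P)))
    as (U & O & UP & Sf' & SH & Sb & Sa & Inv' & EH & Nb & Eb & Na & Ea & HT).
  apply (exists_phi_psi f U P O UP Sf') with (H := H); auto.
Qed.

Lemma transformation_correct (f : jet -> R) (P : jet) (H b : R -> R -> R)
    (a1 : R -> R -> R -> R) (phi psi : R -> R -> R) :
  smooth_near f P -> invariant_conditions f P -> auxiliary f H b a1 P ->
  transformation_system f b a1 phi psi P ->
  exists g abar : R -> R,
    smooth1_near g (pull2 phi P) /\
    let psi' := fun x u => psi x u - g (phi x u) in
    transformation_system f b a1 phi psi' P /\
    carries_to_canonical f phi psi' abar P /\
    locally P (fun z => abar (pull2 phi z) = pull2 b z).
Proof.
  intros Sf Inv Aux (Sphi & Spsi & E).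
  destruct (auxiliary_open f P H b a1 _ Sf Inv Aux
    (filter_and _ _ E (filter_and _ _ Sphi Spsi)))
    as (U & O & UP & Sf' & SH & Sb & Sa & Inv' & EH & Nb & Eb & Na & Ea & HT).
  apply (corrected_transformation f U P O UP Sf') with (H := H); auto; intros z Z;
    destruct (HT z Z) as ((T1 & T2) & T3 & T4); assumption.
Qed.

(* The equation jacobian = J a1 / b determines psi only up to psi + g(phi), and
   an arbitrary solution leads to ubar''' = abar^3 ubar + c(xbar); hence the
   correction g in the fourth clause of the construction. *)
Theorem theorem2p1 (f : jet -> R) (P : jet) (f_smooth : smooth_near f P) :
  (generic_point f P ->
     (equivalent_to_canonical f P <-> invariant_conditions f P)) /\
  (invariant_conditions f P ->
     (exists H : R -> R -> R, aux_H f H P) /\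
     (forall H : R -> R -> R, aux_H f H P ->
        exists (b : R -> R -> R) (a1 : R -> R -> R -> R),
          aux_b f H b P /\ aux_a1 f H a1 P) /\
     (forall (H b : R -> R -> R) (a1 : R -> R -> R -> R),
        auxiliary f H b a1 P ->
        exists phi psi : R -> R -> R, transformation_system f b a1 phi psi P) /\
     (forall (H b : R -> R -> R) (a1 : R -> R -> R -> R) (phi psi : R -> R -> R),
        auxiliary f H b a1 P ->
        transformation_system f b a1 phi psi P ->
        exists g abar : R -> R,
          smooth1_near g (pull2 phi P) /\
          let psi' := fun x u => psi x u - g (phi x u) in
          transformation_system f b a1 phi psi' P /\
          carries_to_canonical f phi psi' abar P /\
          locally P (fun z => abar (pull2 phi z) = pull2 b z)) /\
     (forall (phi psi : R -> R -> R) (abar : R -> R),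
        carries_to_canonical f phi psi abar P ->
        exists (H b : R -> R -> R) (a1 : R -> R -> R -> R),
          auxiliary f H b a1 P /\
          transformation_system f b a1 phi psi P /\
          locally P (fun z => abar (pull2 phi z) = pull2 b z))).

Proof.
  assert (step1 : invariant_conditions f P -> exists H : R -> R -> R, aux_H f H P).
  { intros Inv. destruct (locally_open_nbhd P _ (filter_and _ _ f_smooth Inv))
      as (U & O & UP & HU).
    apply (exists_H f U P O UP (fun z Z => proj1 (HU z Z)) (fun z Z => proj2 (HU z Z))). }
  split.
  - intros G. split; [now apply invariants_of_equivalent|]. intros Inv.
    destruct (step1 Inv) as (H & EH).
    destruct (exists_auxiliary_b_a1 f P H f_smooth Inv EH) as (b & a1 & Eb & Ea).
    assert (Aux : auxiliary f H b a1 P) by (split; [|split]; assumption).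
    destruct (exists_transformation f P H b a1 f_smooth Inv Aux) as (phi & psi & T).
    destruct (transformation_correct f P H b a1 phi psi f_smooth Inv Aux T)
      as (g & abar & _ & _ & C & _).
    now exists phi, (fun x u => psi x u - g (phi x u)), abar.
  - intros Inv. split; [now apply step1|]. split; [|split; [|split]].
    + intros H. now apply exists_auxiliary_b_a1.
    + intros H b a1. now apply exists_transformation.
    + intros H b a1 phi psi. now apply transformation_correct.
    + intros phi psi abar. now apply auxiliary_of_carries.
Qed.
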